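(* Let $(X,\mathcal{X},\mu)$ be a probability space, let $T_1,\ldots,T_\ell\colon X\to X$ be commuting, invertible measure preserving transformations, and let $A\in\mathcal{X}$. Then for every choice of distinct positive integers $d_1,\ldots,d_\ell$, and every $\varepsilon>0$, the set $$\{n\in\mathbb{N}\colon \mu(A\cap T_1^{-n^{d_1}}A\cap\cdots\cap T_\ell^{-n^{d_\ell}}A)\ge\mu(A)^{\ell+1}-\varepsilon\}$$ has bounded gaps.
   Context: $\mathbb{N}=\{1,2,\ldots\}$. A set $E\subset\mathbb{N}$ has bounded gaps if there is $L\in\mathbb{N}$ such that every interval of $L$ consecutive positive integers meets $E$. *)

(* Defs.v *)
From HB Require Import structures.
From mathcomp Require Import all_boot all_order all_algebra.
From mathcomp Require Import all_classical all_reals all_analysis.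

Set Implicit Arguments.
Unset Strict Implicit.
Unset Printing Implicit Defensive.

Import Order.TTheory GRing.Theory Num.Theory.

Local Open Scope classical_set_scope.
Local Open Scope ring_scope.

Definition measure_preserving (d : measure_display) (X : measurableType d)
    (R : realType) (mu : {measure set X -> \bar R}) (T : X -> X) : Prop :=
  measurable_fun [set: X] T /\
  forall B : set X, measurable B -> mu (T @^-1` B) = mu B.

(* Invertible in the measurable category: the inverse is required to be
   measurable (it then preserves [mu] too). *)
Definition invertible_measure_preserving (d : measure_display)
    (X : measurableType d) (R : realType) (mu : {measure set X -> \bar R})
    (T : X -> X) : Prop :=
  measure_preserving mu T /\
  exists S : X -> X,
    [/\ cancel T S, cancel S T & measurable_fun [set: X] S].

(* The positive integers are {1, 2, ...}; the interval of [L] consecutive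
   positive integers starting at [m] is {m, ..., m + L - 1}. *)
Definition bounded_gaps (E : set nat) : Prop :=
  exists L : nat, (0 < L)%N /\
    forall m : nat, (0 < m)%N ->
      exists n : nat, E n /\ (m <= n < m + L)%N.

(* Main.v *)
(** If the set of good [n] had unbounded gaps, averaging over longer and longer windows of bad [n]
    along an ultrafilter would give a shift-invariant mean [m] under which the correlation averages
    to at most [mu(A)^(l+1) - eps]; so it suffices to bound such means from below.  Sort the
    exponents increasingly and let [F_i] be the conditional expectation of [1_A] on the
    [T_i^r]-invariant functions, with [r] so divisible that replacing [r] by a multiple changes
    [F_i] little in [L^2].  Along [n = r n'], each factor [1_A] may be replaced by [F_i], the largest
    degree first, and [\int_A \prod_i F_i >= mu(A)^(l+1)] because [\int_A 1/F_i <= 1].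

    The replacement says that averages
    [\int f0 . \prod_i U(T_i^(p_i(n))) f_i . \prod_j theta_j^(r_j(n))] with degrees strictly
    increasing are small when the last function is orthogonal to its [N]-th power invariants.  PET
    induction (van der Corput) gives control by some Host-Kra box seminorm along the single
    transformation [T_k] of the last function; this also holds for the dual function [F].  The
    seminorm is then lowered one step at a time without nilsystems: the inverse theorem for the
    second-order seminorm turns the derivatives of [F] into eigenfunctions, whose eigenvalue products
    reappear in the averages as a polynomial phase [theta^(p_k(n))] of high degree replacing [T_k].
    By induction on the number of transformations, such averages only see phases with
    [theta^N = 1], i.e. invariants of a power, and the seminorm drops by one order.  *)

Require Import Defs.
From HB Require Import structures.
From mathcomp Require Import all_boot all_order all_algebra.
From mathcomp Require Import all_classical all_reals all_analysis.
From mathcomp Require Import measurable_realfun complex.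
From mathcomp Require Import ring lra zify.

Set Implicit Arguments.
Unset Strict Implicit.
Unset Printing Implicit Defensive.

Import Order.TTheory GRing.Theory Num.Theory.
Import numFieldNormedType.Exports.

Local Open Scope classical_set_scope.
Local Open Scope ring_scope.

(** * Shift-invariant means on bounded sequences *)

Section Means.
Variable R : realType.

(** Neither ergodicity nor convergence is available. Hence eigenvalues and phases are invariant
    functions instead of constants, and sets such as the one where [theta^N = 1] are cut out by
    indicator functions. Every estimate is finitary: constants and moduli are fixed before the mean
    and the functions, because each van der Corput step replaces the functions by others that depend
    on the shift. Seminorms therefore appear as averages over finite windows, whose lengths are
    multiples of a modulus since a linear exponent [c n] only sees multiples of [c]. The lowering of
    the order works for dual functions only: the inverse theorem selects an eigenfunction for each
    derivative with no relation between different parameters, and it is the averaged form of the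
    dual function that lets Cauchy-Schwarz remove this arbitrary dependence. Distinct degrees enter
    when a transformation is traded for a phase: the new phase has larger degree than every exponent
    that remains and smaller degree than every earlier phase, so the induction stays within families
    of strictly increasing degrees. *)

Definition bseq (u : nat -> R) := exists B, forall n, `|u n| <= B.

(** The functional is total, but its values on unbounded sequences are arbitrary; this is the origin
    of the [bseq] side conditions. *)
Record is_mean (m : (nat -> R) -> R) : Prop := IsMean {
  meanD : forall u v, bseq u -> bseq v -> m (fun n => u n + v n) = m u + m v;
  meanZ : forall c u, bseq u -> m (fun n => c * u n) = c * m u;
  mean_le : forall u v, bseq u -> bseq v -> (forall n, u n <= v n) -> m u <= m v;
  mean1 : m (fun=> 1) = 1;
  meanS : forall u, bseq u -> m (fun n => u n.+1) = m u }.

Lemma bseq_cst c : bseq (fun=> c).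
Proof. by exists `|c|. Qed.

Lemma bseqD u v : bseq u -> bseq v -> bseq (fun n => u n + v n).
Proof.
move=> [B hB] [C hC]; exists (B + C) => n.
by rewrite (le_trans (ler_normD _ _))// lerD.
Qed.

Lemma bseqM u v : bseq u -> bseq v -> bseq (fun n => u n * v n).
Proof.
move=> [B hB] [C hC]; exists (B * C) => n.
by rewrite normrM ler_pM.
Qed.

Lemma bseqZ c u : bseq u -> bseq (fun n => c * u n).
Proof. by move=> ?; apply: bseqM => //; exact: bseq_cst. Qed.

Lemma bseq_sum (I : Type) (r : seq I) (u : I -> nat -> R) :
  (forall i, bseq (u i)) -> bseq (fun n => \sum_(i <- r) u i n).
Proof.
move=> hu; elim: r => [|i r IH].
  by exists 0 => n; rewrite big_nil normr0.
have [B hB] := bseqD (hu i) IH.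
by exists B => n; rewrite big_cons.
Qed.

Lemma bseq_comp (h : nat -> nat) u : bseq u -> bseq (fun n => u (h n)).
Proof. by move=> [B hB]; exists B. Qed.

Variables (m : (nat -> R) -> R) (hm : is_mean m).

Lemma mean_cst c : m (fun=> c) = c.
Proof.
rewrite -[RHS]mulr1 -[in RHS](mean1 hm) -(meanZ hm) //; last exact: bseq_cst.
by congr m; apply: funext => n; rewrite mulr1.
Qed.

Lemma meanN u : bseq u -> m (fun n => - u n) = - m u.
Proof.
move=> hu; rewrite -mulN1r -(meanZ hm) //.
by congr m; apply: funext => n; rewrite mulN1r.
Qed.

Lemma meanB u v : bseq u -> bseq v -> m (fun n => u n - v n) = m u - m v.
Proof.
move=> hu hv; rewrite (meanD hm) ?meanN //.
by case: hv => B hB; exists B => n; rewrite normrN.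
Qed.

Lemma mean_sum (I : Type) (r : seq I) (u : I -> nat -> R) :
  (forall i, bseq (u i)) ->
  m (fun n => \sum_(i <- r) u i n) = \sum_(i <- r) m (u i).
Proof.
move=> hu; elim: r => [|i r IH].
  rewrite big_nil -[RHS]mean_cst; congr m; apply: funext => n.
  by rewrite big_nil.
rewrite big_cons -IH -(meanD hm) //; last exact: bseq_sum.
by congr m; apply: funext => n; rewrite big_cons.
Qed.

Lemma meanSn a u : bseq u -> m (fun n => u (n + a)%N) = m u.
Proof.
move=> hu; elim: a => [|a IH].
  by congr m; apply: funext => n; rewrite addn0.
rewrite -IH -[RHS](meanS hm); last exact: (bseq_comp (fun n => n + a)%N).
by congr m; apply: funext => n; rewrite addnS.
Qed.

Lemma mean_ge0 u : bseq u -> (forall n, 0 <= u n) -> 0 <= m u.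
Proof.
by move=> hu h0; rewrite -(mean_cst 0) (mean_le hm)//; exact: bseq_cst.
Qed.

Lemma mean_lec u c : bseq u -> (forall n, u n <= c) -> m u <= c.
Proof.
by move=> hu h0; rewrite -(mean_cst c) (mean_le hm)//; exact: bseq_cst.
Qed.

Lemma mean_sqr u : bseq u -> m u ^+ 2 <= m (fun n => u n ^+ 2).
Proof.
move=> hu; set c := m u.
have b2 : bseq (fun n => u n ^+ 2) by exact: bseqM.
have bc : bseq (fun n => - 2 * c * u n) by exact: bseqZ.
have bcc : bseq (fun=> c ^+ 2) by exact: bseq_cst.
have := @mean_ge0 (fun n => u n ^+ 2 + (- 2 * c * u n + c ^+ 2)).
have bd : bseq (fun n => - 2 * c * u n + c ^+ 2) by exact: bseqD.
rewrite (meanD hm)// (meanD hm)// (meanZ hm)// mean_cst -/c => h.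
have : 0 <= m (fun n => u n ^+ 2) + (-2 * c * c + c ^+ 2).
  apply: h; first by exact: bseqD.
  by move=> n; have := sqr_ge0 (u n - c); congr (_ <= _); ring.
by move=> h'; nra.
Qed.

Lemma mean_pow k u : bseq u -> m u ^+ (2 ^ k) <= m (fun n => u n ^+ (2 ^ k)).
Proof.
elim: k u => [|k IH] u hu; first by rewrite expn0 expr1.
rewrite expnS exprM.
have h2 : bseq (fun n => u n ^+ 2) by exact: bseqM.
apply: (le_trans _ (le_trans (IH _ h2) _)).
  apply: lerXn2r; rewrite ?nnegrE ?sqr_ge0//; last exact: mean_sqr.
  by apply: mean_ge0 => // n; exact: sqr_ge0.
rewrite le_eqVlt; apply/orP; left; apply/eqP; congr m.
by apply: funext => n; rewrite exprM.
Qed.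

End Means.

(** * Averages over finite windows *)

Section Avg.
Variable R : realType.
Implicit Types (f g : nat -> R).

(** The empty average is [0], because [0^-1 = 0]; several inequalities below thus hold for [H = 0]
    too. *)
Definition avg (H : nat) (f : nat -> R) : R := H%:R^-1 * \sum_(a < H) f a.

Lemma avg_ext H f g : (forall a, (a < H)%N -> f a = g a) -> avg H f = avg H g.
Proof. by move=> h; congr (_ * _); apply: eq_bigr => i _; exact: h. Qed.

Lemma avg_le H f g : (forall a, (a < H)%N -> f a <= g a) -> avg H f <= avg H g.
Proof.
move=> h; rewrite ler_wpM2l ?invr_ge0 ?ler0n// ler_sum// => i _; exact: h.
Qed.

Lemma avg_ge0 H f : (forall a, (a < H)%N -> 0 <= f a) -> 0 <= avg H f.
Proof. by move=> h; rewrite mulr_ge0 ?invr_ge0 ?ler0n// sumr_ge0// => i _; exact: h. Qed.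

Lemma avg_cst H c : (0 < H)%N -> avg H (fun=> c) = c.
Proof.
move=> H0; rewrite /avg sumr_const card_ord -[c *+ H]mulr_natl mulKf//.
by rewrite pnatr_eq0 -lt0n.
Qed.

Lemma avgD H f g : avg H (fun a => f a + g a) = avg H f + avg H g.
Proof. by rewrite /avg big_split/= mulrDr. Qed.

Lemma avgZ H c f : avg H (fun a => c * f a) = c * avg H f.
Proof. by rewrite /avg -mulr_sumr mulrCA. Qed.

Lemma avg_exch H K (f : nat -> nat -> R) :
  avg H (fun a => avg K (f a)) = avg K (fun b => avg H (fun a => f a b)).
Proof.
rewrite /avg -!mulr_sumr mulrCA; congr (_ * (_ * _)).
exact: exchange_big.
Qed.

Lemma avg_sqr H f : avg H f ^+ 2 <= avg H (fun a => f a ^+ 2).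
Proof.
case: H => [|H]; first by rewrite /avg !big_ord0 !mulr0 expr0n.
set c := avg _ f.
have : 0 <= avg H.+1 (fun a => f a ^+ 2 + (-2 * c * f a + c ^+ 2)).
  apply: avg_ge0 => a _; have := sqr_ge0 (f a - c); congr (_ <= _); ring.
rewrite !avgD avgZ avg_cst// -/c => h; nra.
Qed.

Lemma avg_pow k H f : (0 < H)%N ->
  avg H f ^+ (2 ^ k) <= avg H (fun a => f a ^+ (2 ^ k)).
Proof.
move=> H0; elim: k f => [|k IH] f.
  by rewrite expn0 expr1; apply: avg_le => a _; rewrite expr1.
rewrite expnS exprM; apply: (le_trans _ (le_trans (IH (fun a => f a ^+ 2)) _)).
  apply: lerXn2r; rewrite ?nnegrE ?sqr_ge0//; last exact: avg_sqr.
  by apply: avg_ge0 => a _; exact: sqr_ge0.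
by apply: avg_le => a _; rewrite exprM.
Qed.

Lemma avg_ub H f c : 0 <= c -> (forall a, (a < H)%N -> f a <= c) -> avg H f <= c.
Proof.
move=> c0; case: H => [|H] h; first by rewrite /avg big_ord0 mulr0.
by rewrite -(@avg_cst H.+1 c)//; apply: avg_le.
Qed.

Lemma avg_ex H f c : (0 < H)%N -> c <= avg H f ->
  exists2 a, (a < H)%N & c <= f a.
Proof.
move=> H0 h; apply: contrapT => hn.
have hf a : (a < H)%N -> f a < c.
  by move=> aH; rewrite ltNge; apply/negP => ca; apply: hn; exists a.
suff : avg H f < c by rewrite ltNge h.
rewrite -(avg_cst c H0) /avg ltr_pM2l ?invr_gt0 ?ltr0n//.
case: H H0 hf {h hn} => // H _ hf.
rewrite ltr_sum// => [|i _]; last exact: hf.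
by apply/hasP; exists ord0 => //; rewrite mem_index_enum.
Qed.

(** Each window is used twice: the average is over pairs of points of one box, the shape that
    repeated Cauchy-Schwarz produces. [Av1] averages over single points. *)
Fixpoint Av (Hs : seq nat) (phi : seq nat -> seq nat -> R) : R :=
  if Hs is H :: Hs' then
    avg H (fun a => avg H (fun a' =>
      Av Hs' (fun h h' => phi (a :: h) (a' :: h'))))
  else phi [::] [::].

Fixpoint Av1 (Hs : seq nat) (phi : seq nat -> R) : R :=
  if Hs is H :: Hs' then avg H (fun a => Av1 Hs' (fun h => phi (a :: h)))
  else phi [::].

Fixpoint win (Hs h : seq nat) : bool :=
  match Hs, h with
  | H :: Hs', a :: h' => (a < H)%N && win Hs' h'
  | [::], [::] => true
  | _, _ => false
  end.

Lemma win_size Hs h : win Hs h -> size h = size Hs.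
Proof. by elim: Hs h => [|H Hs IH] [|a h]//= /andP[_ /IH ->]. Qed.

Definition posw (Hs : seq nat) := all (fun H => 0 < H)%N Hs.

Lemma Av_le Hs phi psi :
  (forall h h', win Hs h -> win Hs h' -> phi h h' <= psi h h') ->
  Av Hs phi <= Av Hs psi.
Proof.
elim: Hs phi psi => [|H Hs IH] phi psi h /=; first exact: h.
apply: avg_le => a aH; apply: avg_le => b bH; apply: IH => v v' hv hv'.
by apply: h => /=; rewrite ?aH ?bH.
Qed.

Lemma Av_ext Hs phi psi :
  (forall h h', win Hs h -> win Hs h' -> phi h h' = psi h h') ->
  Av Hs phi = Av Hs psi.
Proof.
move=> h; apply/eqP; rewrite eq_le !Av_le// => v v' hv hv'; by rewrite h.
Qed.

Lemma AvD Hs phi psi :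
  Av Hs (fun h h' => phi h h' + psi h h') = Av Hs phi + Av Hs psi.
Proof.
elim: Hs phi psi => [//|H Hs IH] phi psi /=; rewrite -avgD.
by apply: avg_ext => a _; rewrite -avgD; apply: avg_ext => b _; rewrite IH.
Qed.

Lemma AvZ Hs c phi : Av Hs (fun h h' => c * phi h h') = c * Av Hs phi.
Proof.
elim: Hs phi => [//|H Hs IH] phi /=; rewrite -avgZ.
by apply: avg_ext => a _; rewrite -avgZ; apply: avg_ext => b _; rewrite IH.
Qed.

Lemma Av_cst Hs c : posw Hs -> Av Hs (fun _ _ => c) = c.
Proof.
elim: Hs => [//|H Hs IH] /= /andP[H0 pH].
under avg_ext do (under avg_ext do rewrite IH//).
by rewrite !avg_cst.
Qed.

Lemma Av_ge0 Hs phi :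
  (forall h h', win Hs h -> win Hs h' -> 0 <= phi h h') -> 0 <= Av Hs phi.
Proof.
elim: Hs phi => [|H Hs IH] phi h /=; first exact: h.
apply: avg_ge0 => a aH; apply: avg_ge0 => b bH; apply: IH => v v' hv hv'.
by apply: h => /=; rewrite ?aH ?bH.
Qed.

Lemma Av_sqr Hs phi : Av Hs phi ^+ 2 <= Av Hs (fun h h' => phi h h' ^+ 2).
Proof.
elim: Hs phi => [//|H Hs IH] phi /=.
apply: (le_trans (avg_sqr _ _)); apply: avg_le => a _.
apply: (le_trans (avg_sqr _ _)); apply: avg_le => b _; exact: IH.
Qed.

Lemma Av_rcons Hs H phi : Av (rcons Hs H) phi =
  Av Hs (fun h h' => avg H (fun a => avg H (fun a' =>
    phi (rcons h a) (rcons h' a')))).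
Proof.
elim: Hs phi => [//|K Hs IH] phi /=.
by apply: avg_ext => a _; apply: avg_ext => b _; rewrite IH.
Qed.

Lemma Av1_le Hs phi psi : (forall h, win Hs h -> phi h <= psi h) ->
  Av1 Hs phi <= Av1 Hs psi.
Proof.
elim: Hs phi psi => [|H Hs IH] phi psi h /=; first exact: h.
apply: avg_le => a aH; apply: IH => v hv; by apply: h => /=; rewrite aH.
Qed.

Lemma Av1_ext Hs phi psi : (forall h, win Hs h -> phi h = psi h) ->
  Av1 Hs phi = Av1 Hs psi.
Proof. by move=> h; apply/eqP; rewrite eq_le !Av1_le// => v hv; rewrite h. Qed.

Lemma Av1D Hs phi psi : Av1 Hs (fun h => phi h + psi h) = Av1 Hs phi + Av1 Hs psi.
Proof.
elim: Hs phi psi => [//|H Hs IH] phi psi /=; rewrite -avgD.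
by apply: avg_ext => a _; rewrite IH.
Qed.

Lemma Av1Z Hs c phi : Av1 Hs (fun h => c * phi h) = c * Av1 Hs phi.
Proof.
elim: Hs phi => [//|H Hs IH] phi /=; rewrite -avgZ.
by apply: avg_ext => a _; rewrite IH.
Qed.

Lemma Av1_sum Hs (I : Type) (r : seq I) (phi : I -> seq nat -> R) :
  Av1 Hs (fun h => \sum_(i <- r) phi i h) = \sum_(i <- r) Av1 Hs (phi i).
Proof.
elim: r => [|i r IH].
  rewrite big_nil -[RHS](mul0r (Av1 Hs (fun=> 0))) -Av1Z.
  by apply: Av1_ext => h _; rewrite big_nil mul0r.
by rewrite big_cons -IH -Av1D; apply: Av1_ext => h _; rewrite big_cons.
Qed.

Lemma Av1_avg Hs H (phi : nat -> seq nat -> R) :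
  Av1 Hs (fun h => avg H (fun a => phi a h)) = avg H (fun a => Av1 Hs (phi a)).
Proof. by rewrite /avg Av1Z Av1_sum. Qed.

Lemma Av1_sqr Hs phi : Av1 Hs phi ^+ 2 <= Av1 Hs (fun h => phi h ^+ 2).
Proof.
elim: Hs phi => [//|H Hs IH] phi /=.
apply: (le_trans (avg_sqr _ _)); apply: avg_le => a _; exact: IH.
Qed.

Lemma Av1_cst Hs c : posw Hs -> Av1 Hs (fun=> c) = c.
Proof.
elim: Hs => [//|H Hs IH] /= /andP[H0 pH].
by under avg_ext do rewrite IH//; rewrite avg_cst.
Qed.

Lemma Av1_ub Hs phi c : posw Hs -> (forall h, win Hs h -> phi h <= c) -> Av1 Hs phi <= c.
Proof. by move=> pH h; rewrite -(Av1_cst c pH); exact: Av1_le. Qed.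

Lemma AvE Hs phi : Av Hs phi = Av1 Hs (fun h' => Av1 Hs (fun h => phi h h')).
Proof.
elim: Hs phi => [//|H Hs IH] phi /=.
rewrite avg_exch; apply: avg_ext => b _.
rewrite Av1_avg; apply: avg_ext => a _; exact: IH.
Qed.

Lemma Av1_ex Hs phi c : posw Hs -> c <= Av1 Hs phi ->
  exists2 h, win Hs h & c <= phi h.
Proof.
elim: Hs phi => [|H Hs IH] phi /=; first by move=> _ ?; exists [::].
move=> /andP[H0 pH] /(avg_ex H0)[a aH] /(IH _ pH)[h hw hc].
by exists (a :: h); rewrite ?aH.
Qed.

Lemma mean_avg (m : (nat -> R) -> R) (hm : is_mean m) H (u : nat -> nat -> R) :
  (forall a, bseq (u a)) ->
  m (fun n => avg H (fun a => u a n)) = avg H (fun a => m (u a)).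
Proof.
move=> hu; rewrite /avg -(mean_sum hm)// -(meanZ hm)//; exact: bseq_sum.
Qed.

Lemma bseq_avg H (u : nat -> nat -> R) : (forall a, bseq (u a)) ->
  bseq (fun n => avg H (fun a => u a n)).
Proof. by move=> hu; apply: bseqZ; exact: bseq_sum. Qed.

Lemma bseq_Av Hs (u : seq nat -> seq nat -> nat -> R) :
  (forall h h', bseq (u h h')) ->
  bseq (fun n => Av Hs (fun h h' => u h h' n)).
Proof.
elim: Hs u => [|H Hs IH] u hu /=; first exact: hu.
do 2 (apply: bseq_avg => ?); exact: IH.
Qed.

Lemma mean_Av (m : (nat -> R) -> R) (hm : is_mean m) Hs
    (u : seq nat -> seq nat -> nat -> R) : (forall h h', bseq (u h h')) ->
  m (fun n => Av Hs (fun h h' => u h h' n)) = Av Hs (fun h h' => m (u h h')).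
Proof.
elim: Hs u => [//|H Hs IH] u hu /=.
have hb a b : bseq (fun n => Av Hs (fun h h' => u (a :: h) (b :: h') n)).
  by apply: bseq_Av.
rewrite (mean_avg hm) => [|a]; last exact: bseq_avg.
apply: avg_ext => a _; rewrite (mean_avg hm)//; apply: avg_ext => b _.
by rewrite IH.
Qed.

Lemma bseq_Av1 Hs (u : seq nat -> nat -> R) : (forall h, bseq (u h)) ->
  bseq (fun n => Av1 Hs (fun h => u h n)).
Proof.
elim: Hs u => [|H Hs IH] u hu /=; first exact: hu.
apply: bseq_avg => ?; exact: IH.
Qed.

Lemma mean_Av1 (m : (nat -> R) -> R) (hm : is_mean m) Hs
    (u : seq nat -> nat -> R) : (forall h, bseq (u h)) ->
  m (fun n => Av1 Hs (fun h => u h n)) = Av1 Hs (fun h => m (u h)).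
Proof.
elim: Hs u => [//|H Hs IH] u hu /=.
rewrite (mean_avg hm) => [|a]; last exact: bseq_Av1.
by apply: avg_ext => a _; rewrite IH.
Qed.

End Avg.

(** * Means obtained from averages over long windows *)

Section WindowMean.
Variable R : realType.

Lemma ultra_cvg (G : set_system nat) (u : nat -> R) : UltraFilter G -> bseq u -> cvg (u @ G).
Proof.
move=> GU [B hB].
have [p [_ clp]] : `[- B, B]%classic `&` cluster (u @ G) !=set0.
  apply: (@segment_compact R (- B) B (u @ G) _).
  have : G (u @^-1` `[- B, B]%classic).
    by apply: filterE => n; rewrite /= in_itv /= -ler_norml; exact: hB.
  by [].
apply/cvg_ex; exists p => V nV.
have [//|GV] := @in_ultra_setVsetC _ G (u @^-1` V) GU.
have [x [/= h1 h2]] := clp (~` V) V GV nV.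
by [].
Qed.

Lemma bseq_block (w L : nat -> nat) (u : nat -> R) : bseq u ->
  bseq (fun n => avg (L n) (fun k => u (w n + k)%N)).
Proof.
move=> [B hB]; exists B => n; have B0 : 0 <= B by apply: le_trans (hB 0%N).
rewrite ler_norml; apply/andP; split; last first.
  by apply: avg_ub => // a _; apply: le_trans (hB (w n + a)%N); exact: ler_norm.
rewrite lerNl -[- avg _ _]mulN1r -avgZ; apply: avg_ub => // a _.
by rewrite mulN1r; apply: le_trans (hB (w n + a)%N); rewrite -normrN; exact: ler_norm.
Qed.

(** The mean is the limit of the window averages along an ultrafilter finer than [\oo]. Shifting a
    sequence bounded by [B] changes the [n]-th average by at most [2 * B / L n], which tends to
    [0]. *)
Lemma window_mean (w L : nat -> nat) : (forall n, (n < L n)%N) ->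
  exists m : (nat -> R) -> R, is_mean m /\ forall u c, bseq u ->
    (forall n, c <= avg (L n) (fun k => u (w n + k)%N)) -> c <= m u.
Proof.
move=> hL; have [G [GU hG]] := ultraFilterLemma (eventually_filter).
pose a (u : nat -> R) : nat -> R := fun n => avg (L n) (fun k => u (w n + k)%N).
have ac (u : nat -> R) : bseq u -> cvg (a u @ G).
  by move=> hu; apply: ultra_cvg; exact: bseq_block.
exists (fun u => lim (a u @ G)); split; last first.
  by move=> u c hu hc; apply: limr_ge; [exact: ac|exact: filterE].
split.
- move=> u v hu hv; apply/cvg_lim => //.
  have -> : a (fun n => u n + v n) = (a u \+ a v)%R.
    by apply: funext => n; rewrite /a avgD.
  by apply: cvgD; exact: ac.
- move=> c u hu; apply/cvg_lim => //.
  have -> : a (fun n => c * u n) = (fun n => c * a u n).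
    by apply: funext => n; rewrite /a avgZ.
  by apply: cvgMr; exact: ac.
- move=> u v hu hv huv; apply: ler_lim; [exact: ac|exact: ac|].
  by apply: filterE => n; apply: avg_le => i _.
- apply/cvg_lim => //; have -> : a (fun=> 1) = (fun=> 1).
    by apply: funext => n; rewrite /a avg_cst// (leq_ltn_trans _ (hL n)).
  exact: cvg_cst.
- move=> u hu; apply/cvg_lim => //.
  have hS : bseq (fun n => u n.+1) by exact: (bseq_comp succn).
  have [B hB] := hu.
  have d0 : (fun n => a (fun n => u n.+1) n - a u n) @ G --> (0 : R).
    apply: (cvg_trans _ (_ : (fun n => a (fun n => u n.+1) n - a u n) @ \oo --> (0:R))).
      by move=> V hV; apply: hG.
    have L0 n : 0 < (L n)%:R :> R by rewrite ltr0n (leq_ltn_trans _ (hL n)).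
    have e n : `|a (fun n => u n.+1) n - a u n| <= (2 * B) * n.+1%:R^-1.
      have -> : a (fun n => u n.+1) n - a u n = (L n)%:R^-1 * (u (w n + L n)%N - u (w n)).
        rewrite /a /avg -mulrBr -sumrB; congr (_ * _).
        elim: (L n) => [|j IH]; first by rewrite big_ord0 addn0 subrr.
        by rewrite big_ord_recr/= IH addnS; ring.
      rewrite normrM gtr0_norm ?invr_gt0// mulrC ler_pM ?invr_ge0//.
      + by apply: le_trans (ler_normB _ _) _; rewrite mulr2n mulrDl mul1r lerD.
      + by rewrite lef_pV2 ?posrE// ler_nat.
    apply/cvgr0Pnorm_le => eps e0.
    have h : (fun n => (2 * B) * n.+1%:R^-1) @ \oo --> (0 : R).
      by rewrite -[X in _ --> X](mulr0 (2 * B)); apply: cvgMr; exact: cvg_harmonic.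
    move/cvgr0Pnorm_le : h => /(_ _ e0); apply: filterS => n hn.
    apply: le_trans (e n) _; apply: le_trans hn; exact: ler_norm.
  have -> : a (fun n => u n.+1) = (fun n => (a (fun n => u n.+1) n - a u n) + a u n).
    by apply: funext => n; rewrite subrK.
  by rewrite -[X in _ --> X]add0r; apply: cvgD => //; exact: ac.
Qed.

End WindowMean.

(* Almost everywhere equality: here [rho] will be the real part of the integral. *)
Definition weq (R : pzRingType) (A : comPzRingType) (rho : A -> R) (f g : A) :=
  forall a, rho (a * f) = rho (a * g).

(* Bounded complex measurable functions on a system: [rho] is the real part of the integral, [ub f]
   means [|f| <= 1], the group [{poly int}] acts by the Koopman operators [U] (['X^i] stands for the
   i-th transformation), [kk] embeds the real constants, [ei u] is the indicator function of
   [{u = 1}], [thr] gives the indicator function of [{Re y >= c}], [wmean] weak limits along a mean,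
   [roots] splits [{L^N = 1}] according to the value of [L].  In [u2freq], [c a b] is the conditional
   expectation of [U (s *+ a) g * cj (U (s *+ b) g)] on the [s]-invariants, and [W] its Fejer sums;
   factorial windows are used so that they are eventually divisible by any given integer. *)
Record dsys (R : realType) := Dsys {
  sA :> comPzRingType;
  cj : {rmorphism sA -> sA};
  kk : {rmorphism R -> sA};
  rho : {additive sA -> R};
  U : {poly int} -> {rmorphism sA -> sA};
  ub : sA -> Prop;
  cjK : forall f, cj (cj f) = f;
  cj_kk : forall r, cj (kk r) = kk r;
  rho_kk : forall r f, rho (kk r * f) = r * rho f;
  rho_cj : forall f, rho (cj f) = rho f;
  rho_ge0 : forall f, 0 <= rho (f * cj f);
  U_0 : forall f, U 0 f = f;
  U_D : forall g h f, U g (U h f) = U (g + h) f;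
  U_cj : forall g f, U g (cj f) = cj (U g f);
  U_kk : forall g r, U g (kk r) = kk r;
  rho_U : forall g f, rho (U g f) = rho f;
  ub_1 : ub 1;
  ub_M : forall f g, ub f -> ub g -> ub (f * g);
  ub_N : forall f, ub f -> ub (- f);
  ub_cj : forall f, ub f -> ub (cj f);
  ub_U : forall g f, ub f -> ub (U g f);
  ub_conv : forall t f g, 0 <= t <= 1 -> ub f -> ub g ->
    ub (kk t * f + kk (1 - t) * g);
  ub_unit : forall f, f * cj f = 1 -> ub f;
  ub_sq : forall f g, ub f -> rho (f * cj f * (g * cj g)) <= rho (g * cj g);
  rho_le1 : forall f, ub f -> rho f <= 1;
  ub_all : forall f, exists2 c, 0 < c & ub (kk c * f);
  wmean : forall m (u : nat -> sA), is_mean m -> (forall n, ub (u n)) ->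
    exists2 F, ub F & forall a, rho (a * F) = m (fun n => rho (a * u n));
  ei : sA -> sA;
  ei_idem : forall u, ei u * ei u = ei u;
  ei_cj : forall u, cj (ei u) = ei u;
  ei_ub : forall u, ub (ei u);
  ei_ubC : forall u, ub (1 - ei u);
  ei_U : forall g u, U g (ei u) = ei (U g u);
  ei_weq : forall u v, weq rho u v -> weq rho (ei u) (ei v);
  ei_mul : forall u, ei u * u = ei u;
  ei_abs : forall e u, e * e = e -> e * u = e -> e * ei u = e;
  ei_fix : forall u F, weq rho (u * F) F -> weq rho (ei u * F) F;
  thr : forall y c, 0 <= c -> exists e, [/\ e * e = e, cj e = e, ub e,
    (forall g, weq rho (U g y) y -> weq rho (U g e) e) &
    (rho ((1 - e) * y) <= c /\
     forall v, c * rho (e * (v * cj v)) <= rho (e * y * (v * cj v)))];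
  roots : forall N, (0 < N)%N -> exists zs : seq sA,
    (forall z, List.In z zs -> z * cj z = 1 /\ forall g, U g z = z) /\
    forall L, L * cj L = 1 -> ei (L ^+ N) = \sum_(z <- zs) ei (cj z * L);
  u2freq : forall eta, 0 < eta -> exists2 kap, 0 < kap &
    forall (s : {poly int}) (D : nat) (c : nat -> nat -> sA),
    (0 < D)%N -> (forall a b, ub (c a b)) ->
    (forall a b, weq rho (U s (c a b)) (c a b)) ->
    (forall a b, weq rho (c a.+1 b.+1) (c a b)) ->
    (forall a b, weq rho (cj (c a b)) (c b a)) ->
    (forall z v (W := fun M => avg M (fun a => avg M (fun b =>
       rho (v * cj v * (cj z ^+ a * z ^+ b * c a b))))),
     z * cj z = 1 -> (forall h, U h z = z) -> weq rho (U s v) v ->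
     (forall M, 0 <= W M) /\ (forall M N, (0 < M)%N -> (0 < N)%N -> W (N * M)%N <= W M)) ->
    (forall T, exists2 t, (T <= t)%N & eta <= avg (D * t`!) (fun a =>
       avg (D * t`!) (fun b => rho (c a b * cj (c a b))))) ->
    exists G lam, [/\ ub G /\ G * cj G = G, weq rho (U s G) G, lam * cj lam = 1,
      weq rho (U s lam) lam & forall K, (0 < K)%N -> kap <= avg K (fun a =>
        avg K (fun b => rho (G * (cj lam ^+ a * lam ^+ b * c a b))))] }.

Arguments cj {R d}. Arguments kk {R d}. Arguments rho {R d}.
Arguments U {R d}. Arguments ub {R d}. Arguments ei {R d}.
#[global] Hint Resolve ub_1 ei_ub : core.

(** * Calculus in an abstract system, and van der Corput's inequality *)

Section Sys.
Variables (R : realType) (A : dsys R).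
Implicit Types (f g u v y : A) (h : {poly int}) (m : (nat -> R) -> R).

Notation aeq := (@weq R A rho).

Lemma rho0 : rho (0 : A) = 0. Proof. exact: raddf0. Qed.
Lemma rhoD f g : rho (f + g) = rho f + rho g. Proof. exact: raddfD. Qed.
Lemma rhoN f : rho (- f) = - rho f. Proof. exact: raddfN. Qed.
Lemma rhoB f g : rho (f - g) = rho f - rho g. Proof. exact: raddfB. Qed.

Lemma rho_abs f : ub f -> `|rho f| <= 1.
Proof.
move=> uf; rewrite ler_norml rho_le1// andbT lerNl -rhoN.
by apply: rho_le1; exact: ub_N.
Qed.

Lemma bseq_rho (u : nat -> A) : (forall n, ub (u n)) -> bseq (fun n => rho (u n)).
Proof. by move=> hu; exists 1 => n; exact: rho_abs. Qed.

Lemma ub_0 : ub (0 : A).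
Proof.
have h : 0 <= (2^-1 : R) <= 1 by apply/andP; split; lra.
have := ub_conv h (ub_1 A) (ub_N (ub_1 A)).
have -> : 1 - 2^-1 = 2^-1 :> R by field.
by rewrite mulrN subrr.
Qed.

Lemma ub_X f n : ub f -> ub (f ^+ n).
Proof.
move=> uf; elim: n => [|n IH]; first by rewrite expr0.
by rewrite exprS; exact: ub_M.
Qed.

Lemma ub_avg H (F : nat -> A) : (forall a, ub (F a)) ->
  ub (kk (H%:R^-1) * \sum_(a < H) F a).
Proof.
move=> hF; elim: H => [|H IH]; first by rewrite big_ord0 mulr0; exact: ub_0.
case: H IH => [|H] IH.
  by rewrite big_ord_recr/= big_ord0 add0r invr1 rmorph1 mul1r.
rewrite big_ord_recr/=; set S := \sum_(i < _) _ in IH *.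
pose t : R := H.+1%:R / H.+2%:R.
have h1 : (0 : R) < H.+1%:R by rewrite ltr0n.
have h2 : H.+2%:R = H.+1%:R + 1 :> R by rewrite -[H.+2]addn1 natrD.
have ht : 0 <= t <= 1.
  by rewrite /t divr_ge0 ?ler0n//= ler_pdivrMr ?ltr0n// mul1r ler_nat.
have := ub_conv ht IH (hF H.+1).
rewrite mulrA -rmorphM mulrDr; congr (ub (kk _ * _ + kk _ * _)).
  by rewrite /t h2; field; apply/andP; split; apply: lt0r_neq0; lra.
by rewrite /t h2; field; apply: lt0r_neq0; lra.
Qed.

Lemma aeq_refl f : aeq f f. Proof. by []. Qed.
Lemma aeq_sym f g : aeq f g -> aeq g f. Proof. by move=> h a; rewrite h. Qed.
Lemma aeq_trans g f u : aeq f g -> aeq g u -> aeq f u.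
Proof. by move=> h h' a; rewrite h h'. Qed.
Lemma aeq_M f g u v : aeq f g -> aeq u v -> aeq (f * u) (g * v).
Proof.
move=> h h' a; have -> : a * (f * u) = (a * u) * f by ring.
rewrite h; have -> : a * u * g = (a * g) * u by ring.
by rewrite h' mulrA.
Qed.
Lemma aeq_D f g u v : aeq f g -> aeq u v -> aeq (f + u) (g + v).
Proof. by move=> h h' a; rewrite !mulrDr !rhoD h h'. Qed.
Lemma aeq_cj f g : aeq f g -> aeq (cj f) (cj g).
Proof.
move=> h a; rewrite -rho_cj rmorphM cjK h -[LHS]rho_cj rmorphM cjK.
by [].
Qed.
Lemma aeq_rho f g : aeq f g -> rho f = rho g.
Proof. by move=> /(_ 1); rewrite !mul1r. Qed.
Lemma aeq_U h f g : aeq f g -> aeq (U h f) (U h g).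
Proof.
move=> e a; have -> : a = U h (U (- h) a) by rewrite U_D subrr U_0.
by rewrite -!rmorphM !rho_U.
Qed.
Lemma aeq_X f g n : aeq f g -> aeq (f ^+ n) (g ^+ n).
Proof.
by move=> h; elim: n => [|n IH]; rewrite ?expr0// !exprS; exact: aeq_M.
Qed.
Lemma aeq_rhoM f g u : aeq f g -> rho (f * u) = rho (g * u).
Proof. by move=> h; rewrite mulrC h mulrC. Qed.

Lemma U_NK h f : U (- h) (U h f) = f.
Proof. by rewrite U_D addNr U_0. Qed.

Lemma rho_UM h f g : rho (U h f * g) = rho (f * U (- h) g).
Proof. by rewrite -(rho_U (- h)) rmorphM U_NK. Qed.

Lemma quad_disc (a b c : R) : 0 <= b -> (forall t, 0 <= a + 2 * t * c + t ^+ 2 * b) ->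
  c ^+ 2 <= a * b.
Proof.
rewrite le_eqVlt => /orP[/eqP<-|b0] h.
  rewrite mulr0; have [->|c0] := eqVneq c 0; first by rewrite expr0n.
  exfalso; have := h (- (a + 1) / (2 * c)).
  have -> : a + 2 * (- (a + 1) / (2 * c)) * c + (- (a + 1) / (2 * c)) ^+ 2 * 0 = -1.
    by field.
  by lra.
have := h (- c / b).
have -> : a + 2 * (- c / b) * c + (- c / b) ^+ 2 * b = (a * b - c ^+ 2) / b.
  by field; exact: lt0r_neq0.
by rewrite pmulr_lge0 ?invr_gt0// subr_ge0.
Qed.

Lemma rho_CS f g : rho (f * g) ^+ 2 <= rho (f * cj f) * rho (g * cj g).
Proof.
apply: quad_disc => [|t]; first exact: rho_ge0.
have := rho_ge0 (f + kk t * cj g).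
rewrite rmorphD rmorphM/= cjK cj_kk.
have -> : (f + kk t * cj g) * (cj f + kk t * g) =
  f * cj f + kk t * (f * g) + kk t * cj (f * g) + kk (t ^+ 2) * (g * cj g).
  by rewrite !rmorphM/=; ring.
rewrite !rhoD !rho_kk rho_cj; congr (_ <= _); ring.
Qed.

Lemma rho_CS1 f g : ub f -> rho (f * g) ^+ 2 <= rho (g * cj g).
Proof.
move=> uf; apply: (le_trans (rho_CS f g)).
rewrite ler_piMl ?rho_ge0//; apply: rho_le1; apply: ub_M => //; exact: ub_cj.
Qed.

Lemma rho_sum (I : Type) (r : seq I) (F : I -> A) :
  rho (\sum_(i <- r) F i) = \sum_(i <- r) rho (F i).
Proof. exact: raddf_sum. Qed.

Lemma rho_avg H (F : nat -> A) :
  rho (kk (H%:R^-1) * \sum_(a < H) F a) = avg H (fun a => rho (F a)).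
Proof. by rewrite rho_kk rho_sum. Qed.

Lemma avg_sq H (F : nat -> A) (y := kk (H%:R^-1) * \sum_(a < H) F a) :
  rho (y * cj y) = avg H (fun a => avg H (fun b => rho (F a * cj (F b)))).
Proof.
rewrite /y -mulrA mulr_suml (@rho_avg H (fun a => F a * cj y)).
apply: avg_ext => a _; rewrite rmorphM cj_kk mulrCA rmorph_sum/= mulr_sumr.
exact: (@rho_avg H (fun b => F a * cj (F b))).
Qed.

(** Invariance of [m] replaces [u n] by its average over the shifts [sh a] with no error term;
    Cauchy-Schwarz, in the system and for [m], then discards [f0]. *)
Lemma vdC m (f0 : A) (u : nat -> A) (sh : nat -> nat) H d : is_mean m -> (0 < H)%N -> ub f0 ->
  (forall n, ub (u n)) -> 0 <= d -> d <= m (fun n => rho (f0 * u n)) ->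
  d ^+ 2 <= avg H (fun a => avg H (fun b =>
     m (fun n => rho (u (n + sh a)%N * cj (u (n + sh b)%N))))).
Proof.
move=> hm H0 uf hu d0 hd.
have uu a b n : ub (u (n + sh a)%N * cj (u (n + sh b)%N)).
  by apply: ub_M => //; exact: ub_cj.
pose y n := kk (H%:R^-1) * \sum_(a < H) u (n + sh a)%N.
have uy n : ub (y n) by apply: (@ub_avg H (fun a => u (n + sh a)%N)).
have E : m (fun n => rho (f0 * u n)) = m (fun n => rho (f0 * y n)).
  rewrite -(avg_cst (m _) H0).
  under avg_ext => a _.
    rewrite -(meanSn hm (sh a)); last by apply: bseq_rho => n; exact: ub_M.
    over.
  rewrite -(mean_avg hm); last by move=> a; apply: bseq_rho => n; exact: ub_M.
  congr m; apply: funext => n; rewrite -rho_avg -mulr_sumr.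
  by rewrite /y mulrCA.
apply: (@le_trans _ _ (m (fun n => rho (f0 * y n)) ^+ 2)).
  by rewrite -E lerXn2r ?nnegrE// (le_trans d0).
have by0 : bseq (fun n => rho (f0 * y n)).
  by apply: bseq_rho => n; exact: ub_M.
apply: (le_trans (mean_sqr hm by0)).
have -> : avg H (fun a => avg H (fun b => m (fun n => rho (u (n + sh a)%N * cj (u (n + sh b)%N))))) =
  m (fun n => rho (y n * cj (y n))).
  under avg_ext => a _.
    rewrite -(mean_avg hm); last by move=> b; exact: bseq_rho.
    over.
  rewrite -(mean_avg hm); last first.
    by move=> a; apply: bseq_avg => b; exact: bseq_rho.
  by congr m; apply: funext => n; rewrite (@avg_sq H (fun a => u (n + sh a)%N)).
apply: (mean_le hm).
- exact: (bseqM by0 by0).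
- by apply: bseq_rho => n; apply: ub_M => //; exact: ub_cj.
- by move=> n; exact: rho_CS1.
Qed.

Lemma rho_swap f g : rho (f * cj g) = rho (g * cj f).
Proof. by rewrite -rho_cj rmorphM cjK mulrC. Qed.

(* Only the diagonal pairs are degenerate once the shifts are multiples of B. *)
Lemma vdC_shift d B : 0 < d -> exists Z, forall m (f0 : A) (u : nat -> A),
  is_mean m -> ub f0 -> (forall n, ub (u n)) -> d <= m (fun n => rho (f0 * u n)) ->
  exists z, [/\ (B < z)%N, (z <= Z)%N &
    d ^+ 2 / 2 <= m (fun n => rho (u (n + z)%N * cj (u n)))].
Proof.
(* With [H > 2 / d ^+ 2] the diagonal pairs contribute less than [d ^+ 2 / 2], so some off-diagonal
   pair must carry the rest. *)
move=> d0; pose H := (Num.truncn (2 / d ^+ 2)).+1.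
have hH : 2 / d ^+ 2 < H%:R.
  by have := truncnS_gt (2 / d ^+ 2); rewrite /H.
exists (B.+1 * H)%N => m f0 u hm uf hu hd.
apply: contrapT => hn.
have uu a b n : ub (u (n + a)%N * cj (u (n + b)%N)).
  by apply: ub_M => //; exact: ub_cj.
have bu a b : bseq (fun n => rho (u (n + a)%N * cj (u (n + b)%N))).
  exact: bseq_rho.
have hz a b : (b < a)%N -> (a < H)%N ->
    m (fun n => rho (u (n + B.+1 * a)%N * cj (u (n + B.+1 * b)%N))) < d ^+ 2 / 2.
  move=> ba aH; rewrite ltNge; apply/negP => hge; apply: hn.
  exists (B.+1 * (a - b))%N; split; [nia|nia|].
  rewrite -(meanSn hm (B.+1 * b)); last first.
    by apply: bseq_rho => n; apply: ub_M => //; exact: ub_cj.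
  apply: le_trans hge _; rewrite le_eqVlt; apply/orP; left; apply/eqP.
  congr m; apply: funext => n; congr (rho (u _ * cj (u _))); lia.
have hz' a b : (a < H)%N -> (b < H)%N ->
    m (fun n => rho (u (n + B.+1 * a)%N * cj (u (n + B.+1 * b)%N))) <=
    (a == b)%:R + d ^+ 2 / 2.
  move=> aH bH; have d2 : 0 <= d ^+ 2 / 2 by rewrite divr_ge0// ?sqr_ge0.
  case: (ltngtP a b) => [ab|ab|->].
  - rewrite add0r; apply/ltW; have := hz _ _ ab bH.
    by under [in m _]eq_fun do rewrite rho_swap.
  - by rewrite add0r; apply/ltW; exact: hz.
  - rewrite (le_trans (y := 1))// ?lerDl//; apply: (mean_lec hm) => // n.
    exact: rho_le1.
have := @vdC m f0 u (fun a => (B.+1 * a)%N) H d hm (ltn0Sn _) uf hu (ltW d0) hd.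
apply/negP; rewrite -ltNge.
apply: (@le_lt_trans _ _ (avg H (fun a => H%:R^-1 + d ^+ 2 / 2))).
  apply: avg_le => a aH; apply: (le_trans (avg_le (fun b bH => hz' a b aH bH))).
  rewrite avgD avg_cst// lerD2r /avg ler_piMr ?invr_ge0 ?ler0n//.
  rewrite -natr_sum -[leRHS]/(1%:R) ler_nat (bigD1 (Ordinal aH))//= eqxx big1 ?addn0//.
  by move=> i /negPf; rewrite -val_eqE/= eq_sym => ->.
rewrite avg_cst//.
have : H%:R^-1 < d ^+ 2 / 2.
  rewrite -[d ^+ 2 / 2]invrK ltf_pV2 ?posrE ?ltr0n//.
    by rewrite invfM invrK mulrC.
  by rewrite invr_gt0 divr_gt0// exprn_gt0.
by lra.
Qed.

End Sys.

(** * Box products, invariant projections and box averages *)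

Section Boxes.
Variables (R : realType) (A : dsys R).
Implicit Types (f g : A) (w : seq nat -> A) (m : (nat -> R) -> R).

Notation aeq := (@weq R A rho).

(* The product over [omega] in [{0,1}^k] of [w (h_omega)], the i-th entry of [h_omega] being
   that of [h] or of [h'], conjugated when [omega] has odd weight. *)
Fixpoint bp (w : seq nat -> A) (h h' : seq nat) : A :=
  match h, h' with
  | a :: t, a' :: t' => bp (fun v => w (a :: v) * cj (w (a' :: v))) t t'
  | _, _ => w [::]
  end.

Lemma bp_ext w w' h h' : (forall v, w v = w' v) -> bp w h h' = bp w' h h'.
Proof. by move=> e; congr bp; apply: funext. Qed.

Lemma bpM w w' h h' : bp (fun v => w v * w' v) h h' = bp w h h' * bp w' h h'.
Proof.
elim: h h' w w' => [|a h IH] [|a' h'] w w' //=.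
by rewrite -IH; apply: bp_ext => v; rewrite rmorphM; ring.
Qed.

Lemma bp_cj w h h' : bp (fun v => cj (w v)) h h' = cj (bp w h h').
Proof.
elim: h h' w => [|a h IH] [|a' h'] w //=.
by rewrite -IH; apply: bp_ext => v; rewrite rmorphM.
Qed.

Lemma bp_U k w h h' : bp (fun v => U k (w v)) h h' = U k (bp w h h').
Proof.
elim: h h' w => [|a h IH] [|a' h'] w //=.
by rewrite -IH; apply: bp_ext => v; rewrite rmorphM -U_cj.
Qed.

Lemma bp_ub w h h' : (forall v, ub (w v)) -> ub (bp w h h').
Proof.
elim: h h' w => [|a h IH] [|a' h'] w hw //=.
by apply: IH => v; apply: ub_M => //; exact: ub_cj.
Qed.

Lemma bp_aeq w w' h h' : (forall v, aeq (w v) (w' v)) -> aeq (bp w h h') (bp w' h h').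
Proof.
elim: h h' w w' => [|a h IH] [|a' h'] w w' hw //=.
by apply: IH => v; apply: aeq_M => //; exact: aeq_cj.
Qed.

Lemma bp_1 h h' : bp (fun=> 1) h h' = 1.
Proof.
elim: h h' => [|a h IH] [|a' h'] //=.
by rewrite (@bp_ext _ (fun=> 1)) ?IH// => v; rewrite rmorph1 mulr1.
Qed.

Lemma bp_unit w h h' : (forall v, w v * cj (w v) = 1) ->
  bp w h h' * cj (bp w h h') = 1.
Proof.
by move=> hw; rewrite -bp_cj -bpM (@bp_ext _ (fun=> 1)) ?bp_1.
Qed.

(* Products of [k] bounded functions of [v], the i-th of which does not depend on the i-th entry
   of [v]: the Gowers-Cauchy-Schwarz inequality removes them from averages of box products. *)
Fixpoint LO (k : nat) (b : seq nat -> A) : Prop :=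
  if k is k'.+1 then
    exists b0 : seq nat -> A, exists b' : nat -> seq nat -> A,
    [/\ forall v, ub (b0 v), forall a, LO k' (b' a) &
        forall a v, b (a :: v) = b0 v * b' a v]
  else b [::] = 1.

Lemma LO_M k b c : LO k b -> LO k c -> LO k (fun v => b v * c v).
Proof.
elim: k b c => [|k IH] b c /=; first by move=> -> ->; rewrite mulr1.
move=> [b0 [b' [ub0 hb' e]]] [c0 [c' [uc0 hc' e']]].
exists (fun v => b0 v * c0 v), (fun a v => b' a v * c' a v); split.
- by move=> v; exact: ub_M.
- by move=> a; exact: IH.
- by move=> a v; rewrite e e'; ring.
Qed.

Lemma LO_cj k b : LO k b -> LO k (fun v => cj (b v)).
Proof.
elim: k b => [|k IH] b /=; first by move=> ->; rewrite rmorph1.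
move=> [b0 [b' [ub0 hb' e]]].
exists (fun v => cj (b0 v)), (fun a v => cj (b' a v)); split.
- by move=> v; exact: ub_cj.
- by move=> a; exact: IH.
- by move=> a v; rewrite e rmorphM.
Qed.

Lemma LO_ub k b v : LO k b -> size v = k -> ub (b v).
Proof.
elim: k b v => [|k IH] b [|a v] //= => [-> //|].
by move=> [b0 [b' [ub0 hb' e]]] [hs]; rewrite e; apply: ub_M => //; exact: IH.
Qed.

(** Once [h'] is fixed, every vertex of the box other than [w h] omits some entry of [h], so the
    product of these vertices has the form [LO]. The property [P] rides along in order to record
    that the moduli of these factors are invariant. *)
Lemma bp_LO w h' (P : A -> Prop) : P 1 -> (forall f g, P f -> P g -> P (f * g)) ->
  (forall f, P f -> P (cj f)) -> (forall v, ub (w v)) -> (forall v, P (w v)) ->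
  exists b, [/\ LO (size h') b, forall h, P (b h) &
    forall h, size h = size h' -> bp w h h' = w h * b h].
Proof.
move=> P1 PM Pc; elim: h' w => [|a' h' IH] w hw Pw /=.
  by exists (fun=> 1); split=> // -[]//= _; rewrite mulr1.
have Pbp h w1 : (forall v, P (w1 v)) -> P (bp w1 h h').
  elim: h h' w1 {IH} => [|a h IH] [|c t] w1 hw1 //=.
  by apply: IH => v; apply: PM => //; exact: Pc.
have /choice[b hb] : forall a, exists b, [/\ LO (size h') b, forall h, P (b h) &
    forall h, size h = size h' -> bp (fun v => w (a :: v)) h h' = w (a :: h) * b h].
  by move=> a; apply: IH.
exists (fun h => if h is a :: v then bp (fun u => cj (w (a' :: u))) v h' * b a v else 1).
split.
- exists (fun v => bp (fun u => cj (w (a' :: u))) v h'), b; split => //.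
    by move=> v; apply: bp_ub => u; exact: ub_cj.
  by move=> a; case: (hb a).
- move=> [//|a v]; apply: PM; last by case: (hb a).
  by apply: Pbp => u; exact: Pc.
by move=> [//|a v] [hs] /=; rewrite bpM; have [_ _ ->//] := hb a; ring.
Qed.

Lemma Av1_rho_sq H Hs (b0 : seq nat -> A) (F : nat -> seq nat -> A) :
  (forall v, win Hs v -> ub (b0 v)) ->
  avg H (fun a => Av1 Hs (fun v => rho (b0 v * F a v))) ^+ 2 <=
  avg H (fun a => avg H (fun b => Av1 Hs (fun v => rho (F a v * cj (F b v))))).
Proof.
move=> hb; rewrite -Av1_avg; apply: (le_trans (Av1_sqr _ _)).
rewrite [leRHS](_ : _ = Av1 Hs (fun v => avg H (fun a => avg H (fun b =>
    rho (F a v * cj (F b v)))))); last first.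
  by rewrite Av1_avg; apply: avg_ext => a _; rewrite Av1_avg.
apply: Av1_le => v hv; rewrite -(@avg_sq _ _ H (fun a => F a v)).
rewrite -(@rho_avg _ _ H (fun a => b0 v * F a v)) -mulr_sumr mulrCA.
by apply: rho_CS1; exact: hb.
Qed.

(** Cauchy-Schwarz in one entry removes the factor [b0], which does not depend on it, and doubles
    that entry in [w]; what is left of [b] is again of the form [LO]. Convexity of the powers
    [2 ^ k] moves the exponent inside. *)
Lemma GCS Hs (w b : seq nat -> A) : posw Hs -> (forall v, ub (w v)) ->
  LO (size Hs) b ->
  Av1 Hs (fun h => rho (w h * b h)) ^+ (2 ^ size Hs) <=
  Av Hs (fun h h' => rho (bp w h h')).
Proof.
elim: Hs w b => [|H Hs IH] w b /=; first by move=> _ _ ->; rewrite mulr1 expr1.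
move=> /andP[H0 pH] hw [b0 [b' [ub0 hb' e]]].
rewrite expnS exprM.
pose x a c := Av1 Hs (fun v =>
  rho (w (a :: v) * cj (w (c :: v)) * (b' a v * cj (b' c v)))).
apply: (@le_trans _ _ (avg H (fun a => avg H (fun c => x a c)) ^+ (2 ^ size Hs))).
  have hx : avg H (fun a => Av1 Hs (fun h => rho (w (a :: h) * b (a :: h)))) ^+ 2
      <= avg H (fun a => avg H (fun c => x a c)).
    rewrite (@avg_ext _ _ _ (fun a => Av1 Hs (fun v => rho (b0 v * (w (a :: v) * b' a v))))).
      apply: (le_trans (@Av1_rho_sq H Hs b0 (fun a v => w (a :: v) * b' a v) _)) => //.
      apply: avg_le => a _; apply: avg_le => c _; apply: Av1_le => v _.
      by rewrite rmorphM mulrACA.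
    by move=> a _; apply: Av1_ext => v _; rewrite e mulrCA.
  apply: lerXn2r => //; rewrite nnegrE ?sqr_ge0//.
  exact: le_trans (sqr_ge0 _) hx.
apply: (le_trans (avg_pow _ _ H0)); apply: avg_le => a aH.
apply: (le_trans (avg_pow _ _ H0)); apply: avg_le => c cH.
apply: (IH (fun v => w (a :: v) * cj (w (c :: v)))) => //.
  by move=> v; apply: ub_M => //; exact: ub_cj.
by apply: LO_M => //; exact: LO_cj.
Qed.

Variables (m0 : (nat -> R) -> R) (hm0 : is_mean m0).

Definition inv (s : {poly int}) (y : A) := aeq (U s y) y.

Lemma inv_M s f g : inv s f -> inv s g -> inv s (f * g).
Proof. by rewrite /inv rmorphM => *; exact: aeq_M. Qed.
Lemma inv_cj s f : inv s f -> inv s (cj f).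
Proof. by rewrite /inv U_cj => *; exact: aeq_cj. Qed.
Lemma inv_1 s : inv s 1.
Proof. by rewrite /inv rmorph1. Qed.
Lemma inv_U s h f : inv s f -> inv s (U h f).
Proof. by rewrite /inv U_D addrC -U_D; exact: aeq_U. Qed.
Lemma inv_ei s f : inv s f -> inv s (ei f).
Proof. by rewrite /inv ei_U; exact: ei_weq. Qed.
Lemma inv_opp s f : inv s f -> inv s (- f).
Proof. by rewrite /inv rmorphN => h a; rewrite !mulrN !rhoN h. Qed.
Lemma inv_D s f g : inv s f -> inv s g -> inv s (f + g).
Proof. by rewrite /inv rmorphD => h h'; apply: aeq_D. Qed.
Lemma inv_oppr s f : inv s f -> inv (- s) f.
Proof.
move=> h; have := aeq_U (- s) h; rewrite U_D addNr U_0.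
by move=> h'; exact: aeq_sym.
Qed.
Lemma inv_muln s f n : inv s f -> inv (s *+ n) f.
Proof.
move=> h; elim: n => [|n IH]; first by rewrite /inv mulr0n U_0.
rewrite mulrS /inv -U_D; apply: aeq_trans h; exact: aeq_U.
Qed.
Lemma inv_mulz s f (n : int) : inv s f -> inv (s *~ n) f.
Proof.
by case: n => n h; rewrite ?NegzE ?mulrNz /= -?pmulrn; [|apply: inv_oppr];
  exact: inv_muln.
Qed.

Lemma ei_X (u : A) n : ei (u ^+ n) * ei u = ei u.
Proof.
rewrite mulrC; apply: ei_abs; first exact: ei_idem.
elim: n => [|n IH]; first by rewrite expr0 mulr1.
by rewrite exprS mulrA ei_mul.
Qed.

(* [c] is the conditional expectation of [f] on the [s]-invariant functions. *)
Definition isP s f c := [/\ ub c, inv s c &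
  forall y, inv s y -> rho (y * f) = rho (y * c)].

Lemma bseq_rhoM (a : A) (F : nat -> A) : (forall n, ub (F n)) ->
  bseq (fun n => rho (a * F n)).
Proof.
move=> hF; have [c c0 uc] := ub_all a.
exists c^-1 => n; rewrite -[c^-1]mulr1 ler_pdivlMl// -[c in c * _]gtr0_norm//.
by rewrite -normrM -rho_kk mulrA; apply: rho_abs; exact: ub_M.
Qed.

(** The mean ergodic theorem in weak form: shift invariance of [m0] makes the weak limit
    [s]-invariant, and the pairing of [U (s *+ n) f] with an invariant function does not depend on
    [n]. *)
Lemma isP_wmean s f F : ub f -> ub F ->
  (forall a, rho (a * F) = m0 (fun n => rho (a * U (s *+ n) f))) -> isP s f F.
Proof.
move=> uf uF hF; have hu n : ub (U (s *+ n) f) by exact: ub_U.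
split => //.
  move=> a; have -> : a * U s F = U s (U (- s) a * F).
    by rewrite rmorphM U_D subrr U_0.
  rewrite rho_U hF hF -[RHS](meanS hm0); last exact: bseq_rhoM.
  congr m0; apply: funext => n.
  by rewrite -(rho_U s) rmorphM !U_D subrr U_0 mulrS.
move=> y iy; rewrite hF -(mean_cst hm0 (rho (y * f))); congr m0.
apply: funext => n; rewrite -(rho_U (s *+ n)) rmorphM.
exact: (aeq_rhoM _ (inv_muln n iy)).
Qed.

Lemma isP_ex s f : ub f -> exists c, isP s f c.
Proof.
move=> uf; have hu n : ub (U (s *+ n) f) by exact: ub_U.
have [F uF hF] := wmean hm0 hu; exists F; exact: isP_wmean.
Qed.

(** The difference [c - e] is invariant, hence may be tested against its own conjugate, which gives
    norm [0]. *)
Lemma isP_uniq s f g c e : aeq f g -> isP s f c -> isP s g e -> aeq c e.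
Proof.
move=> fg [uc ic hc] [ue ie he].
have ice : inv s (c - e) by apply: inv_D => //; exact: inv_opp.
have h0 : rho ((c - e) * cj (c - e)) = 0.
  have := inv_cj ice; move: (cj _) => y iy.
  by rewrite mulrC mulrBr rhoB -hc// -he// fg subrr.
move=> a; apply/eqP; rewrite -subr_eq0 -rhoB -mulrBr -sqrf_eq0 eq_le sqr_ge0 andbT.
by apply: (le_trans (rho_CS a (c - e))); rewrite h0 mulr0.
Qed.

Lemma isP_U s h f c : isP s f c -> isP s (U h f) (U h c).
Proof.
move=> [uc ic hc]; split; [exact: ub_U|exact: inv_U|] => y iy.
rewrite -(rho_U (- h)) -[RHS](rho_U (- h)) !rmorphM !U_D addNr !U_0.
by apply: hc; exact: inv_U.
Qed.

Lemma isP_cj s f c : isP s f c -> isP s (cj f) (cj c).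
Proof.
move=> [uc ic hc]; split; [exact: ub_cj|exact: inv_cj|] => y iy.
rewrite -rho_cj -[RHS]rho_cj !rmorphM !cjK; apply: hc; exact: inv_cj.
Qed.

(** A choice of the projection, determined up to [aeq]; the default [0] is taken when none exists,
    which does not happen for bounded [f]. *)
Definition PP s f : A :=
  if pselect (exists c, isP s f c) is left e then sval (cid e) else 0.

Lemma PPP s f : ub f -> isP s f (PP s f).
Proof.
rewrite /PP => uf; case: pselect => [e|]; last by case; exact: isP_ex.
by case: cid.
Qed.

Lemma PP_mean s f a : ub f ->
  rho (a * PP s f) = m0 (fun n => rho (a * U (s *+ n) f)).
Proof.
move=> uf; have hu n : ub (U (s *+ n) f) by exact: ub_U.
have [F uF hF] := wmean hm0 hu; rewrite -hF.
exact: (isP_uniq (aeq_refl f) (PPP s uf) (isP_wmean uf uF hF)).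
Qed.

(** The square of the first-order seminorm of [f] along [s]. *)
Definition Psi s f := rho (PP s f * cj (PP s f)).

Lemma Psi_ge0 s f : 0 <= Psi s f. Proof. exact: rho_ge0. Qed.

Lemma Psi_le1 s f : ub f -> Psi s f <= 1.
Proof.
move=> /(@PPP s)[u _ _]; apply: rho_le1; apply: ub_M => //; exact: ub_cj.
Qed.

Lemma Psi_E s f c : ub f -> isP s f c -> Psi s f = rho (c * cj c).
Proof.
move=> uf hc; have e := isP_uniq (aeq_refl f) (PPP s uf) hc.
by apply: aeq_rho; apply: aeq_M => //; exact: aeq_cj.
Qed.

Lemma Psi_U s h f : ub f -> Psi s (U h f) = Psi s f.
Proof.
move=> uf; rewrite (Psi_E (ub_U h uf) (isP_U h (PPP s uf))).
by rewrite -U_cj -rmorphM rho_U.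
Qed.

Lemma rho_Psi s f y : ub f -> ub y -> inv s y -> rho (f * y) ^+ 2 <= Psi s f.
Proof.
move=> uf uy iy; have [_ _ h] := PPP s uf.
by rewrite mulrC h//; exact: rho_CS1.
Qed.

Definition dl s f (h h' : seq nat) : A :=
  bp (fun v => U (s *+ sumn v) f) h h'.

(* A finitary version of the Host-Kra seminorm of [f] of order [size Hs + 1] along [s]. *)
Definition QQ s Hs f := Av Hs (fun h h' => Psi s (dl s f h h')).

Lemma dl_ub s f h h' : ub f -> ub (dl s f h h').
Proof. by move=> uf; apply: bp_ub => v; exact: ub_U. Qed.

Lemma dl_cons s f a a' h h' :
  dl s f (a :: h) (a' :: h') = dl s (U (s *+ a) f * cj (U (s *+ a') f)) h h'.
Proof.
rewrite /dl /=; apply: bp_ext => v.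
by rewrite !mulrnDr rmorphM U_cj !U_D ![s *+ sumn v + _]addrC.
Qed.

Lemma QQ_cons s H Hs f : QQ s (H :: Hs) f = avg H (fun a => avg H (fun b =>
  QQ s Hs (U (s *+ a) f * cj (U (s *+ b) f)))).
Proof.
rewrite /QQ /=; apply: avg_ext => a _; apply: avg_ext => b _.
by apply: Av_ext => h h' _ _; rewrite dl_cons.
Qed.

Lemma dl_U s k f h h' : dl s (U k f) h h' = U k (dl s f h h').
Proof. by rewrite /dl -bp_U; apply: bp_ext => v; rewrite !U_D addrC. Qed.

Lemma QQ_U s k Hs f : ub f -> QQ s Hs (U k f) = QQ s Hs f.
Proof.
by move=> uf; apply: Av_ext => h h' _ _; rewrite dl_U Psi_U//; exact: dl_ub.
Qed.

Lemma QQ_ge0 s Hs f : 0 <= QQ s Hs f.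
Proof. by apply: Av_ge0 => *; exact: Psi_ge0. Qed.

End Boxes.

Lemma avg_block (R : realType) N M (f : nat -> R) :
  avg (N * M) f = avg N (fun j => avg M (fun a => f (j * M + a)%N)).
Proof.
rewrite /avg -mulr_sumr mulrA -invfM -natrM; congr (_ * _).
elim: N => [|N IH]; first by rewrite !big_ord0.
rewrite [RHS]big_ord_recr/= -IH mulSnr big_split_ord/=; congr (_ + _).
Qed.

(** * The inverse theorem for the second-order seminorm *)

Section U2Inverse.
Variables (R : realType) (A : dsys R).
Implicit Types (g u v y z : A).

Variables (g : A) (s : {poly int}) (c : nat -> nat -> A).
Hypotheses (ug : ub g) (uc : forall a b, ub (c a b)) (ic : forall a b, inv s (c a b)).
Hypothesis hc : forall a b y, inv s y ->
  rho (y * (U (s *+ a) g * cj (U (s *+ b) g))) = rho (y * c a b).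

Let isPc a b : isP s (U (s *+ a) g * cj (U (s *+ b) g)) (c a b).
Proof. by split=> // y iy; exact: hc. Qed.

(** Applying [U s] shifts both indices, while the projection is invariant. *)
Lemma c_toeplitz a b : weq rho (c a.+1 b.+1) (c a b).
Proof.
have h := isP_U s (isPc a b); rewrite rmorphM U_cj !U_D -!mulrS in h.
by apply: aeq_trans (ic a b); apply: isP_uniq (isPc _ _) h; exact: aeq_refl.
Qed.

Lemma c_toeplitzD i a b : weq rho (c (i + a) (i + b)) (c a b).
Proof.
elim: i => [|i IH]; first by move=> y.
by rewrite !addSn; apply: aeq_trans IH; exact: c_toeplitz.
Qed.

Lemma c_herm a b : weq rho (cj (c a b)) (c b a).
Proof.
have h := isP_cj (isPc a b); rewrite rmorphM cjK mulrC in h.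
by apply: isP_uniq h (isPc _ _); exact: aeq_refl.
Qed.

(** [W M] is the squared norm of the average of [F a = v * cj z ^+ a * U (s *+ a) g] over [M] terms.
    The Gram matrix of [F] is Toeplitz, so all blocks of [M] consecutive terms give the same norm,
    and averaging [N] blocks cannot increase it. *)
Lemma c_fejer z v (W := fun M => avg M (fun a => avg M (fun b =>
       rho (v * cj v * (cj z ^+ a * z ^+ b * c a b))))) :
     z * cj z = 1 -> (forall h, U h z = z) -> inv s v ->
     (forall M, 0 <= W M) /\ (forall M N, (0 < M)%N -> (0 < N)%N -> W (N * M)%N <= W M).
Proof.
move=> hz cz iv; pose F a := v * cj z ^+ a * U (s *+ a) g.
have iz : inv s z by rewrite /inv cz.
have FF a b : rho (F a * cj (F b)) = rho (v * cj v * (cj z ^+ a * z ^+ b * c a b)).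
  rewrite mulrA -hc; last first.
    apply: inv_M; first by apply: inv_M => //; exact: inv_cj.
    by apply: inv_M; rewrite /inv rmorphXn/= ?U_cj cz.
  by congr (rho _); rewrite /F !rmorphM rmorphXn/= cjK; ring.
have shift i a b : rho (F (i + a)%N * cj (F (i + b)%N)) = rho (F a * cj (F b)).
  rewrite !FF; have -> : cj z ^+ (i + a) * z ^+ (i + b) = cj z ^+ a * z ^+ b.
    have -> : cj z ^+ (i + a) * z ^+ (i + b) = (z * cj z) ^+ i * (cj z ^+ a * z ^+ b).
      by rewrite exprMn_comm ?[z ^+ (i + b)]exprD ?exprD; [ring|exact: mulrC].
    by rewrite hz expr1n mul1r.
  by rewrite !mulrA; exact: c_toeplitzD.
have WE M : W M = avg M (fun a => avg M (fun b => rho (F a * cj (F b)))).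
  by apply: avg_ext => a _; apply: avg_ext => b _; rewrite FF.
split=> [M|M N M0 N0]; first by rewrite WE -avg_sq; exact: rho_ge0.
pose Y j := kk (M%:R^-1) * \sum_(a < M) F (j * M + a)%N.
have YY j : rho (Y j * cj (Y j)) = W M.
  rewrite (avg_sq M (fun a => F (j * M + a)%N)) WE.
  by apply: avg_ext => a _; apply: avg_ext => b _; rewrite shift.
have WNM : W (N * M)%N = avg N (fun j => avg N (fun k => rho (Y j * cj (Y k)))).
  rewrite WE avg_block; apply: avg_ext => j _.
  under avg_ext do rewrite avg_block.
  rewrite avg_exch; apply: avg_ext => k _.
  rewrite /Y -mulrA mulr_suml rmorphM cj_kk.
  rewrite (@rho_avg _ A M (fun a => F (j * M + a)%N * _)); apply: avg_ext => a _.
  rewrite mulrCA rmorph_sum/= mulr_sumr.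
  by rewrite (@rho_avg _ A M (fun b => F (j * M + a)%N * cj (F (k * M + b)%N))).
rewrite WNM -(avg_cst (W M) N0); apply: avg_le => j _.
rewrite -(avg_cst (W M) N0); apply: avg_le => k _.
have := rho_ge0 (Y j - Y k).
have -> : (Y j - Y k) * cj (Y j - Y k) =
  Y j * cj (Y j) + Y k * cj (Y k) - Y j * cj (Y k) - Y k * cj (Y j).
  by rewrite rmorphB; ring.
by rewrite !rhoB rhoD !YY [rho (Y k * _)]rho_swap; lra.
Qed.

Variables (G lam : A) (kap : R).
Hypotheses (kap0 : 0 < kap) (uG : ub G) (GG : G * cj G = G) (iG : inv s G)
  (hlam : lam * cj lam = 1) (ilam : inv s lam).
Hypothesis hE : forall K, (0 < K)%N -> kap <= avg K (fun a =>
        avg K (fun b => rho (G * (cj lam ^+ a * lam ^+ b * c a b)))).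

Let u n := G * cj lam ^+ n * U (s *+ n) g.
Let beta n := rho (cj g * u n).
Let S n := \sum_(k < n) beta k.

Let uu n : ub (u n).
Proof.
apply: ub_M; last exact: ub_U.
by apply: ub_M => //; apply: ub_X; apply: ub_cj; exact: ub_unit.
Qed.

Let bbeta : bseq beta. Proof. by apply: bseq_rho => n; apply: ub_M => //; exact: ub_cj. Qed.

Let S_le n : S n <= n%:R.
Proof.
rewrite -[n in n%:R]card_ord -sumr_const; apply: ler_sum => i _.
by apply: rho_le1; apply: ub_M => //; exact: ub_cj.
Qed.

(** The array is Toeplitz, and symmetric because [rho] is a real part, so its double sum is governed
    by sums of the partial sums [S]. The diagonal is counted twice on the right, harmlessly since
    [beta 0 >= 0]. *)
Lemma eig_sum K : (0 < K)%N -> kap * K%:R ^+ 2 <= 2 * \sum_(n < K) S n.+1.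
Proof.
move=> K0; pose E a b := rho (G * (cj lam ^+ a * lam ^+ b * c a b)).
have cG : cj G = G by rewrite -GG rmorphM cjK mulrC.
have Esym a b : E a b = E b a.
  rewrite /E -rho_cj !rmorphM cG !rmorphXn/= cjK.
  rewrite [X in rho X]mulrA c_herm; congr (rho _); ring.
have ES a b : E a.+1 b.+1 = E a b.
  rewrite /E ![in RHS]mulrA -c_toeplitz; congr (rho _).
  rewrite !exprS; have -> : cj lam * cj lam ^+ a * (lam * lam ^+ b) =
    (lam * cj lam) * (cj lam ^+ a * lam ^+ b) by ring.
  by rewrite hlam mul1r; ring.
have E0 k : E k 0%N = beta k.
  rewrite /E [X in rho X]mulrA -hc; last first.
    by apply: inv_M => //; rewrite /inv expr0 mulr1 rmorphXn/= U_cj; exact: (aeq_X k (aeq_cj ilam)).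
  by rewrite mulr0n U_0 /beta /u; congr (rho _); ring.
have EE b k : E (b + k)%N b = beta k.
  by elim: b => [|b IH]; rewrite ?add0n ?E0// addSn ES.
have b0 : 0 <= beta 0%N.
  have := hE (ltn0Sn 0); rewrite -[avg _ _]/(avg 1 (fun a => avg 1 (fun b => E a b))).
  by rewrite /avg !big_ord1 invr1 !mul1r E0 => /(le_trans (ltW kap0)).
have row n : \sum_(b < n) E n b = S n.+1 - beta 0%N.
  rewrite /S big_ord_recl /= [RHS]addrC addKr.
  rewrite (reindex_inj rev_ord_inj)/=; apply: eq_bigr => i _.
  have -> : E n (n - i.+1)%N = E (n - i.+1 + i.+1)%N (n - i.+1)%N by rewrite subnK.
  by rewrite EE.
have Q n : \sum_(a < n) \sum_(b < n) E a b <= 2 * \sum_(k < n) S k.+1.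
  elim: n => [|n IH]; first by rewrite !big_ord0 mulr0.
  rewrite big_ord_recr/= [X in _ * X]big_ord_recr/=.
  under eq_bigr do rewrite big_ord_recr/=.
  rewrite big_split/= big_ord_recr/= -[E n n]/(E n n).
  under [X in _ + X + _]eq_bigr do rewrite Esym.
  have -> : E n n = beta 0%N by have := EE n 0%N; rewrite addn0.
  rewrite !row mulrDr; lra.
apply: le_trans (Q K); have := hE K0; rewrite /avg.
rewrite -mulr_sumr mulrA -invfM -expr2 mulrC ler_pdivlMr ?exprn_gt0 ?ltr0n//.
Qed.

(** Otherwise the sum in [eig_sum] would be at most [K * (T + kap * K / 4)], too small once
    [kap * K > 4 * T]. *)
Lemma eig_inf T : exists2 K, (T < K)%N & kap / 4 * K%:R <= S K.
Proof.
apply: contrapT => hn.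
have h n : (T < n)%N -> S n <= kap / 4 * n%:R.
  by move=> Tn; rewrite leNgt; apply/negP => /ltW hlt; apply: hn; exists n.
pose K := (Num.truncn (4 * T%:R / kap)).+1.
have hK : 4 * T%:R < kap * K%:R.
  by rewrite [kap * _]mulrC -ltr_pdivrMr// /K truncnS_gt.
have := eig_sum (ltn0Sn _ : (0 < K)%N).
have : \sum_(n < K) S n.+1 <= \sum_(n < K) (T%:R + kap / 4 * K%:R).
  apply: ler_sum => -[n nK] _ /=; have [Tn|nT] := ltnP T n.+1.
    apply: le_trans (h _ Tn) _; rewrite -[leLHS]add0r lerD// ler_wpM2l//.
      by rewrite divr_ge0// ltW.
    by rewrite ler_nat.
  apply: le_trans (S_le _) _; rewrite -[leLHS]addr0 lerD ?ler_nat//.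
  by rewrite mulr_ge0// divr_ge0// ltW.
rewrite sumr_const card_ord -mulr_natl => h1 h2.
have K1 : 0 < K%:R :> R by rewrite ltr0n.
have : kap * K%:R ^+ 2 <= 2 * (K%:R * (T%:R + kap / 4 * K%:R)) by lra.
have -> : 2 * (K%:R * (T%:R + kap / 4 * K%:R)) = K%:R * (2 * T%:R + kap * K%:R / 2) :> R by field.
have -> : kap * K%:R ^+ 2 = K%:R * (kap * K%:R) by ring.
rewrite ler_pM2l// => h3.
lra.
Qed.

(** Take a mean along windows [[0, K)] with [S K] large, and the weak limit [F] of
    [u n = G * cj lam ^+ n * U (s *+ n) g]. Shift invariance gives [U s F = lam * F], and the mean
    of [beta] is the correlation of [g] with [cj F]. *)
Lemma eig_chi : exists chi, ub chi /\ weq rho (U s chi) (cj lam * chi) /\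
  kap / 4 <= rho (g * chi).
Proof.
have /choice[Ks hKs] T : exists K, (T < K)%N /\ kap / 4 * K%:R <= S K.
  by have [K h1 h2] := eig_inf T; exists K.
have [m [hm hw]] := @window_mean R (fun=> 0%N) Ks (fun n => (hKs n).1).
have mb : kap / 4 <= m beta.
  apply: hw => // n; have [h1 h2] := hKs n.
  by rewrite /avg [leRHS]mulrC ler_pdivlMr ?ltr0n ?(leq_ltn_trans _ h1).
have [F uF hF] := wmean hm uu.
exists (cj F); split; [exact: ub_cj|split]; last first.
  by rewrite -rho_cj rmorphM cjK hF.
have h : weq rho (U s F) (lam * F).
  move=> a; rewrite mulrC rho_UM mulrC hF mulrA hF.
  rewrite -[RHS](meanS hm); last by apply: bseq_rhoM.
  congr m; apply: funext => n; rewrite mulrC -[s in LHS]opprK -rho_UM opprK mulrC.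
  rewrite /u !rmorphM rmorphXn/= U_cj U_D -mulrS.
  have e : weq rho (U s G * cj (U s lam) ^+ n) (G * cj lam ^+ n).
    by apply: aeq_M => //; apply: aeq_X; exact: aeq_cj.
  rewrite [LHS](_ : _ = rho ((a * U (s *+ n.+1) g) * (U s G * cj (U s lam) ^+ n))); last first.
    by congr (rho _); ring.
  rewrite e; congr (rho _); rewrite exprS.
  have -> : a * lam * (G * (cj lam * cj lam ^+ n) * U (s *+ n.+1) g) =
     (lam * cj lam) * (a * U (s *+ n.+1) g * (G * cj lam ^+ n)) by ring.
  by rewrite hlam mul1r.
by rewrite U_cj -rmorphM; exact: aeq_cj.
Qed.

End U2Inverse.

(** The correlation [kap] depends on [eta] only. The eigenvalue is an [s]-invariant function of
    modulus one, as [s] need not act ergodically. *)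
Lemma u2inv (R : realType) (A : dsys R) eta : 0 < eta -> exists2 kap, 0 < kap &
    forall (g : A) (s : {poly int}) (D : nat) (c : nat -> nat -> A),
    ub g -> (0 < D)%N -> (forall a b, ub (c a b)) ->
    (forall a b, weq rho (U s (c a b)) (c a b)) ->
    (forall a b y, weq rho (U s y) y ->
       rho (y * (U (s *+ a) g * cj (U (s *+ b) g))) = rho (y * c a b)) ->
    (forall T, exists2 t, (T <= t)%N & eta <= avg (D * t`!) (fun a =>
       avg (D * t`!) (fun b => rho (c a b * cj (c a b))))) ->
    exists chi lam, [/\ ub chi, lam * cj lam = 1, weq rho (U s lam) lam,
      weq rho (U s chi) (lam * chi) & kap <= rho (g * chi)].
Proof.
move=> eta0; have [kap k0 hk] := u2freq A eta0; exists (kap / 4); first by rewrite divr_gt0.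
move=> g s D c ug D0 uc ic hc hw.
have [] // := hk s D c D0 uc ic (c_toeplitz uc ic hc) (c_herm uc ic hc) _ hw.
  by move=> z v W hz cz iv; exact: (c_fejer uc ic hc hz cz iv).
move=> G [lam [[uG GG] iG hlam ilam hE]].
have [chi [h1 [h2 h3]]] := eig_chi ug uc ic hc k0 uG GG iG hlam ilam hE.
exists chi, (cj lam); split=> //; first by rewrite cjK mulrC.
by rewrite U_cj; exact: aeq_cj.
Qed.

(** * Shifts and differences of polynomials *)

Section PolyShift.
Variable T : idomainType.
Implicit Types (p q r : {poly T}) (z : T).

Definition shp z r := r \Po ('X + z%:P).

Lemma shpE z r x : (shp z r).[x] = r.[x + z].
Proof. by rewrite /shp horner_comp hornerD hornerX hornerC. Qed.

Lemma shpD z p q : shp z (p + q) = shp z p + shp z q.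
Proof. exact: comp_polyD. Qed.

Lemma shpN z p : shp z (- p) = - shp z p.
Proof. exact: raddfN. Qed.

Lemma size_XDC z : size ('X + z%:P) = 2%N.
Proof. by rewrite -[z%:P]opprK -polyCN size_XsubC. Qed.

Lemma size_shp z r : size (shp z r) = size r.
Proof. by rewrite /shp size_comp_poly2// size_XDC. Qed.

Lemma lead_shp z r : lead_coef (shp z r) = lead_coef r.
Proof.
rewrite /shp lead_coef_comp ?size_XDC// -[z%:P]opprK -polyCN.
by rewrite lead_coefXsubC expr1n mulr1.
Qed.

Lemma size_subl p q n : (size p <= n.+1)%N -> (size q <= n.+1)%N ->
  p`_n = q`_n -> (size (p - q)%R <= n)%N.
Proof.
move=> sp sq e; apply/leq_sizeP => j; rewrite leq_eqVlt coefB => /orP[/eqP<-|nj].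
  by rewrite e subrr.
by rewrite !nth_default ?subrr//; [exact: leq_trans sq nj|exact: leq_trans sp nj].
Qed.

Lemma size_dshp z w r : (size (shp z r - shp w r)%R <= (size r).-1)%N.
Proof.
case e : (size r) => [|n] /=.
  by move/eqP: e; rewrite size_poly_eq0 => /eqP->; rewrite /shp !comp_poly0 subrr size_poly0.
apply: size_subl; rewrite ?size_shp ?e//.
have h x : (shp x r)`_n = lead_coef r by rewrite -(lead_shp x) lead_coefE size_shp e.
by rewrite !h.
Qed.

Lemma coef_XDCn z n : ((('X + z%:P) ^+ n.+1)`_n = z *+ n.+1).
Proof.
elim: n => [|n IH]; first by rewrite expr1 coefD coefX coefC add0r.
rewrite exprSr mulrDr coefD coefMX/= IH coefMC [in RHS]mulrS addrC; congr (_ + _).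
have := lead_shp z ('X^(n.+1) : {poly T}).
rewrite lead_coefXn lead_coefE size_shp size_polyXn /= /shp comp_Xn_poly => ->.
by rewrite mul1r.
Qed.

Lemma coef_shp z q n : size q = n.+2 ->
  (shp z q)`_n = q`_n + lead_coef q * z *+ n.+1.
Proof.
move=> sq; rewrite /shp comp_polyE sq coef_sum !big_ord_recr/= big1 ?add0r; last first.
  move=> i _; rewrite coefZ [X in _ * X]nth_default ?mulr0//.
  by rewrite (leq_trans (size_poly_exp_leq _ _))// size_XDC mul1n.
rewrite !coefZ coef_XDCn lead_coefE sq/= mulrnAr; congr (_ + _).
have := lead_shp z ('X^n : {poly T}).
rewrite lead_coefXn lead_coefE size_shp size_polyXn /= /shp comp_Xn_poly => ->.
by rewrite mulr1.
Qed.

Lemma size_lead_eq p n : (size p <= n.+1)%N -> p`_n != 0 ->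
  size p = n.+1 /\ lead_coef p = p`_n.
Proof.
move=> sp pn; have e : size p = n.+1.
  apply/eqP; rewrite eqn_leq sp ltnNge; apply: contra pn => h.
  by rewrite nth_default.
by rewrite lead_coefE e.
Qed.

Lemma size_dshp_eq z r n : size r = n.+2 -> lead_coef r * z *+ n.+1 != 0 ->
  size (shp z r - r) = n.+1.
Proof.
move=> sr h; have e : (shp z r - r)`_n != 0 by rewrite coefB (coef_shp _ sr) addrAC subrr add0r.
have [] // := size_lead_eq _ e.
have sz : (size (shp z r) <= n.+2)%N by rewrite size_shp sr.
apply: size_subl => //; rewrite ?sr//.
by have := lead_shp z r; rewrite !lead_coefE size_shp sr/= => ->.
Qed.

End PolyShift.

(** * Polynomial phases *)

Section Phases.
Variables (R : realType) (A : dsys R).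
Implicit Types (f g u : A) (m : (nat -> R) -> R).

Notation aeq := (@weq R A rho).

(** Negative powers use the conjugate, which is the inverse exactly when [u * cj u = 1]. *)
Definition upow u (z : int) : A :=
  match z with Posz n => u ^+ n | Negz n => cj u ^+ n.+1 end.

Lemma upow1z z : upow 1 z = 1.
Proof. by case: z => n /=; rewrite ?rmorph1 expr1n. Qed.

Lemma upowS u z : u * cj u = 1 -> upow u (z + 1) = u * upow u z.
Proof.
move=> hu; case: z => [n|[|n]] /=.
- by rewrite addn1 exprS.
- by rewrite expr1 hu subnn expr0.
- by rewrite subn1 [in RHS]exprS mulrA hu mul1r.
Qed.

Lemma upowD u z w : u * cj u = 1 -> upow u (z + w) = upow u z * upow u w.
Proof.
move=> hu; elim/int_rec: z => [|n IH|n IH]; first by rewrite add0r /= mul1r.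
  rewrite intS (addrC (1 : int)) addrAC !upowS// IH; ring.
have e x : upow u (x - 1) = cj u * upow u x.
  by rewrite -[in RHS](subrK 1 x) upowS// mulrA (mulrC (cj u)) hu mul1r.
by rewrite intS opprD (addrC (- 1 : int)) addrAC !e IH; ring.
Qed.

Lemma upow_cj u z : cj (upow u z) = upow (cj u) z.
Proof. by case: z => n /=; rewrite rmorphXn. Qed.

Lemma upowM u v z : upow (u * v) z = upow u z * upow v z.
Proof. by case: z => n /=; rewrite ?rmorphM exprMn. Qed.

Lemma upow_unit u z : u * cj u = 1 -> upow u z * cj (upow u z) = 1.
Proof. by move=> hu; rewrite upow_cj -upowM hu upow1z. Qed.

Lemma upowN u z : u * cj u = 1 -> upow u (- z) = cj (upow u z).
Proof.
move=> hu; have e : upow u (- z) * upow u z = 1 by rewrite -upowD// addNr.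
by rewrite -[LHS]mulr1 -(upow_unit z hu) mulrA e mul1r.
Qed.

Lemma upow_U h u z : U h (upow u z) = upow (U h u) z.
Proof. by case: z => n /=; rewrite rmorphXn//= U_cj. Qed.

Lemma upow_mul u (n : nat) z : u * cj u = 1 -> upow u (n%:Z * z) = upow (u ^+ n) z.
Proof.
move=> hu; elim: n => [|n IH]; first by rewrite mul0r expr0 upow1z.
by rewrite intS mulrDl mul1r upowD// IH exprS upowM.
Qed.

Fixpoint uni (ths : seq A) : Prop :=
  if ths is th :: t then th * cj th = 1 /\ uni t else True.

(* Stops at the shorter list; the lengths always agree in use. *)
Fixpoint ph (rs : seq {poly int}) (ths : seq A) (n : nat) : A :=
  match rs, ths with
  | r :: rs', th :: ths' => upow th r.[n%:Z] * ph rs' ths' n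
  | _, _ => 1
  end.

Definition shz (z : nat) (r : {poly int}) := shp z%:Z r.
Definition dif (a b : nat) (r : {poly int}) := shz a r - shz b r.

Lemma shzE z r n : (shz z r).[n%:Z] = r.[(n + z)%N%:Z].
Proof. by rewrite /shz shpE PoszD. Qed.

Lemma size_dif a b r : (size (dif a b r) <= (size r).-1)%N.
Proof. exact: size_dshp. Qed.

Lemma ph_unit rs ths n : uni ths -> ph rs ths n * cj (ph rs ths n) = 1.
Proof.
elim: rs ths => [|r rs IH] [|th ths] //=; rewrite ?rmorph1 ?mulr1// => -[h1 h2].
by rewrite rmorphM mulrACA IH// upow_unit// mulr1.
Qed.

Lemma ph_ub rs ths n : uni ths -> ub (ph rs ths n).
Proof. by move=> h; apply: ub_unit; exact: ph_unit. Qed.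

Lemma ph_dif rs ths n a b : uni ths ->
  ph rs ths (n + a)%N * cj (ph rs ths (n + b)%N) = ph (map (dif a b) rs) ths n.
Proof.
elim: rs ths => [|r rs IH] [|th ths] //=; rewrite ?rmorph1 ?mulr1// => -[h1 h2].
by rewrite rmorphM mulrACA IH// -upowN// -upowD// /dif hornerD hornerN !shzE.
Qed.

Lemma ph_cst rs ths n : all (fun r : {poly int} => size r <= 1)%N rs ->
  ph rs ths n = ph rs ths 0.
Proof.
elim: rs ths => [|r rs IH] [|th ths] //= /andP[/size1_polyC -> h].
by rewrite IH// !hornerC.
Qed.

Lemma bpX (w : seq nat -> A) n h h' :
  bp (fun v => w v ^+ n) h h' = bp w h h' ^+ n.
Proof.
elim: n => [|n IH]; first by rewrite expr0 -[RHS](bp_1 A h h'); exact: bp_ext.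
by rewrite exprS -IH -bpM; apply: bp_ext => v; rewrite exprS.
Qed.

Fixpoint uba (fs : seq A) : Prop := if fs is f :: t then ub f /\ uba t else True.

Lemma uba_cat fs gs : uba fs -> uba gs -> uba (fs ++ gs).
Proof. by elim: fs => //= f fs IH [h1 h2] h; split=> //; exact: IH. Qed.

Lemma uba_map (F : A -> A) fs : (forall f, ub f -> ub (F f)) -> uba fs -> uba (map F fs).
Proof. by move=> hF; elim: fs => //= f fs IH [h1 h2]; split; auto. Qed.

End Phases.

(** * Averages with linear exponents along one transformation *)

Section Lin.
Variables (R : realType) (A : dsys R).
Variables (m0 : (nat -> R) -> R) (hm0 : is_mean m0) (s : {poly int}).
Implicit Types (f g u : A) (m : (nat -> R) -> R).

Local Notation Q := (@QQ R A s).

Lemma sum_mul (K c : nat) (F : nat -> R) :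
  \sum_(i < c * K) F i = \sum_(a < K) \sum_(t < c) F (c * a + t)%N.
Proof.
elim: K => [|K IH]; first by rewrite muln0 !big_ord0.
by rewrite mulnS addnC big_split_ord/= IH big_ord_recr.
Qed.

Lemma scale_le (x y a b : R) : 0 < x -> 0 < y -> x * a <= b ->
  y^-1 * (y^-1 * a) <= x * ((x * y)^-1 * ((x * y)^-1 * b)).
Proof.
move=> x0 y0 h; rewrite -subr_ge0.
have -> : x * ((x * y)^-1 * ((x * y)^-1 * b)) - y^-1 * (y^-1 * a) =
    (b - x * a) / (x * y ^+ 2).
  by field; rewrite !lt0r_neq0.
by rewrite divr_ge0 ?subr_ge0// mulr_ge0 ?exprn_ge0// ltW.
Qed.

(** With [C = |c|], the value at [(C a, C b)] is shared by its [C] diagonal translates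
    [(C a + t, C b + t)], all in the window of length [C K]; the other pairs contribute
    nonnegatively. For negative [c] a further translation exchanges the roles of [a] and [b]. *)
Lemma win_conv (c : int) K (Hs : seq nat) f : c != 0 -> ub f ->
  avg K (fun a => avg K (fun b =>
    Q Hs (U (s *~ (c * a%:Z)) f * cj (U (s *~ (c * b%:Z)) f)))) <=
  `|c|%N%:R * Q ((`|c| * K)%N :: Hs) f.
Proof.
move=> c0 uf; rewrite QQ_cons; set C := `|c|%N.
have C0 : (0 < C)%N by rewrite absz_gt0.
pose psi (i j : int) := Q Hs (U (s *~ i) f * cj (U (s *~ j) f)).
have psi_sh i j t : psi (i + t) (j + t) = psi i j.
  rewrite /psi -(QQ_U hm0 s (s *~ t) Hs (f := U (s *~ i) f * cj (U (s *~ j) f))).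
    by rewrite rmorphM U_cj !U_D -!mulrzDr ![t + _]addrC.
  by apply: ub_M; [exact: ub_U|apply: ub_cj; exact: ub_U].
have psi0 i j : 0 <= psi i j by exact: QQ_ge0.
rewrite (_ : avg K _ = avg K (fun a => avg K (fun b => psi (C * a)%N (C * b)%N))).
  rewrite (_ : avg (C * K) _ = avg (C * K) (fun a => avg (C * K) (fun b => psi a b))); last first.
    by apply: avg_ext => a _; apply: avg_ext => b _; rewrite /psi !pmulrn.
  case: K => [|K].
    by rewrite /avg muln0 !big_ord0 !mulr0.
  rewrite /avg -!mulr_sumr.
  set SK := \sum_(i < K.+1) _.
  set SH := \sum_(i < C * K.+1) _.
  have hS : C%:R * SK <= SH.
    rewrite /SH (sum_mul K.+1 C (fun i => \sum_(j < C * K.+1) psi i j)) /SK mulr_sumr.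
  apply: ler_sum => a _.
    rewrite (_ : C%:R * _ = \sum_(t < C) \sum_(b < K.+1) psi (C * a)%N (C * b)%N); last first.
      by rewrite sumr_const card_ord mulr_natl.
    apply: ler_sum => t _.
    rewrite (sum_mul K.+1 C (fun j => psi (C * a + t)%N j)); apply: ler_sum => b _.
    rewrite (bigD1 t)//= -(psi_sh _ _ t%:Z) -!PoszD lerDl sumr_ge0//.
  by rewrite natrM; apply: scale_le => //; rewrite ltr0n.
have [cp|cn] := leP 0 c.
  have cE : c = C%:Z by rewrite /C gez0_abs.
  by apply: avg_ext => a _; apply: avg_ext => b _; rewrite cE -!PoszM.
have cE : c = - C%:Z by rewrite /C ltz0_abs// opprK.
rewrite avg_exch; apply: avg_ext => a _; apply: avg_ext => b _.
rewrite -/(psi _ _) -(psi_sh _ _ (C%:Z * (a%:Z + b%:Z))) cE !PoszM.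
congr psi; ring.
Qed.

Fixpoint tml (cs : seq int) (fs : seq A) (n : nat) : A :=
  match cs, fs with
  | c :: cs', f :: fs' => U (s *~ (c * n%:Z)) f * tml cs' fs' n
  | _, _ => 1
  end.

Lemma tml_ub cs fs n : uba fs -> ub (tml cs fs n).
Proof.
elim: cs fs => [|c cs IH] [|f fs] //= [uf hf].
by apply: ub_M; [exact: ub_U|exact: IH].
Qed.

Fixpoint tmd (a b : nat) (cs : seq int) (fs : seq A) : seq A :=
  match cs, fs with
  | c :: cs', f :: fs' =>
    (U (s *~ (c * a%:Z)) f * cj (U (s *~ (c * b%:Z)) f)) :: tmd a b cs' fs'
  | _, _ => [::]
  end.

Lemma tmd_ub a b cs fs : uba fs -> uba (tmd a b cs fs).
Proof.
elim: cs fs => [|c cs IH] [|f fs] //= [uf hf]; split; last exact: IH.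
by apply: ub_M; [exact: ub_U|apply: ub_cj; exact: ub_U].
Qed.

Lemma U_mulzS c (n a : nat) f :
  U (s *~ (c * (n + a)%N%:Z)) f = U (s *~ (c * n%:Z)) (U (s *~ (c * a%:Z)) f).
Proof. by rewrite U_D -mulrzDr PoszD mulrDr. Qed.

Lemma tmdE a b cs fs n : tml cs fs (n + a)%N * cj (tml cs fs (n + b)%N) =
  tml cs (tmd a b cs fs) n.
Proof.
elim: cs fs => [|c cs IH] [|f fs] /=; rewrite ?rmorph1 ?mulr1//.
by rewrite rmorphM mulrACA IH !U_mulzS -!U_cj -rmorphM.
Qed.

Lemma tml_rec d cs fs n : U (s *~ (- d * n%:Z)) (tml cs fs n) =
  tml (map (fun c => c - d) cs) fs n.
Proof.
elim: cs fs => [|c cs IH] [|f fs] /=; rewrite ?rmorph1//.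
rewrite rmorphM IH U_D -mulrzDr; congr (U (s *~ _) _ * _); ring.
Qed.

Definition mulw (M : nat) (Hs : seq nat) := all (fun H => (0 < H)%N && (M %| H)%N) Hs.

Lemma mulw_dvd M N Hs : (M %| N)%N -> mulw N Hs -> mulw M Hs.
Proof.
move=> MN; apply: sub_all => H /andP[-> h] /=; exact: dvdn_trans h.
Qed.

Lemma mulw_pos M Hs : mulw M Hs -> posw Hs.
Proof. by apply: sub_all => H /andP[]. Qed.

(** The constants precede the mean, the functions and the phases, since van der Corput changes these
    at every step. Each step costs one order: [D] of them trivialise phases of degree at most [D],
    and one more is spent on each function of [fs]. *)
Definition LinP (c : int) (cs : seq int) (D : nat) := forall d : R, 0 < d ->
  exists c' M, [/\ 0 < c', (0 < M)%N & forall m f0 f fs rs ths,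
    is_mean m -> ub f0 -> ub f -> uba fs -> uni ths -> size fs = size cs ->
    all (fun r : {poly int} => size r <= D.+1)%N rs ->
    d <= m (fun n => rho (f0 * (U (s *~ (c * n%:Z)) f * tml cs fs n * ph rs ths n))) ->
    forall Hs, size Hs = (D + size cs).+1 -> mulw M Hs -> c' <= Q Hs f].

(* Pigeonhole over the pairs of shifts, then the change of step [win_conv]. *)
Lemma pair_avg (c : int) (x : nat -> nat -> R) (d c' : R) K Hs f :
  c != 0 -> ub f -> 0 < d -> 0 < c' -> posw Hs ->
  (forall a b, x a b <= 1) ->
  d <= avg K (fun a => avg K (fun b => x a b)) ->
  (forall a b, d / 2 <= x a b ->
    c' <= Q Hs (U (s *~ (c * a%:Z)) f * cj (U (s *~ (c * b%:Z)) f))) ->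
  c' * d / (2 * `|c|%N%:R) <= Q ((`|c| * K)%N :: Hs) f.
Proof.
move=> c0 uf d0 c'0 pH x1 hd hx.
have C0 : (0 : R) < `|c|%N%:R by rewrite ltr0n absz_gt0.
have := win_conv K Hs c0 uf; set S := avg K _ => hS.
suff : c' * d / 2 <= S.
  move=> h; rewrite ler_pdivrMr ?mulr_gt0//.
  by have := le_trans h hS; lra.
have : d <= d / 2 + c'^-1 * S.
  apply: (le_trans hd); case: K {hd} @S hS => [|K] S hS.
    by rewrite {1}/avg big_ord0 mulr0 /S /avg big_ord0 !mulr0; lra.
  rewrite -[d / 2](@avg_cst _ K.+1)// -avgZ -avgD; apply: avg_le => a _.
  rewrite -[d / 2](@avg_cst _ K.+1)// -avgZ -avgD; apply: avg_le => b _.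
  have [h|h] := leP (d / 2) (x a b).
    have h' := hx _ _ h.
    apply: (le_trans (x1 a b)); rewrite -[leLHS]add0r lerD//.
      by rewrite divr_ge0// ltW.
    by rewrite ler_pdivlMl// mulr1.
  by rewrite (le_trans (ltW h))// lerDl mulr_ge0 ?invr_ge0 ?(ltW c'0)//; exact: QQ_ge0.
move=> h; have : d / 2 <= c'^-1 * S by lra.
by rewrite ler_pdivlMl// mulrA.
Qed.

Lemma lin_prod a b c cs f fs rs ths n (uu := fun n =>
    U (s *~ (c * n%:Z)) f * tml cs fs n * ph rs ths n) : uni ths ->
  uu (n + a)%N * cj (uu (n + b)%N) =
  U (s *~ (c * n%:Z)) (U (s *~ (c * a%:Z)) f * cj (U (s *~ (c * b%:Z)) f)) *
  tml cs (tmd a b cs fs) n * ph (map (dif a b) rs) ths n.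
Proof.
move=> hu; rewrite /uu -tmdE -ph_dif// !rmorphM !U_mulzS U_cj; ring.
Qed.

Lemma size_tmd a b cs fs : size fs = size cs -> size (tmd a b cs fs) = size cs.
Proof. by elim: cs fs => [|c cs IH] [|f fs] //= [/IH ->]. Qed.

Lemma dl_nil f : dl s f [::] [::] = f.
Proof. by rewrite /dl /= mulr0n U_0. Qed.

Lemma Lin_base c : c != 0 -> LinP c [::] 0.
Proof.
move=> c0 d d0; have C0 : (0 : R) < `|c|%N%:R by rewrite ltr0n absz_gt0.
exists ((d ^+ 2) ^+ 2 / `|c|%N%:R), `|c|%N; split.
- by rewrite divr_gt0// !exprn_gt0.
- by rewrite absz_gt0.
move=> m f0 f [|//] rs ths hm u0 uf _ hu _ hr hd [|H [|//]]//= _ /andP[/andP[H0 /dvdnP[K KE]] _].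
have K0 : (0 < K)%N by move: H0; rewrite KE; case: (K).
have un n : ub (U (s *~ (c * n%:Z)) f) by exact: ub_U.
have ug (a b : nat) : ub (U (s *~ (c * a%:Z)) f * cj (U (s *~ (c * b%:Z)) f)).
  by apply: ub_M => //; exact: ub_cj.
have hd' : d <= m (fun n => rho ((f0 * ph rs ths 0) * U (s *~ (c * n%:Z)) f)).
  apply: (le_trans hd); rewrite le_eqVlt; apply/orP; left; apply/eqP; congr m.
  by apply: funext => n; rewrite mulr1 (ph_cst _ n hr) -mulrA [U _ _ * _]mulrC.
have := @vdC _ _ m _ _ id _ _ hm K0 (ub_M u0 (ph_ub _ 0 hu)) un (ltW d0) hd'.
set x := fun a b => rho (U (s *~ (c * a%:Z)) f * cj (U (s *~ (c * b%:Z)) f)).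
rewrite (_ : avg K _ = avg K (fun a => avg K (fun b => x a b))); last first.
  apply: avg_ext => a _; apply: avg_ext => b _; rewrite -[RHS](mean_cst hm).
  congr m; apply: funext => n; rewrite !U_mulzS.
  by rewrite -U_cj -rmorphM rho_U.
move=> hx; rewrite ler_pdivrMr// mulrC.
have := win_conv K [::] c0 uf; rewrite -[(`|c| * K)%N]mulnC -KE => hw.
apply: (le_trans _ hw).
apply: (@le_trans _ _ (avg K (fun a => avg K (fun b => x a b)) ^+ 2)).
  by apply: lerXn2r; rewrite ?nnegrE ?sqr_ge0// (le_trans _ hx)// sqr_ge0.
apply: (le_trans (avg_sqr _ _)); apply: avg_le => a _.
apply: (le_trans (avg_sqr _ _)); apply: avg_le => b _.
rewrite /QQ /= dl_nil /x -[X in rho X]mulr1; apply: (rho_Psi hm0) => //.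
exact: inv_1.
Qed.

(** One application of van der Corput differentiates all the phases and leaves the linear exponents
    unchanged. *)
Lemma Lin_phase c cs D : c != 0 -> LinP c cs D -> LinP c cs D.+1.
Proof.
move=> c0 IH d d0; have C0 : (0 : R) < `|c|%N%:R by rewrite ltr0n absz_gt0.
have [|c1 [M1 [c10 M10 h1]]] := IH (d ^+ 2 / 2); first by rewrite divr_gt0// exprn_gt0.
exists (c1 * d ^+ 2 / (2 * `|c|%N%:R)), (`|c| * M1)%N; split.
- by rewrite divr_gt0// mulr_gt0// exprn_gt0.
- by rewrite muln_gt0 absz_gt0 c0.
move=> m f0 f fs rs ths hm u0 uf ufs hu sf hr hd [//|H Hs] /= [sH].
move=> /andP[/andP[H0 /(dvdn_trans (dvdn_mulr M1 (dvdnn `|c|)))/dvdnP[K KE]] hH].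
have hH1 : mulw M1 Hs by apply: mulw_dvd hH; exact: dvdn_mull.
have K0 : (0 < K)%N by move: H0; rewrite KE; case: (K).
pose u n := U (s *~ (c * n%:Z)) f * tml cs fs n * ph rs ths n.
have un n : ub (u n).
  by apply: ub_M; [apply: ub_M; [exact: ub_U|exact: tml_ub]|exact: ph_ub].
have := @vdC _ _ m _ _ id _ _ hm K0 u0 un (ltW d0) hd.
rewrite KE [(K * _)%N]mulnC => hx; apply: (pair_avg c0 uf _ c10 _ _ hx).
- by rewrite exprn_gt0.
- exact: mulw_pos hH1.
- have ub2 a b n : ub (u (n + a)%N * cj (u (n + b)%N)).
    by apply: ub_M => //; exact: ub_cj.
  move=> a b; apply: (mean_lec hm); first by apply: bseq_rho => n; exact: ub2.
  by move=> n; apply: rho_le1; exact: ub2.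
move=> a b hab; apply: (h1 m 1 _ (tmd a b cs fs) (map (dif a b) rs) ths hm) => //.
- by apply: ub_M; [|apply: ub_cj]; exact: ub_U.
- exact: tmd_ub.
- by rewrite size_tmd.
- rewrite all_map; apply: sub_all hr => r hr /=.
  by apply: (leq_trans (size_dif _ _ _)); move: hr; case: (size r).
- apply: (le_trans hab); rewrite le_eqVlt; apply/orP; left; apply/eqP; congr m.
  by apply: funext => n; rewrite mul1r -lin_prod.
Qed.

(** The phases are constant here and join [f0]. After van der Corput, everything is translated by
    [U (s *~ (- c1 * n))]: the function of exponent [c1] stops moving and becomes the new [f0], and
    the other exponents are reduced by [c1]. *)
Lemma Lin_step c c1 cs : c != 0 -> c1 != c -> LinP (c - c1) (map (fun x => x - c1) cs) 0 ->
  LinP c (c1 :: cs) 0.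
Proof.
move=> c0 cc1 IH d d0; have C0 : (0 : R) < `|c|%N%:R by rewrite ltr0n absz_gt0.
have [|k1 [M1 [k10 M10 h1]]] := IH (d ^+ 2 / 2); first by rewrite divr_gt0// exprn_gt0.
exists (k1 * d ^+ 2 / (2 * `|c|%N%:R)), (`|c| * M1)%N; split.
- by rewrite divr_gt0// mulr_gt0// exprn_gt0.
- by rewrite muln_gt0 absz_gt0 c0.
move=> m f0 f [//|F fs] rs ths hm u0 uf [uF ufs] hu [sf] hr hd [//|H Hs] /= [sH].
move=> /andP[/andP[H0 /(dvdn_trans (dvdn_mulr M1 (dvdnn `|c|)))/dvdnP[K KE]] hH].
have hH1 : mulw M1 Hs by apply: mulw_dvd hH; exact: dvdn_mull.
have K0 : (0 < K)%N by move: H0; rewrite KE; case: (K).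
pose u n := U (s *~ (c * n%:Z)) f * tml (c1 :: cs) (F :: fs) n * ph [::] [::] n.
have un n : ub (u n).
  by apply: ub_M; [apply: ub_M; [exact: ub_U|exact: tml_ub]|].
have hd' : d <= m (fun n => rho ((f0 * ph rs ths 0) * u n)).
  apply: (le_trans hd); rewrite le_eqVlt; apply/orP; left; apply/eqP; congr m.
  apply: funext => n; rewrite (ph_cst _ n hr) /u /= mulr1 -[in RHS]mulrA.
  by rewrite [in RHS](mulrC (ph _ _ _)).
have := @vdC _ _ m _ _ id _ _ hm K0 (ub_M u0 (ph_ub _ 0 hu)) un (ltW d0) hd'.
rewrite KE [(K * _)%N]mulnC => hx; apply: (pair_avg c0 uf _ k10 _ _ hx).
- by rewrite exprn_gt0.
- exact: mulw_pos hH1.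
- have ub2 a b n : ub (u (n + a)%N * cj (u (n + b)%N)).
    by apply: ub_M => //; exact: ub_cj.
  move=> a b; apply: (mean_lec hm); first by apply: bseq_rho => n; exact: ub2.
  by move=> n; apply: rho_le1; exact: ub2.
move=> a b hab.
have uF' : ub (U (s *~ (c1 * a%:Z)) F * cj (U (s *~ (c1 * b%:Z)) F)).
  by apply: ub_M; [|apply: ub_cj]; exact: ub_U.
apply: (h1 m (U (s *~ (c1 * a%:Z)) F * cj (U (s *~ (c1 * b%:Z)) F)) _
  (tmd a b cs fs) [::] [::] hm) => //.
- by apply: ub_M; [|apply: ub_cj]; exact: ub_U.
- exact: tmd_ub.
- by rewrite size_tmd// size_map.
- apply: (le_trans hab); rewrite le_eqVlt; apply/orP; left; apply/eqP; congr m.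
  apply: funext => n; rewrite lin_prod// /= !mulr1.
  move: (U _ f * cj _) (U _ F * cj _) => g G1.
  rewrite -(rho_U (s *~ (- c1 * n%:Z))) !rmorphM /= !U_D -!mulrzDr.
  rewrite [X in s *~ X](_ : _ = (c - c1) * n%:Z); last by ring.
  rewrite (_ : - c1 * n%:Z + c1 * n%:Z = 0); last by ring.
  by rewrite mulr0z U_0 tml_rec mulrCA.
- by rewrite size_map sH.
Qed.

Theorem LinT c cs D : c != 0 -> all (fun x => x != c) cs -> LinP c cs D.
Proof.
elim: D => [|D IH] c0 hc; last by apply: Lin_phase => //; exact: IH.
elim: (size cs) {-2}cs (erefl (size cs)) c c0 hc => {cs} [|k IH] [|c1 cs] //=.
  by move=> _ c c0 _; exact: Lin_base.
move=> [sk] c c0 /andP[c1c hc]; apply: Lin_step => //; apply: IH.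
- by rewrite size_map.
- by rewrite subr_eq0 eq_sym.
- rewrite all_map; apply: sub_all hc => x /=; apply: contra.
  by move=> /eqP/(canRL (subrK _)) ->; rewrite subrK.
Qed.

End Lin.

(** * Polynomial families and the weight for their induction *)

Section Lex.

Fixpoint lexlt (t u : seq nat) : bool :=
  match t, u with
  | x :: t', y :: u' => (x < y)%N || ((x == y) && lexlt t' u')
  | _, _ => false
  end.

Lemma lex_ind n (P : seq nat -> Prop) :
  (forall u, size u = n -> (forall t, size t = n -> lexlt t u -> P t) -> P u) ->
  forall u, size u = n -> P u.
Proof.
elim: n P => [|n IH] P hP [|x u] //=.
  by move=> _; apply: hP => // -[].
move=> [su]; elim/ltn_ind: x u su => x IHx u su.
apply: (IH (fun u => P (x :: u))) su => {}u su hu; apply: hP; first by rewrite /= su.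
move=> [//|y t] [st] /= /orP[yx|/andP[/eqP-> tu]]; first exact: IHx.
exact: hu.
Qed.

End Lex.

Section PolyLemmas.
Variable s : {poly int}.
Hypothesis s0 : s != 0.
Implicit Types (q r p : {poly {poly int}}).

Lemma mulz_eq0 (c : int) : (s *~ c == 0) = (c == 0).
Proof.
rewrite -mulrzr mulf_eq0 (negPf s0)/= -[c%:~R](rmorph_int (@polyC int)) intz.
by rewrite polyC_eq0.
Qed.

(* Along [q] the dominant motion is that of [s] itself. *)
Definition good q := exists2 c : int, c != 0 & (1 < size q)%N /\ lead_coef q = s *~ c.

Lemma good_shp z q : good q -> good (shp z q).
Proof. by move=> [c c0 [h1 h2]]; exists c => //; rewrite size_shp lead_shp. Qed.

Lemma dshp_good (z : nat) q (c : int) n : (0 < z)%N -> size q = n.+2 ->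
  lead_coef q = s *~ c -> c != 0 ->
  size (shp z%:R q - q) = n.+1 /\
  lead_coef (shp z%:R q - q) = s *~ (c * (z * n.+1)%N%:Z).
Proof.
move=> z0 sq lq c0.
have e : (shp z%:R q - q)`_n = s *~ (c * (z * n.+1)%N%:Z).
  rewrite coefB (coef_shp _ sq) addrAC subrr add0r lq -mulrzr -[in RHS]mulrzr.
  by rewrite PoszM !intrM -!pmulrn -[_ *+ n.+1]mulr_natr !mulrA.
rewrite -e; apply: size_lead_eq.
  have sz : (size (shp z%:R q) <= n.+2)%N by rewrite size_shp sq.
  apply: size_subl => //; rewrite ?sq//.
  have := lead_shp z%:R q; rewrite !lead_coefE size_shp sq/= => ->//.
by rewrite e mulz_eq0 mulf_neq0// PoszM mulf_neq0// -lt0n.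
Qed.

Lemma good_sum q q' n (c : int) : good q -> size q' = n.+1 -> (0 < n)%N ->
  lead_coef q' = s *~ c -> c != 0 ->
  (forall c', lead_coef q = s *~ c' -> c + c' != 0) -> good (q' + q).
Proof.
move=> [c1 c10 [sq lq]] sq' n0 lq' c0 hc.
have [h|h|h] := ltngtP (size q) (size q').
- by exists c => //; rewrite size_polyDl ?lead_coefDl// sq' ltnS.
- by exists c1 => //; rewrite addrC size_polyDl ?lead_coefDl.
- have e : (q' + q)`_n = s *~ (c + c1).
    by rewrite coefD mulrzDr -lq -lq' !lead_coefE h sq'.
  have [||e1 e2] := @size_lead_eq _ (q' + q) n.
  + by rewrite (leq_trans (size_polyD _ _))// h sq' maxnn.
  + by rewrite e mulz_eq0 hc.
  + by exists (c + c1); [exact: hc|rewrite e1 e2 e ltnS].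
Qed.

(** Write [shp z q0 - q] as [(shp z q0 - q0) + (q0 - q)]. The leading coefficient of the first
    summand is a nonzero multiple of [z], so for [z] large it cannot cancel that of the second. *)
Lemma good_shift q0 q : (2 < size q0)%N -> good q0 -> good (q0 - q) ->
  exists B, forall z, (B < z)%N -> good (shp z%:R q0 - q).
Proof.
move=> s2 [c c0 [_ lc]] gq; case sq : (size q0) s2 => [|[|n]]// s2.
have [c2 c20 [_ lc2]] := gq.
exists `|c2|%N => z zB; rewrite -(subrK q0 (shp _ q0)) -addrA.
have [e1 e2] := dshp_good (leq_ltn_trans (leq0n _) zB) sq lc c0.
apply: (good_sum gq e1 _ e2) => //.
  by rewrite mulf_neq0// PoszM mulf_neq0//; apply/eqP; lia.
move=> c'; rewrite lc2 => /eqP; rewrite -subr_eq0 -mulrzBr mulz_eq0 subr_eq0 => /eqP <-.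
apply/eqP => h; have : (`|c2| = `|c| * (z * n.+1))%N by lia.
have : (0 < `|c|)%N by rewrite absz_gt0.
nia.
Qed.

Definition nice q0 (qs : seq {poly {poly int}}) :=
  good q0 /\ forall q, q \in qs -> good (q0 - q) /\ (size q <= size q0)%N.

Definition nc (qs : seq {poly {poly int}}) := [seq q : {poly {poly int}} <- qs | (1 < size q)%N].

(* The family produced by van der Corput with shift [z], once divided by [r]; the terms of [nc]
   are those that depend on [n]. *)
Definition newL (z : nat) r q0 qs :=
  [seq shp z%:R q - r | q <- nc qs] ++ (q0 - r) :: [seq q - r | q <- nc qs].

Lemma good_shift_seq q0 (qs : seq {poly {poly int}}) : (2 < size q0)%N -> nice q0 qs ->
  exists B, forall z, (B < z)%N -> forall q, q \in q0 :: qs -> good (shp z%:R q0 - q).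
Proof.
move=> s2 [g0]; elim: qs => [|q qs IH] h.
  exists 0%N => z z0 q; rewrite inE => /eqP ->.
  have [c c0 [_ lc]] := g0; case sq : (size q0) s2 => [|[|n]]// s2.
  have [e1 e2] := dshp_good z0 sq lc c0.
  exists (c * (z * n.+1)%N%:Z); last by rewrite e1 e2 ltnS.
  by rewrite mulf_neq0// PoszM mulf_neq0//; apply/eqP; lia.
have [|B hB] := IH; first by move=> p hp; apply: h; rewrite inE hp orbT.
have [B' hB'] := good_shift s2 g0 (proj1 (h q (mem_head _ _))).
exists (maxn B B') => z; rewrite gtn_max => /andP[h1 h2] p.
rewrite !inE => /orP[hp|/orP[/eqP->|hp]]; [|exact: hB'|];
  by apply: hB => //; rewrite inE hp ?orbT.
Qed.

Lemma mem_nc q qs : q \in nc qs -> q \in qs.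
Proof. by rewrite mem_filter => /andP[]. Qed.

(** The case without division, for use while phases are present, since dividing would move them. *)
Lemma nice_new0 q0 qs : (2 < size q0)%N -> nice q0 qs ->
  exists B, forall z, (B < z)%N -> nice (shp z%:R q0 - 0) (newL z 0 q0 qs).
Proof.
move=> s2 nq; have [B hB] := good_shift_seq s2 nq; exists B => z zB.
have {}hB := hB z zB; case: nq => g0 h.
split; first by rewrite subr0; exact: good_shp.
move=> p; rewrite mem_cat inE => /or3P[/mapP[q /mem_nc hq ->]|/eqP ->|/mapP[q /mem_nc hq ->]];
  rewrite !subr0 !size_shp.
- rewrite -shpN -shpD; have [h1 h2] := h _ hq; rewrite ?size_shp; split; [exact: good_shp|done].
- by split=> //; apply: hB; rewrite mem_head.
- by split; [apply: hB; rewrite inE hq orbT|case: (h _ hq)].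
Qed.

(** The member to divide by has least degree among those that depend on [n]. The three alternatives
    are the situations in which [shp z q0 - r] keeps maximal degree in the new family: in the last
    one every member loses at least one degree, and [shp z q0 - q0] loses exactly one. *)
Definition pivot r q0 (qs : seq {poly {poly int}}) :=
  [/\ r \in q0 :: nc qs, (forall q, q \in q0 :: nc qs -> (size r <= size q)%N) &
   [\/ (size r < size q0)%N, size r = size q0 /\ lead_coef r != lead_coef q0 |
     r = q0 /\ forall q, q \in q0 :: nc qs ->
       size q = size q0 /\ lead_coef q = lead_coef q0]].

Lemma pivot_ex q0 qs : (1 < size q0)%N -> (forall q, q \in qs -> (size q <= size q0)%N) ->
  exists r, pivot r q0 qs.
Proof.
move=> s1 hs.
have [r hr hmin] : exists2 r, r \in q0 :: nc qs &
    forall q, q \in q0 :: nc qs -> (size r <= size q)%N.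
  elim: (nc qs) => [|q l [r hr hm]].
    by exists q0 => [|q]; rewrite inE// => /eqP->.
  have [h|h] := leqP (size r) (size q).
    exists r; first by move: hr; rewrite !inE => /orP[->|->]; rewrite ?orbT.
    move=> p; rewrite !inE => /or3P[/eqP->|/eqP->//|hp]; apply: hm; rewrite inE ?eqxx ?hp ?orbT//.
  exists q; first by rewrite !inE eqxx orbT.
  move=> p; rewrite !inE => /or3P[/eqP->|/eqP->//|hp]; apply: (leq_trans (ltnW h)); apply: hm;
    by rewrite inE ?eqxx ?hp ?orbT.
have [h|h] := ltnP (size r) (size q0); first by exists r; split=> //; apply: Or31.
have hall q : q \in q0 :: nc qs -> size q = size q0.
  move=> hq; apply/eqP; rewrite eqn_leq (leq_trans h (hmin _ hq)) andbT.
  by move: hq; rewrite inE => /orP[/eqP->//|/mem_nc/hs].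
have [/hasP[r' h1 h2]|/hasPn hn] := boolP (has (fun q => lead_coef q != lead_coef q0) (q0 :: nc qs)).
  exists r'; split=> //; last by apply: Or32; rewrite hall.
  by move=> q hq; rewrite !hall.
exists q0; split; first exact: mem_head.
  by move=> q hq; rewrite !hall// mem_head.
by apply: Or33; split=> // q hq; split; [exact: hall|apply/eqP; rewrite -[_ == _]negbK; exact: hn].
Qed.

Lemma nice_new q0 qs r : (2 < size q0)%N -> nice q0 qs -> pivot r q0 qs ->
  exists B, forall z, (B < z)%N -> nice (shp z%:R q0 - r) (newL z r q0 qs).
Proof.
move=> s2 nq [hr hmin hcase]; have [B hB] := good_shift_seq s2 nq; exists B => z zB.
have {}hB := hB z zB; case: (nq) => g0 h.
have ncS q : q \in q0 :: nc qs -> q \in q0 :: qs.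
  by rewrite !inE => /orP[->//|/mem_nc ->]; rewrite orbT.
have hs q : q \in q0 :: nc qs -> (size q <= size q0)%N.
  by rewrite !inE => /orP[/eqP ->//|/mem_nc/h[]].
have hsize : forall q, q \in q0 :: nc qs -> forall w, (w = shp z%:R q \/ w = q) ->
    (size (w - r)%R <= size (shp z%:R q0 - r)%R)%N.
  move=> q hq w hw; have sw : size w = size q by case: hw => ->; rewrite ?size_shp.
  have lw : lead_coef w = lead_coef q by case: hw => ->; rewrite ?lead_shp.
  case: hcase => [h1|[h1 h2]|[rq h1]].
  - rewrite [X in (_ <= X)%N]size_polyDl ?size_polyN ?size_shp//.
    rewrite (leq_trans (size_polyD _ _))// geq_max sw hs//= size_polyN; exact: hs.
  - case e : (size q0) s2 => [//|n] _.
    have hn : (shp z%:R q0 - r)`_n != 0.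
      rewrite coefB subr_eq0; apply: contra h2 => /eqP hh.
      rewrite -(lead_shp z%:R q0) !lead_coefE size_shp h1 e/= hh//.
    have [|-> _] := size_lead_eq _ hn.
      by rewrite (leq_trans (size_polyD _ _))// size_polyN size_shp h1 e maxnn.
    rewrite (leq_trans (size_polyD _ _))// size_polyN h1 e geq_max leqnn andbT sw -e; exact: hs.
  - have [sr lr] := h1 _ hr; have [sq lq] := h1 _ hq.
    case e : (size q0) s2 => [|[|n]]// _.
    have [c c0 [_ lc]] := g0.
    have hle : (size (w - r)%R <= n.+1)%N.
      apply: size_subl; rewrite ?sw ?sq ?sr ?e//.
      have -> : w`_n.+1 = lead_coef w by rewrite lead_coefE sw sq e.
      have -> : r`_n.+1 = lead_coef r by rewrite lead_coefE sr e.
      by rewrite lw lq lr.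
    apply: (leq_trans hle); rewrite rq.
    by have [-> _] := dshp_good (leq_ltn_trans (leq0n _) zB) e lc c0.
split; first by apply: hB; exact: ncS.
have cut w : shp z%:R q0 - r - (w - r) = shp z%:R q0 - w by rewrite opprB addrA subrK.
move=> p; rewrite mem_cat inE => /or3P[/mapP[q hq ->]|/eqP ->|/mapP[q hq ->]]; rewrite cut.
- split; last by apply: (hsize q); [rewrite inE hq orbT|left].
  by rewrite -shpN -shpD; apply: good_shp; case: (h _ (mem_nc hq)).
- split; first by apply: hB; rewrite mem_head.
  by apply: (hsize q0); [rewrite mem_head|right].
- split; first by apply: hB; rewrite inE (mem_nc hq) orbT.
  by apply: (hsize q); [rewrite inE hq orbT|right].
Qed.

(* Bergelson's weight: the number of distinct leading coefficients in degree [b]. *)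
Definition wc (L : seq {poly {poly int}}) (b : nat) : nat :=
  size (undup [seq lead_coef q | q : {poly {poly int}} <- L & size q == b.+1]).

Fixpoint wt (a : nat) L : seq nat := if a is a'.+1 then wc L a :: wt a' L else [::].

Lemma size_wt a L : size (wt a L) = a.
Proof. by elim: a => //= a ->. Qed.

Lemma wt_lt a b L L' : (0 < b <= a)%N -> (wc L' b < wc L b)%N ->
  (forall i, (b < i)%N -> (wc L' i <= wc L i)%N) -> lexlt (wt a L') (wt a L).
Proof.
elim: a => [|a IH]; first by case: b.
move=> /andP[b0]; rewrite leq_eqVlt => /orP[/eqP ->|ba] hb hi /=; first by rewrite hb.
have := hi a.+1 ba; rewrite leq_eqVlt => /orP[->|->//].
by rewrite IH ?orbT// b0.
Qed.

Lemma wc_sub (L L' : seq {poly {poly int}}) (F : {poly int} -> {poly int}) i : injective F ->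
  (forall q, q \in L' -> size q = i.+1 ->
     exists2 q' : {poly {poly int}}, q' \in L & size q' = i.+1 /\ lead_coef q' = F (lead_coef q)) ->
  (wc L' i <= wc L i)%N.
Proof.
move=> Fi h; rewrite /wc -(size_map F (undup _)).
apply: uniq_leq_size; first by rewrite map_inj_uniq ?undup_uniq.
move=> x /mapP[y]; rewrite mem_undup => /mapP[q]; rewrite mem_filter => /andP[/eqP sq hq] -> ->.
have [q' h1 [h2 h3]] := h q hq sq.
by rewrite mem_undup; apply/mapP; exists q' => //; rewrite mem_filter h2 eqxx.
Qed.

Lemma mem_newL p z r q0 qs : p \in (shp z%:R q0 - r) :: newL z r q0 qs ->
  exists2 q, q \in q0 :: nc qs & exists2 w, w = shp z%:R q \/ w = q & p = w - r.
Proof.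
rewrite inE mem_cat inE.
move=> /orP[/eqP->|/or3P[/mapP[q hq ->]|/eqP ->|/mapP[q hq ->]]].
- by exists q0; [rewrite mem_head|exists (shp z%:R q0); [left|]].
- by exists q; [rewrite inE hq orbT|exists (shp z%:R q); [left|]].
- by exists q0; [rewrite mem_head|exists q0; [right|]].
- by exists q; [rewrite inE hq orbT|exists q; [right|]].
Qed.

(** Let [b] be the degree of [r]. Above [b], division by [r] keeps leading coefficients. In degree
    [b] they are translated by that of [r], and the one equal to it disappears, so the count drops.
    Lower degrees do not matter for the order. *)
Lemma wt_new a z q0 qs r : (forall q, q \in q0 :: qs -> (size q <= a.+1)%N) ->
  (1 < size q0)%N -> pivot r q0 qs ->
  lexlt (wt a ((shp z%:R q0 - r) :: newL z r q0 qs)) (wt a (q0 :: qs)).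
Proof.
move=> ha s1 [hr hmin _].
have ncS q : q \in q0 :: nc qs -> q \in q0 :: qs.
  by rewrite !inE => /orP[->//|/mem_nc ->]; rewrite orbT.
have sr : (1 < size r)%N.
  by move: hr; rewrite inE => /orP[/eqP->//|]; rewrite mem_filter => /andP[].
case er : (size r) sr => [//|b] b0.
have wq q w : w = shp z%:R q \/ w = q -> size w = size q /\ lead_coef w = lead_coef q.
  by move=> [->|->]; rewrite ?size_shp ?lead_shp.
apply: (@wt_lt a b); first by rewrite -ltnS b0 -ltnS -er ha// ncS.
  rewrite /wc; set LL := undup (map _ [seq q : {poly {poly int}} <- q0 :: qs | _]).
  set L' := undup _; rewrite -(size_map (fun x => x + lead_coef r) L').
  rewrite -[(size _).+1]/(size (lead_coef r :: map (fun x => x + lead_coef r) L')).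
  have key x : x \in L' -> x != 0 /\ (x + lead_coef r) \in LL.
    rewrite mem_undup => /mapP[p]; rewrite mem_filter => /andP[/eqP sp].
    move=> /mem_newL[q hq [w /wq[sw lw] pw]] ->.
    have p0 : p != 0 by rewrite -size_poly_gt0 sp.
    rewrite lead_coef_eq0; split=> //.
    have sq : size q = b.+1.
      apply/eqP; rewrite eqn_leq -{2}er hmin// andbT leqNgt; apply/negP => h.
      by move: sp; rewrite pw size_polyDl ?size_polyN ?er sw// => e; rewrite e ltnn in h.
    rewrite mem_undup; apply/mapP; exists q; first by rewrite mem_filter sq eqxx ncS.
    rewrite -lw !lead_coefE sp sw sq er /= pw coefB subrK//.
  apply: uniq_leq_size.
    rewrite /= map_inj_uniq ?undup_uniq ?andbT; last exact: addIr.
    apply/mapP => -[x /key[x0 _]] /esym/eqP; rewrite -subr_eq0 addrK.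
    by rewrite (negPf x0).
  move=> x; rewrite inE => /orP[/eqP ->|/mapP[y /key[_ h] ->]//].
  by rewrite mem_undup; apply/mapP; exists r => //; rewrite mem_filter er eqxx ncS.
move=> i bi; apply: (@wc_sub _ _ id) => // p /mem_newL[q hq [w /wq[sw lw] pw]] sp.
exists q; first exact: ncS.
have wE : w = p + r by rewrite pw subrK.
have h : (size r < size p)%N by rewrite er sp.
by rewrite -sw -lw wE size_polyDl// lead_coefDl.
Qed.

End PolyLemmas.

(** * The PET induction *)

Section PET.
Variables (R : realType) (A : dsys R).
Variables (m0 : (nat -> R) -> R) (hm0 : is_mean m0) (s : {poly int}).
Hypothesis s0 : s != 0.
Implicit Types (f g u : A) (m : (nat -> R) -> R) (q r : {poly {poly int}}).

Local Notation Q := (@QQ R A s).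

Fixpoint tm (qs : seq {poly {poly int}}) (fs : seq A) (n : nat) : A :=
  match qs, fs with
  | q :: qs', f :: fs' => U q.[n%:R] f * tm qs' fs' n
  | _, _ => 1
  end.

Lemma tm_ub qs fs n : uba fs -> ub (tm qs fs n).
Proof.
elim: qs fs => [|q qs IH] [|f fs] //= [uf hf].
by apply: ub_M; [exact: ub_U|exact: IH].
Qed.

Lemma tm_cat qs qs' fs fs' n : size fs = size qs ->
  tm (qs ++ qs') (fs ++ fs') n = tm qs fs n * tm qs' fs' n.
Proof.
elim: qs fs => [|q qs IH] [|f fs] //=; first by rewrite mul1r.
by move=> [sf]; rewrite IH// mulrA.
Qed.

Lemma tm_shp z qs fs n : tm (map (shp z%:R) qs) fs n = tm qs fs (n + z)%N.
Proof.
by elim: qs fs => [|q qs IH] [|f fs] //=; rewrite IH shpE natrD.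
Qed.

Lemma tm_cj qs fs n : cj (tm qs fs n) = tm qs (map cj fs) n.
Proof.
by elim: qs fs => [|q qs IH] [|f fs] /=; rewrite ?rmorph1// rmorphM IH U_cj.
Qed.

Lemma tm_sub r qs fs n : U (- r.[n%:R]) (tm qs fs n) =
  tm (map (fun q => q - r) qs) fs n.
Proof.
elim: qs fs => [|q qs IH] [|f fs] /=; rewrite ?rmorph1//.
by rewrite rmorphM IH U_D hornerD hornerN addrC.
Qed.

Lemma tm_nc qs fs : size fs = size qs -> uba fs -> exists f0 fs',
  [/\ ub f0, uba fs', size fs' = size (nc qs) &
      forall n, tm qs fs n = f0 * tm (nc qs) fs' n].
Proof.
elim: qs fs => [|q qs IH] [|f fs] //=.
  by exists 1, [::]; split=> // n; rewrite mulr1.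
move=> [sf] [uf ufs]; have [f0 [fs' [u0 ufs' sf' e]]] := IH fs sf ufs.
case: ifPn => [sq|]; first by exists f0, (f :: fs'); split=> /= [||//|n];
  rewrite ?sf'// e; ring.
rewrite -leqNgt => /size1_polyC sq; exists (U q`_0 f * f0), fs'; split=> // [|n].
  by apply: ub_M => //; exact: ub_U.
by rewrite e sq hornerC coefC/= mulrA.
Qed.

(* Every box average of order [k.+1] along multiples of [M] is at least [c], for some [k <= K]. *)
Definition Concl (c : R) (M K : nat) f := exists2 k, (k <= K)%N &
  forall Hs, size Hs = k.+1 -> mulw M Hs -> c <= Q Hs f.

Lemma Concl_le c c' M M' K K' f : c' <= c -> (M %| M')%N -> (K <= K')%N ->
  Concl c M K f -> Concl c' M' K' f.
Proof.
move=> cc MM KK [k kK h]; exists k; first exact: leq_trans KK.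
by move=> Hs sH hH; apply: le_trans cc _; apply: h => //; exact: mulw_dvd hH.
Qed.

Definition GoodC q0 qs D (d c : R) (M K : nat) := forall m f fs rs ths,
  is_mean m -> ub f -> uba fs -> uni ths -> size fs = size qs ->
  all (fun r : {poly int} => size r <= D.+1)%N rs ->
  d <= m (fun n => rho (U q0.[n%:R] f * tm qs fs n * ph rs ths n)) ->
  Concl c M K f.

Definition Good q0 qs D := forall d, 0 < d ->
  exists c M K, [/\ 0 < c, (0 < M)%N & GoodC q0 qs D d c M K].

(** Van der Corput only locates the shift in a finite range; the constants for its finitely many
    values are combined by minimum, product and maximum. *)
Lemma good_unif D (q0 : nat -> {poly {poly int}}) qs d B Z : 0 < d ->
  (forall z, (B < z)%N -> Good (q0 z) (qs z) D) ->
  exists c M K, [/\ 0 < c, (0 < M)%N &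
    forall z, (B < z)%N -> (z <= Z)%N -> GoodC (q0 z) (qs z) D d c M K].
Proof.
move=> d0 h; elim: Z => [|Z [c [M [K [c0 M0 hc]]]]].
  by exists 1, 1%N, 0%N; split=> // z; rewrite leqn0 => h1 /eqP h2; rewrite h2 in h1.
have [ZB|BZ] := leqP Z.+1 B.
  by exists c, M, K; split=> // z Bz zZ; have := leq_trans Bz (leq_trans zZ ZB); rewrite ltnn.
have [c' [M' [K' [c'0 M'0 hc']]]] := h _ BZ d d0.
exists (Num.min c c'), (M * M')%N, (maxn K K'); split.
- by rewrite lt_min c0.
- by rewrite muln_gt0 M0.
move=> z Bz; rewrite leq_eqVlt ltnS => /orP[/eqP->|zZ] m f fs rs ths hm uf ufs hu sf hr hd.
  apply: Concl_le (hc' m f fs rs ths hm uf ufs hu sf hr hd).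
  - by rewrite ge_min lexx orbT.
  - exact: dvdn_mull.
  - exact: leq_maxr.
apply: Concl_le (hc z Bz zZ m f fs rs ths hm uf ufs hu sf hr hd).
- by rewrite ge_min lexx.
- exact: dvdn_mulr.
- exact: leq_maxl.
Qed.

(** Dividing by [r] applies [U (- r.[n%:R])] to the whole product, and would move the phases as
    well. Hence the alternative: the phases are constant and can be absorbed beforehand, or [r = 0]
    and nothing is divided. *)
Lemma good_step0 q0 qs r D : (D = 0%N) \/ (r = 0) ->
  (exists B, forall z, (B < z)%N -> Good (shp z%:R q0 - r) (newL z r q0 qs) D.-1) ->
  Good q0 qs D.
Proof.
move=> hDr [B hB] d d0; have [Z hZ] := @vdC_shift R A d B d0.
have d'0 : 0 < d ^+ 2 / 2 by rewrite divr_gt0// exprn_gt0.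
have [c [M [K [c0 M0 hc]]]] := good_unif (qs := fun z => newL z r q0 qs) Z d'0 hB.
exists c, M, K; split=> // m f fs rs ths hm uf ufs hu sf hr hd.
have [f0 [fs' [u0 ufs' sf' e]]] := tm_nc sf ufs.
have [f1 [rs' [u1 hr' e' hrr]]] : exists f1 rs', [/\ ub f1,
    all (fun r : {poly int} => size r <= D.+1)%N rs',
    forall n, tm qs fs n * ph rs ths n = f1 * (tm (nc qs) fs' n * ph rs' ths n) &
    r = 0 \/ rs' = [::]].
  case: hDr => [D0|r0]; last by exists f0, rs; split=> // [n|]; [rewrite e mulrA|left].
  rewrite D0 in hr.
  exists (f0 * ph rs ths 0), [::]; split=> // [|n|]; last by right.
    by apply: ub_M => //; exact: ph_ub.
  by rewrite e (ph_cst _ n hr) /=; ring.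
pose u n := U q0.[n%:R] f * tm (nc qs) fs' n * ph rs' ths n.
have un n : ub (u n).
  by apply: ub_M; [apply: ub_M; [exact: ub_U|exact: tm_ub]|exact: ph_ub].
have [|z [Bz zZ hz]] := hZ m f1 u hm u1 un.
  apply: (le_trans hd); rewrite le_eqVlt; apply/orP; left; apply/eqP; congr m.
  by apply: funext => n; rewrite -mulrA e' /u; congr (rho _); ring.
apply: (hc z Bz zZ m f (fs' ++ cj f :: map cj fs') (map (dif z 0) rs') ths) => //.
- by apply: uba_cat => //; split; [exact: ub_cj|apply: uba_map ufs'; exact: ub_cj].
- by rewrite !size_cat /= !size_map sf'.
- rewrite all_map; apply: sub_all hr' => x hx /=.
  apply: (leq_trans (size_dif z 0 x)); move: hx; case: (size x) => [|k]; case: (D) => [|D1] /=; lia.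
apply: (le_trans hz); rewrite le_eqVlt; apply/orP; left; apply/eqP; congr m.
apply: funext => n; rewrite -(rho_U (- r.[n%:R])).
have -> : u (n + z)%N * cj (u n) =
    (U (shp z%:R q0).[n%:R] f * tm (map (shp z%:R) (nc qs)) fs' n *
     (U q0.[n%:R] (cj f) * tm (nc qs) (map cj fs') n)) * ph (map (dif z 0) rs') ths n.
  rewrite /u -ph_dif// !addn0 tm_shp -tm_cj shpE natrD U_cj !rmorphM; ring.
rewrite rmorphM; have -> : U (- r.[n%:R]) (ph (map (dif z 0) rs') ths n) =
    ph (map (dif z 0) rs') ths n.
  case: hrr => [->|->]; first by rewrite horner0 oppr0 U_0.
  by rewrite /= rmorph1.
congr (rho _); congr (_ * _).
have -> : newL z r q0 qs = map (fun q => q - r) (map (shp z%:R) (nc qs)) ++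
    map (fun q => q - r) (q0 :: nc qs).
  by rewrite /newL -map_comp.
rewrite tm_cat ?size_map// -!tm_sub /= [in RHS]rmorphM !rmorphM !U_D.
by rewrite hornerD hornerN addrC; ring.
Qed.

Lemma horner_size2 q (c : int) n : (size q <= 2)%N -> q`_1 = s *~ c ->
  q.[n%:R] = s *~ (c * n%:Z) + q`_0.
Proof.
move=> sq e; rewrite (horner_coef_wide _ sq) 2!big_ord_recr big_ord0 /= add0r.
by rewrite expr0 mulr1 expr1 addrC e mulrzA -[in RHS]pmulrn mulr_natr.
Qed.

(** Since [q0] and every [q0 - q] move along [s], so does every [q], and the family is linear along
    a single transformation. *)
Lemma Good_lin q0 qs : size q0 = 2%N -> nice s q0 qs -> Good q0 qs 0.
Proof.
move=> s2 [[c c0 [_ lc]] h] d d0.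
have [cs [scs hcs htm]] : exists cs : seq int, [/\ size cs = size qs,
    all (fun x => x != c) cs & forall fs, uba fs -> size fs = size qs ->
    exists fs', [/\ size fs' = size cs, uba fs' & forall n, tm qs fs n = tml s cs fs' n]].
  elim: qs h => [|q qs IH] h.
    by exists [::]; split=> // -[|//] _ _; exists [::].
  have [|cs [scs hcs htm]] := IH; first by move=> p hp; apply: h; rewrite inE hp orbT.
  have [[c' c'0 [sq lq]] sq2] := h q (mem_head _ _).
  have sq' : size (q0 - q) = 2%N.
    apply/eqP; rewrite eqn_leq sq andbT (leq_trans (size_polyD _ _))//.
    by rewrite size_polyN geq_max s2 leqnn -s2.
  exists ((c - c') :: cs); split; first by rewrite /= scs.
    by rewrite /= hcs andbT; apply/eqP; move/eqP: c'0; lia.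
  move=> [|f fs] //= [uf ufs] [sf]; have [fs' [sf' uf' e]] := htm fs ufs sf.
  exists (U q`_0 f :: fs'); split=> /= [||n]; first by rewrite sf'.
    by split=> //; exact: ub_U.
  rewrite e (@horner_size2 q (c - c')) -?U_D// -?s2//.
  move: lq lc; rewrite !lead_coefE sq' s2 /= coefB => e1 e2.
  by rewrite mulrzBr -e1 -e2 opprB addrC subrK.
have [c' [M [c'0 M0 hL]]] := @LinT R A m0 hm0 s c cs 0%N c0 hcs d d0.
exists c', M, (size cs); split=> // m f fs rs ths hm uf ufs hu sf hr hd.
have [fs' [sf' uf' e]] := htm fs ufs sf.
exists (size cs) => // Hs sH hH; rewrite -(QQ_U hm0 s q0`_0 Hs uf).
apply: (hL m 1 _ fs' rs ths) => //; first exact: ub_U.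
apply: (le_trans hd); rewrite le_eqVlt; apply/orP; left; apply/eqP; congr m.
apply: funext => n; rewrite mul1r e (@horner_size2 q0 c) -?U_D ?s2//.
by rewrite -lc lead_coefE s2.
Qed.

Lemma Good_0 q0 qs : nice s q0 qs -> Good q0 qs 0.
Proof.
(* The bound [a] on the sizes is kept throughout, so that all weights compared have the same
   length. *)
move=> hn; pose a := size q0.
suff H : forall w : seq nat, size w = a -> forall q0 qs, nice s q0 qs ->
    (size q0 <= a.+1)%N -> wt a (q0 :: qs) = w -> Good q0 qs 0.
  by apply: (H (wt a (q0 :: qs))) => //; exact: size_wt.
clearbody a; move=> {q0 qs hn}; apply: (@lex_ind a (fun w => forall q0 qs,
  nice s q0 qs -> (size q0 <= a.+1)%N -> wt a (q0 :: qs) = w -> Good q0 qs 0)).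
move=> w sw IH q0 qs nq sq hw.
have s1 : (1 < size q0)%N by case: nq => -[c _ []].
have [s2|s2] := leqP (size q0) 2.
  by apply: Good_lin => //; apply/eqP; rewrite eqn_leq s2.
have hs q : q \in q0 :: qs -> (size q <= a.+1)%N.
  case: nq => _ h; rewrite inE => /orP[/eqP ->//|/h[_ h']]; exact: leq_trans sq.
have [|r pr] := @pivot_ex q0 qs s1; first by case: nq => _ h q /h[].
have [B hB] := nice_new s0 s2 nq pr.
apply: (@good_step0 _ _ r); first by left.
exists B => z zB; have nz := hB z zB.
apply: (IH (wt a ((shp z%:R q0 - r) :: newL z r q0 qs))) => //.
- exact: size_wt.
- by rewrite -hw; exact: wt_new.
rewrite (leq_trans (size_polyD _ _))// size_polyN size_shp geq_max sq hs//.
have [hr _ _] := pr; move: hr; rewrite !inE => /orP[->//|/mem_nc ->]; by rewrite orbT.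
Qed.

(** [D] steps without division bring the phases down to constants while the degree of [q0] is
    preserved; the induction with division follows. *)
Theorem Good_PET q0 qs D : (2 < size q0)%N -> nice s q0 qs -> Good q0 qs D.
Proof.
elim: D q0 qs => [|D IH] q0 qs s2 nq; first exact: Good_0.
have [B hB] := nice_new0 s0 s2 nq.
apply: (@good_step0 _ _ 0); first by right.
exists B => z zB; apply: IH; last exact: hB.
by rewrite subr0 size_shp.
Qed.

End PET.

(** * Means along residue classes *)

Section SubMean.
Variable R : realType.
Implicit Types (m : (nat -> R) -> R) (u v : nat -> R).

(* The mean [m] conditioned on [n = i] modulo [N], in the variable [(n - i) / N]. *)
Definition msub m (N i : nat) : (nat -> R) -> R := fun v =>
  N%:R * m (fun n => ((n %% N)%N == i)%:R * v (n %/ N)%N).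

Lemma bseq_ind (P : nat -> bool) v : bseq v -> bseq (fun n => (P n)%:R * v n).
Proof.
move=> [B hB]; exists B => n; case: (P n); rewrite ?mul1r// mul0r normr0.
exact: le_trans (normr_ge0 _) (hB n).
Qed.

Lemma bseq_msub N i v : bseq v ->
  bseq (fun n => ((n %% N)%N == i)%:R * v (n %/ N)%N).
Proof.
move=> hv; apply: (@bseq_ind (fun n => (n %% N)%N == i) (fun n => v (n %/ N)%N)).
exact: (bseq_comp (fun n => n %/ N)%N).
Qed.

Lemma bseq_indic (P : nat -> bool) : bseq (fun n => (P n)%:R : R).
Proof. by exists 1 => n; case: (P n); rewrite ?normr1// normr0. Qed.

Lemma mean_residue m (hm : is_mean m) N i : (i < N)%N ->
  N%:R * m (fun n => ((n %% N)%N == i)%:R) = 1.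
Proof.
move=> iN; have e j : (j < N)%N ->
    m (fun n => ((n %% N)%N == j)%:R) = m (fun n => ((n %% N)%N == 0%N)%:R).
  move=> jN; rewrite -(meanSn hm j); last exact: (@bseq_indic (fun n => (n %% N)%N == j)).
  congr m; apply: funext => n; congr (_%:R); congr nat_of_bool.
  by rewrite -{2}(modn_small jN) -[X in _ == X %[mod _]]add0n eqn_modDr mod0n.
rewrite e//; set x := m _.
have -> : N%:R * x = \sum_(j < N) m (fun n => ((n %% N)%N == j)%:R).
  rewrite (eq_bigr (fun=> x)) => [|j _]; last exact: e.
  by rewrite sumr_const card_ord mulr_natl.
rewrite -(@mean_sum R m hm _ _ (fun (j : 'I_N) n => ((n %% N)%N == j)%:R)); last first.
  by move=> j; exact: (@bseq_indic (fun n => (n %% N)%N == j)).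
rewrite -[RHS](mean1 hm); congr m; apply: funext => n.
have N0 : (0 < N)%N by apply: leq_ltn_trans iN.
rewrite (bigD1 (Ordinal (ltn_pmod n N0)))//= eqxx big1 ?addr0// => j.
by rewrite -val_eqE/= eq_sym => /negPf ->.
Qed.

Lemma msub_mean m N i : is_mean m -> (i < N)%N -> is_mean (msub m N i).
Proof.
move=> hm iN; split.
- move=> u v hu hv; rewrite /msub -mulrDr -(meanD hm);
  [|exact: (bseq_msub N i hu)|exact: (bseq_msub N i hv)].
  by congr (_ * m _); apply: funext => n; rewrite mulrDr.
- move=> c u hu; rewrite /msub [RHS]mulrCA -(meanZ hm c); last exact: (bseq_msub N i hu).
  by congr (_ * m _); apply: funext => n; rewrite mulrCA.
- move=> u v hu hv uv; rewrite /msub ler_wpM2l// (mean_le hm)//;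
    [exact: (bseq_msub N i hu)|exact: (bseq_msub N i hv)|].
  by move=> n; rewrite ler_wpM2l.
- rewrite /msub -[RHS](mean_residue hm iN); congr (_ * m _); apply: funext => n.
  by rewrite mulr1.
- move=> u hu; rewrite /msub -[in RHS](meanSn hm N); last exact: (bseq_msub N i hu).
  congr (_ * m _); apply: funext => n; rewrite modnDr divnDr ?dvdnn// divnn.
  by rewrite (leq_ltn_trans _ iN)// addn1.
Qed.

Lemma msub_split m (hm : is_mean m) N u d : (0 < N)%N -> bseq u ->
  (forall i, (i < N)%N -> msub m N i (fun k => u (k * N + i)%N) <= d) -> m u <= d.
Proof.
move=> N0 hu h; have Np : (0 : R) < N%:R by rewrite ltr0n.
have -> : m u = N%:R^-1 * \sum_(i < N) msub m N i (fun k => u (k * N + i)%N).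
  rewrite /msub -mulr_sumr mulKf ?lt0r_neq0//.
  rewrite -(@mean_sum R m hm _ _ (fun (i : 'I_N) n => ((n %% N)%N == i)%:R * u (n %/ N * N + i)%N)).
    congr m; apply: funext => n.
    rewrite (bigD1 (Ordinal (ltn_pmod n N0)))//= eqxx mul1r -divn_eq big1 ?addr0// => j.
    by rewrite -val_eqE/= eq_sym => /negPf ->; rewrite mul0r.
  move=> i; apply: (@bseq_ind (fun n => (n %% N)%N == i) (fun n => u (n %/ N * N + i)%N)).
  exact: (bseq_comp (fun n => n %/ N * N + i)%N).
rewrite ler_pdivrMl//.
rewrite -[X in _ <= X](_ : \sum_(i < N) d = _).
  by apply: ler_sum => i _; exact: h.
by rewrite sumr_const card_ord mulr_natl.
Qed.

End SubMean.

(** * Weyl estimates for phases *)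

Section Weyl.
Variables (R : realType) (A : dsys R).
Variables (m0 : (nat -> R) -> R) (hm0 : is_mean m0).
Implicit Types (f g u : A) (m : (nat -> R) -> R).

Local Notation aeq := (@weq R A rho).

Lemma ei_dvd (N N' : nat) u : (N %| N')%N -> ei (u ^+ N') * ei (u ^+ N) = ei (u ^+ N).
Proof. by move=> /dvdnP[k ->]; rewrite mulnC exprM ei_X. Qed.

Lemma ei_kill N N' (f u : A) : (N %| N')%N -> f * ei (u ^+ N') = 0 -> f * ei (u ^+ N) = 0.
Proof. by move=> h e; rewrite -(ei_dvd u h) mulrA e mul0r. Qed.

Definition WP (r : {poly int}) rs (d : R) N := forall m f0 th ths, is_mean m ->
  ub f0 -> th * cj th = 1 -> uni ths -> f0 * ei (th ^+ N) = 0 ->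
  m (fun n => rho (f0 * (upow th r.[n%:Z] * ph rs ths n))) <= d.

Lemma fin_dvd (P : nat -> nat -> Prop) Z :
  (forall z N N', (N %| N')%N -> P z N -> P z N') ->
  (forall z, exists2 N, (0 < N)%N & P z N) ->
  exists2 N, (0 < N)%N & forall z, (z <= Z)%N -> P z N.
Proof.
move=> hP h; elim: Z => [|Z [N N0 hN]].
  by have [N N0 hN] := h 0%N; exists N => // z; rewrite leqn0 => /eqP ->.
have [N' N'0 hN'] := h Z.+1; exists (N * N')%N; first by rewrite muln_gt0 N0.
move=> z; rewrite leq_eqVlt ltnS => /orP[/eqP->|zZ].
  by apply: hP hN'; exact: dvdn_mull.
by apply: hP (hN z zZ); exact: dvdn_mulr.
Qed.

Lemma size_dif_eq (z : nat) (r : {poly int}) n : (0 < z)%N -> size r = n.+2 ->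
  size (dif z 0 r) = n.+1.
Proof.
move=> z0 sr; rewrite /dif.
have -> : shz 0 r = r by rewrite /shz /shp addr0 comp_polyXr.
apply: size_dshp_eq => //; rewrite mulrn_eq0/= mulf_neq0//.
  by rewrite lead_coef_eq0 -size_poly_gt0 sr.
by rewrite -lt0n.
Qed.

(** The weak limit [F] of [upow th (a * n)] is fixed by multiplication by [upow th a], hence lives
    where [th ^+ |a| = 1]. There [f0] vanishes, and the mean is exactly [0]. *)
Lemma Weyl_lin (r : {poly int}) rs d : 0 < d -> size r = 2%N ->
  all (fun p : {poly int} => size p <= 1)%N rs ->
  exists2 N, (0 < N)%N & WP r rs d N.
Proof.
move=> d0 sr hrs; set a := r`_1.
have a0 : a != 0.
  have : lead_coef r != 0 by rewrite lead_coef_eq0 -size_poly_gt0 sr.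
  by rewrite lead_coefE sr.
exists `|a|%N; first by rewrite absz_gt0.
move=> m f0 th ths hm u0 hth hu he.
have ut z : ub (upow th z) by apply: ub_unit; exact: upow_unit.
have [F uF hF] := @wmean R A m (fun n => upow th (a * n%:Z)) hm (fun n => ut _).
have fixF : aeq (upow th a * F) F.
  move=> x; rewrite mulrA hF hF -[RHS](meanS hm); last first.
    exact: (@bseq_rhoM R A x (fun n => upow th (a * n%:Z))).
  congr m; apply: funext => n; rewrite intS mulrDr mulr1 upowD//.
  by rewrite mulrA.
have fixN : aeq (th ^+ `|a| * F) F.
  move: fixF; case: (a) => k /= h; first exact: h.
  have hk : th ^+ k.+1 * cj th ^+ k.+1 = 1 by rewrite -exprMn hth expr1n.
  have := aeq_M (aeq_refl (th ^+ k.+1)) h; rewrite mulrA hk mul1r.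
  exact: aeq_sym.
have rE n : r.[n%:Z] = r`_0 + a * n%:Z.
  rewrite (@horner_coef_wide _ 2) ?sr// 2!big_ord_recr big_ord0 /= add0r.
  by rewrite expr0 mulr1 expr1.
rewrite [X in X <= _](_ : _ = 0) ?ltW//.
transitivity (m (fun n => rho (f0 * upow th r`_0 * ph rs ths 0 * upow th (a * n%:Z)))).
  congr m; apply: funext => n; rewrite (ph_cst _ n hrs) rE upowD//.
  by congr (rho _); ring.
rewrite -hF; have := ei_fix fixN => /aeq_sym e; rewrite e.
have -> : f0 * upow th r`_0 * ph rs ths 0 * (ei (th ^+ `|a|) * F) =
  f0 * ei (th ^+ `|a|) * (upow th r`_0 * ph rs ths 0 * F) by ring.
by rewrite he mul0r rho0.
Qed.

Lemma WP_dvd r rs d N N' : (N %| N')%N -> WP r rs d N -> WP r rs d N'.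
Proof.
move=> h hW m f0 th ths hm u0 hth hu he; apply: hW => //; exact: ei_kill he.
Qed.

Lemma ei_subK (e f : A) : e * e = e -> f * e = 0 -> f = f * (1 - e).
Proof. by move=> he h; rewrite mulrBr mulr1 h subr0. Qed.

(** Van der Corput with a positive shift lowers all degrees by one and keeps [r] on top. The shift
    lies in a bounded range, so one modulus [N] serves for all of its values. *)
Lemma Weyl n (r : {poly int}) rs d : 0 < d -> size r = n.+2 ->
  all (fun p : {poly int} => size p <= n.+1)%N rs ->
  exists2 N, (0 < N)%N & WP r rs d N.
Proof.
elim: n r rs d => [|n IH] r rs d d0 sr hrs; first exact: Weyl_lin.
have [Z hZ] := @vdC_shift R A d 0 d0.
have d'0 : 0 < d ^+ 2 / 4 by rewrite divr_gt0// exprn_gt0.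
have [|z|N N0 hN] := @fin_dvd (fun z N => (0 < z)%N ->
    WP (dif z 0 r) (map (dif z 0) rs) (d ^+ 2 / 4) N) Z.
- by move=> z N N' h hP z0; apply: WP_dvd h _; exact: hP.
- case: z => [|z]; first by exists 1%N.
  have [||N N0 hN] := IH (dif z.+1 0 r) (map (dif z.+1 0) rs) _ d'0.
  + exact: size_dif_eq.
  + rewrite all_map; apply: sub_all hrs => p /= hp.
    by apply: (leq_trans (size_dif z.+1 0 p)); move: hp; case: (size p).
  + by exists N.
exists N => // m f0 th ths hm u0 hth hu he; rewrite leNgt; apply/negP => hd.
set e := ei (th ^+ N) in he.
have ee : e * e = e by exact: ei_idem.
(* Van der Corput forgets [f0]; the factor [1 - e] keeps the support condition inside the
   sequence. *)
pose u n := (1 - e) * (upow th r.[n%:Z] * ph rs ths n).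
have ue : ub (1 - e) by exact: ei_ubC.
have un k : ub (u k).
  apply: ub_M => //; apply: ub_M; last exact: ph_ub.
  by apply: ub_unit; exact: upow_unit.
have [|z [z0 zZ]] := hZ m f0 u hm u0 un.
  apply: (le_trans (ltW hd)); rewrite le_eqVlt; apply/orP; left; apply/eqP; congr m.
  by apply: funext => k; rewrite /u [in LHS](ei_subK ee he) -[in LHS]mulrA.
have := hN z zZ z0 m (1 - e) th ths hm ue hth hu.
rewrite mulrBl mul1r ee subrr => /(_ erefl) h1.
rewrite (_ : m _ = m (fun k => rho ((1 - e) *
    (upow th (dif z 0 r).[k%:Z] * ph [seq dif z 0 i | i <- rs] ths k)))).
  move=> /le_trans/(_ h1) h2; have d2 : 0 < d ^+ 2 by rewrite exprn_gt0.
  by exfalso; lra.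
congr m; apply: funext => k; congr (rho _).
have e1 : (1 - e) * (1 - e) = 1 - e by rewrite mulrBr mulr1 mulrBl mul1r ee subrr subr0.
rewrite -ph_dif// /u !rmorphM rmorphB rmorph1 ei_cj -/e -{3}e1.
rewrite /dif hornerD hornerN !shzE upowD// upowN// !addn0; ring.
Qed.

End Weyl.

(** * Removing the function or the phase of highest degree *)

Section Reduction.
Variables (R : realType) (A : dsys R).
Variables (m0 : (nat -> R) -> R) (hm0 : is_mean m0).
Implicit Types (f g u : A) (m : (nat -> R) -> R) (p r : {poly int}).

Local Notation aeq := (@weq R A rho).

Definition eprod (N : nat) (ths : seq A) : A := \prod_(th <- ths) ei (th ^+ N).

Lemma eprod_dvd N N' ths : (N %| N')%N -> eprod N' ths * eprod N ths = eprod N ths.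
Proof.
move=> h; rewrite /eprod -big_split/=; apply: eq_bigr => th _; exact: ei_dvd.
Qed.

Lemma eprod_kill N N' f ths : (N %| N')%N -> f * eprod N' ths = 0 -> f * eprod N ths = 0.
Proof. by move=> h e; rewrite -(eprod_dvd ths h) mulrA e mul0r. Qed.

Fixpoint VV (i : nat) (ps : seq {poly int}) (fs : seq A) (n : nat) : A :=
  match ps, fs with
  | p :: ps', f :: fs' => U ('X^i *~ p.[n%:Z]) f * VV i.+1 ps' fs' n
  | _, _ => 1
  end.

Lemma VV_ub i ps fs n : uba fs -> ub (VV i ps fs n).
Proof.
elim: ps i fs => [|p ps IH] i [|f fs] //= [uf hf].
by apply: ub_M; [exact: ub_U|exact: IH].
Qed.

Lemma VV_rcons i ps p fs f n : size fs = size ps ->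
  VV i (rcons ps p) (rcons fs f) n =
  VV i ps fs n * U ('X^(i + size ps) *~ p.[n%:Z]) f.
Proof.
elim: ps i fs => [|q ps IH] i [|g fs] //= => [_|[sf]].
  by rewrite addn0 mulr1 mul1r.
by rewrite IH// addnS mulrA.
Qed.

Definition aff (N i : nat) p := p \Po (N%:Z *: 'X + (i%:Z)%:P).

Lemma affE N i p n : (aff N i p).[n%:Z] = p.[(n * N + i)%N%:Z].
Proof.
rewrite /aff horner_comp hornerD hornerZ hornerX hornerC PoszD PoszM.
by rewrite [N%:Z * _]mulrC.
Qed.

Lemma size_aff N i p : (0 < N)%N -> size (aff N i p) = size p.
Proof.
move=> N0; have sN : size (N%:Z *: 'X : {poly int}) = 2%N.
  by rewrite size_scale ?size_polyX// eqz_nat -lt0n.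
by rewrite /aff size_comp_poly2// size_polyDl sN// ltnS size_polyC leq_b1.
Qed.

Lemma ph_aff N i rs ths n : ph (map (aff N i) rs) ths n = ph rs ths (n * N + i)%N :> A.
Proof. by elim: rs ths => [|r rs IH] [|th ths] //=; rewrite IH affE. Qed.

Lemma VV_aff N i j ps fs n : VV j (map (aff N i) ps) fs n = VV j ps fs (n * N + i)%N.
Proof. by elim: ps j fs => [|r ps IH] j [|f fs] //=; rewrite IH affE. Qed.

Lemma poly_dvd p (N n i : nat) :
  exists w : int, p.[(n * N + i)%N%:Z] = p.[i%:Z] + N%:Z * w.
Proof.
have /factor_theorem[q hq] : root (p - p.[i%:Z]%:P) i%:Z.
  by rewrite /root hornerD hornerN hornerC subrr.
exists (q.[(n * N + i)%N%:Z] * n%:Z).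
have := congr1 (fun x => x.[(n * N + i)%N%:Z]) hq.
rewrite hornerD hornerN hornerC hornerM hornerXsubC => /(canRL (subrK _)) ->.
rewrite addrC PoszD PoszM addrK; congr (_ + _); ring.
Qed.

(* [eprod N ths] is the indicator function of the set where all the phases are [N]-th roots of
   unity; off that set the averages are at most [d]. *)
Definition CPN ps rs (d : R) N := forall m f0 fs ths, is_mean m -> ub f0 ->
  uba fs -> uni ths -> size fs = size ps -> size ths = size rs ->
  f0 * eprod N ths = 0 -> m (fun n => rho (f0 * VV 0 ps fs n * ph rs ths n)) <= d.

Definition CP ps rs := forall d, 0 < d -> exists2 N, (0 < N)%N & CPN ps rs d N.

Lemma CPN_dvd ps rs d N N' : (N %| N')%N -> CPN ps rs d N -> CPN ps rs d N'.
Proof.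
by move=> h hC m f0 fs ths hm u0 uf hu sf st e; apply: hC => //; exact: eprod_kill e.
Qed.

(** Up to [d], only the projection of the last function on the invariants of an [N]-th power
    matters. *)
Definition PPN ps p rs (d : R) N := forall m f0 f fs ths, is_mean m -> ub f0 -> ub f ->
  uba fs -> uni ths -> size fs = size ps -> size ths = size rs ->
  (forall y, inv ('X^(size ps) *+ N) y -> rho (y * f) = 0) ->
  m (fun n => rho (f0 * VV 0 ps fs n * U ('X^(size ps) *~ p.[n%:Z]) f * ph rs ths n)) <= d.

Definition PPr ps p rs := forall d, 0 < d -> exists2 N, (0 < N)%N & PPN ps p rs d N.

(** Sizes exceed [1] and increase: the degrees are positive and strictly increasing. *)
Definition srt (ps : seq {poly int}) := path ltn 1 [seq size p | p : {poly int} <- ps].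

Lemma srt_aff N i ps : (0 < N)%N -> srt (map (aff N i) ps) = srt ps.
Proof.
move=> N0; rewrite /srt -map_comp; congr path; apply: eq_map => p /=.
exact: size_aff.
Qed.

Lemma CP_aff ps rs N d : (0 < N)%N -> 0 < d ->
  (forall i, CP (map (aff N i) ps) (map (aff N i) rs)) ->
  exists2 N', (0 < N')%N & forall i, (i <= N)%N ->
    CPN (map (aff N i) ps) (map (aff N i) rs) d N'.
Proof.
move=> N0 d0 h; apply: (@fin_dvd (fun i N' =>
  CPN (map (aff N i) ps) (map (aff N i) rs) d N')).
  by move=> i N1 N2; exact: CPN_dvd.
by move=> i; exact: h.
Qed.

Lemma upow_ei (th : A) N (w : int) : th * cj th = 1 ->
  upow th (N%:Z * w) * ei (th ^+ N) = ei (th ^+ N).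
Proof.
move=> hth; rewrite upow_mul//; set e := ei _.
have e1 : th ^+ N * e = e by rewrite mulrC /e ei_mul.
have e2 : cj (th ^+ N) * e = e by rewrite -{1}[e]ei_cj -rmorphM e1 /e ei_cj.
case: w => k /=.
  elim: k => [|k IH]; first by rewrite expr0 mul1r.
  by rewrite exprSr -mulrA e1.
elim: k => [|k IH]; first by rewrite expr1.
by rewrite exprSr -mulrA e2.
Qed.

(** Induction on the phases, the highest degree first. Off the set where its [N1]-th power is [1],
    the top phase is handled by [Weyl]; on that set it becomes constant along residue classes. *)
Lemma CP_nil rs : srt rs -> CP [::] rs.
Proof.
elim: (size rs) {-2}rs (erefl (size rs)) => {rs} [|K IH] rs0; case/lastP: rs0 => [|rs r].
- move=> _ _ d d0; exists 1%N => // m f0 fs [|//] hm u0 _ _ _ _.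
  rewrite /eprod big_nil mulr1 => ->.
  rewrite (_ : (fun _ => _) = fun=> 0) ?(mean_cst hm) ?ltW//.
  by apply: funext => n; rewrite !mul0r rho0.
- by rewrite size_rcons.
- by [].
rewrite size_rcons => -[srs] hs d d0; have d2 : 0 < d / 2 by rewrite divr_gt0.
have [hs' hr] : srt rs /\ (last 1%N [seq size p | p : {poly int} <- rs] < size r)%N.
  by move: hs; rewrite /srt map_rcons rcons_path => /andP.
have hall : all (fun p : {poly int} => size p < size r)%N rs.
  have := hs; rewrite /srt map_rcons => /(order_path_min ltn_trans).
  have : sorted ltn (rcons [seq size p | p : {poly int} <- rs] (size r)).
    by move: hs; rewrite /srt map_rcons; apply: path_sorted.
  rewrite -[rcons _ _]revK rev_rcons rev_sorted => /(order_path_min _).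
  rewrite all_rev all_map => h _; apply: h => x y z /= h1 h2; exact: ltn_trans h2 h1.
have r2 : (1 < size r)%N.
  apply: leq_ltn_trans hr; move: hs'; rewrite /srt.
  elim/last_ind: [seq _ | _ <- _] => // l x _; rewrite last_rcons rcons_path.
  move=> /andP[/(order_path_min ltn_trans)]; case/lastP: l => [|l y] //=.
    by move=> _ /ltnW.
  by rewrite all_rcons last_rcons => /andP[h _] /ltnW; exact: leq_trans (ltnW h).
case sr : (size r) r2 => [|[|n]]// _.
have [|N1 N10 h1] := @Weyl R A n r rs _ d2 sr.
  by apply: sub_all hall => p; rewrite sr ltnS.
have [|N2 N20 h2] := @CP_aff [::] rs N1 _ N10 d2.
  by move=> i; apply: IH; rewrite ?size_map// srt_aff.
exists (N1 * N2)%N; first by rewrite muln_gt0 N10.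
move=> m f0 fs ths' hm u0 _ hu _ sths he.
case/lastP: ths' sths hu he => [|ths th]; first by rewrite size_rcons.
rewrite !size_rcons => -[sths] hu he.
have [huth hths] : th * cj th = 1 /\ uni ths.
  by elim: ths hu {he sths} => [|a l IHl] /= [ha] //; move=> /IHl[].
have phr k : ph (rcons rs r) (rcons ths th) k = upow th r.[k%:Z] * ph rs ths k.
  elim: rs ths sths {IH srs hs hs' hr hall h1 h2 hu he hths} => [|a l IHl] [|b t] //=.
  by move=> [/IHl ->]; ring.
have hprod : f0 * eprod (N1 * N2) ths * ei (th ^+ (N1 * N2)) = 0.
  by move: he; rewrite /eprod -cats1 big_cat /= big_seq1 mulrA.
set e := ei (th ^+ N1).
have uph k : ub (ph (rcons rs r) (rcons ths th) k) by exact: ph_ub.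
have b1 : bseq (fun n => rho (f0 * (1 - e) * ph (rcons rs r) (rcons ths th) n)).
  by apply: bseq_rho => n0; apply: ub_M => //; apply: ub_M => //; exact: ei_ubC.
have b2 : bseq (fun n => rho (f0 * e * ph (rcons rs r) (rcons ths th) n)).
  by apply: bseq_rho => n0; apply: ub_M => //; apply: ub_M => //; exact: ei_ub.
rewrite (_ : (fun n => _) = fun n =>
    rho (f0 * (1 - e) * ph (rcons rs r) (rcons ths th) n) +
    rho (f0 * e * ph (rcons rs r) (rcons ths th) n)); last first.
  by apply: funext => k; rewrite -rhoD /=; congr (rho _); ring.
rewrite (meanD hm)// [d]splitr lerD//.
  rewrite (_ : (fun n => _) = fun n => rho (f0 * (1 - e) * (upow th r.[n%:Z] * ph rs ths n))).
    apply: h1 => //; first by apply: ub_M => //; exact: ei_ubC.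
    by rewrite -mulrA mulrBl mul1r ei_idem subrr mulr0.
  by apply: funext => k; rewrite phr.
(* Where [th ^+ N1 = 1], the value of [upow th r.[n]] only depends on [n] modulo [N1], so on each
   class it joins [f0]. *)
apply: (msub_split hm N10 b2) => i iN.
rewrite (_ : (fun k => _) = (fun n => rho (f0 * e * upow th r.[i%:Z] *
    VV 0 [seq aff N1 i r | r <- [::]] [::] n * ph [seq aff N1 i r | r <- rs] ths n))).
  apply: (h2 i (ltnW iN) _ _ [::] ths (msub_mean hm iN)) => //.
  - apply: ub_M; first by apply: ub_M => //; exact: ei_ub.
    by apply: ub_unit; exact: upow_unit.
  - by rewrite size_map.
  have -> : f0 * e * upow th r.[i%:Z] * eprod N2 ths =
      f0 * eprod (N1 * N2) ths * ei (th ^+ (N1 * N2)) * (e * upow th r.[i%:Z] * eprod N2 ths).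
    rewrite -{1}(eprod_dvd ths (dvdn_mull N1 (dvdnn N2))).
    have ee : ei (th ^+ (N1 * N2)) * e = e by exact: ei_dvd (dvdn_mulr N2 (dvdnn N1)).
    by rewrite -{1}ee; ring.
  by rewrite hprod mul0r.
apply: funext => k; rewrite phr ph_aff /= mulr1; congr (rho _).
have [w ->] := poly_dvd r N1 k i; rewrite upowD//.
have := upow_ei N1 w huth; rewrite -/e; move: (upow th r.[i%:Z]) (ph _ _ _) => y z.
move: (upow th _) => x ew.
have -> : f0 * e * (y * x * z) = f0 * (x * e) * y * z by ring.
by rewrite ew.
Qed.

(** Split [f] into its projection [g] on the [N1]-th power invariants and the rest. The rest is
    negligible by [PPr]; on each residue class modulo [N1], [g] is moved only by a fixed power and
    joins [f0], which leaves one function fewer. *)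
Lemma CP_rcons ps p rs : srt (rcons ps p ++ rs) -> PPr ps p rs ->
  (forall N i, (0 < N)%N -> CP (map (aff N i) ps) (map (aff N i) rs)) ->
  CP (rcons ps p) rs.
Proof.
move=> hs hP hC d d0; have d4 : 0 < d / 4 by rewrite divr_gt0.
have d2 : 0 < d / 2 by rewrite divr_gt0.
have [N1 N10 h1] := hP _ d4.
have [N2 N20 h2] := CP_aff N10 d2 (fun i => hC N1 i N10).
exists N2 => // m f0 fs' ths hm u0 ufs hu sfs sths he.
case/lastP: fs' sfs ufs => [|fs f]; first by rewrite size_rcons.
rewrite !size_rcons => -[sfs] ufs'.
have [uf ufs] : ub f /\ uba fs.
  by elim: fs ufs' {sfs} => [|a l IHl] /= [ha] //; move=> /IHl[].
set s : {poly int} := 'X^(size ps).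
pose g := PP (s *+ N1) f; have [ug ig hg] := PPP hm0 (s *+ N1) uf.
pose W n := f0 * VV 0 ps fs n.
have uW n : ub (W n) by apply: ub_M => //; exact: VV_ub.
have h01 : 0 <= (2^-1 : R) <= 1 by apply/andP; split; lra.
(* Halved to be bounded by [1]; this is why [PPr] is used with [d / 4]. *)
pose f' := kk 2^-1 * (f - g).
have uf' : ub f'.
  have := ub_conv h01 uf (ub_N ug).
  have -> : 1 - 2^-1 = 2^-1 :> R by field.
  by rewrite -mulrDr.
pose X h n := rho (W n * U (s *~ p.[n%:Z]) h * ph rs ths n).
have bX h : ub h -> bseq (X h).
  move=> uh; apply: bseq_rho => n; apply: ub_M; last exact: ph_ub.
  by apply: ub_M => //; exact: ub_U.
rewrite (_ : (fun n => _) = fun n => 2 * X f' n + X g n); last first.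
  apply: funext => n; rewrite VV_rcons// add0n -/s /X -rho_kk -rhoD; congr (rho _).
  rewrite /f' rmorphM rmorphB/= U_kk mulrA -/(W n).
  have k2 : kk 2 * kk 2^-1 = 1 :> A by rewrite -rmorphM mulfV ?rmorph1// pnatr_eq0.
  have gen (w x y q a b : A) : a * b = 1 ->
      w * x * q = a * (w * (b * (x - y)) * q) + w * y * q.
    move=> ab; transitivity (a * b * (w * (x - y) * q) + w * y * q); last by ring.
    by rewrite ab; ring.
  exact: gen k2.
rewrite (meanD hm); [|by apply: bseqZ; exact: bX|exact: bX].
rewrite (meanZ hm); last exact: bX.
have -> : d = 2 * (d / 4) + d / 2 by field.
apply: lerD.
  rewrite ler_wpM2l//; apply: h1 => // y iy.
  rewrite /f' mulrCA rho_kk mulrBr rhoB; have -> := hg y iy.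
  by rewrite subrr mulr0.
apply: (msub_split hm N10); first exact: bX.
move=> i iN.
rewrite (_ : (fun k => _) = (fun n => rho (f0 * U (s *~ p.[i%:Z]) g *
    VV 0 [seq aff N1 i r | r <- ps] fs n * ph [seq aff N1 i r | r <- rs] ths n))).
  apply: (h2 i (ltnW iN) _ _ fs ths (msub_mean hm iN)) => //.
  - by apply: ub_M => //; exact: ub_U.
  - by rewrite size_map.
  - by rewrite size_map.
  by rewrite mulrAC he mul0r.
apply: funext => k; rewrite /X /W ph_aff VV_aff.
have [w ->] := poly_dvd p N1 k i.
rewrite mulrzDr -U_D mulrzA -pmulrn.
have e := aeq_U (s *~ p.[i%:Z]) (inv_mulz w ig).
have -> : forall a b c x : A, a * b * x * c = (a * b * c) * x by move=> *; ring.
by rewrite e; congr (rho _); ring.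
Qed.

End Reduction.

(** * Dual functions: eigenfunctions turn into phases *)

Section Lowering.
Variables (R : realType) (A : dsys R).
Variables (m0 : (nat -> R) -> R) (hm0 : is_mean m0).
Implicit Types (f g u : A) (m : (nat -> R) -> R).

Local Notation aeq := (@weq R A rho).

Section Dl.
Variable s : {poly int}.

Lemma dlM f g h h' : dl s (f * g) h h' = dl s f h h' * dl s g h h'.
Proof. by rewrite /dl -bpM; apply: bp_ext => v; rewrite rmorphM. Qed.

Lemma dl1 h h' : dl s (1 : A) h h' = 1.
Proof. by rewrite /dl -[RHS](bp_1 A h h'); apply: bp_ext => v; rewrite rmorph1. Qed.

Lemma dl_upow f z h h' : dl s (upow f z) h h' = upow (dl s f h h') z.
Proof.
rewrite /dl (@bp_ext _ _ _ (fun v => upow (U (s *+ sumn v) f) z)) => [|v]; last exact: upow_U.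
by case: z => n /=; rewrite bpX// bp_cj.
Qed.

Lemma dl_ph rs ths n h h' : dl s (ph rs ths n : A) h h' =
  ph rs (map (fun f => dl s f h h') ths) n.
Proof.
by elim: rs ths => [|r rs IH] [|th ths] /=; rewrite ?dl1// dlM IH dl_upow.
Qed.

Lemma dl_VV i ps fs n h h' : dl s (VV i ps fs n : A) h h' =
  VV i ps (map (fun f => dl s f h h') fs) n.
Proof.
by elim: ps i fs => [|p ps IH] i [|f fs] /=; rewrite ?dl1// dlM IH dl_U.
Qed.

Lemma dl_unit f h h' : f * cj f = 1 -> dl s f h h' * cj (dl s f h h') = 1.
Proof.
by move=> e; apply: bp_unit => v; rewrite -U_cj -rmorphM e rmorph1.
Qed.

Lemma uni_dl ths h h' : uni ths -> uni (map (fun f : A => dl s f h h') ths).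
Proof. by elim: ths => //= th ths IH [h1 /IH]; split=> //; exact: dl_unit. Qed.

Lemma dl_rcons f h h' a a' : size h = size h' -> dl s f (rcons h a) (rcons h' a') =
  U (s *+ a) (dl s f h h') * cj (U (s *+ a') (dl s f h h')).
Proof.
elim: h h' f => [|b h IH] [|b' h'] f //= => [_|[sh]].
  by rewrite dl_cons !dl_nil.
by rewrite !dl_cons IH// !dl_cons.
Qed.

Lemma eig_pow (L X : A) (z : int) : L * cj L = 1 -> inv s L -> aeq (U s X) (L * X) ->
  aeq (U (s *~ z) X) (upow L z * X).
Proof.
move=> hL iL hX.
have pos n : aeq (U (s *+ n) X) (L ^+ n * X).
  elim: n => [|n IH]; first by rewrite mulr0n U_0 expr0 mul1r.
  rewrite mulrSr -U_D; apply: (aeq_trans (aeq_U (s *+ n) hX)).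
  rewrite rmorphM exprS -mulrA; apply: aeq_M => //; exact: inv_muln.
case: z => n; first by rewrite -pmulrn.
rewrite NegzE mulrNz -pmulrn /=.
have h := aeq_U (- (s *+ n.+1)) (pos n.+1).
rewrite U_D addNr U_0 rmorphM rmorphXn/= in h.
have iL' : aeq (U (- (s *+ n.+1)) L) L by apply: inv_oppr; exact: inv_muln.
have h2 : aeq X (L ^+ n.+1 * U (- (s *+ n.+1)) X).
  by apply: (aeq_trans h); apply: aeq_M => //; exact: aeq_X.
apply: aeq_sym; apply: (aeq_trans (aeq_M (aeq_refl _) h2)).
by rewrite mulrA -exprMn mulrC [cj L * L]mulrC hL expr1n mulr1.
Qed.

End Dl.

Variables (ps : seq {poly int}) (p : {poly int}) (rs : seq {poly int}).
Let s : {poly int} := 'X^(size ps).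

Definition gseq f0 fs ths n : A := f0 * VV 0 ps fs n * ph rs ths n.

(* [F] is the dual function of the average: pairing with [F] is averaging against the last factor. *)
Record isDual m f0 fs ths (F : A) : Prop := IsDual {
  dual_mean : is_mean m; dual_f0 : ub f0; dual_fs : uba fs; dual_ths : uni ths;
  dual_sfs : size fs = size ps; dual_sths : size ths = size rs; dual_F : ub F;
  dualE : forall a, rho (a * cj F) =
    m (fun n => rho (f0 * VV 0 ps fs n * U (s *~ p.[n%:Z]) a * ph rs ths n)) }.

Lemma gseq_ub f0 fs ths n : ub f0 -> uba fs -> uni ths -> ub (gseq f0 fs ths n).
Proof.
move=> *; apply: ub_M; last exact: ph_ub.
by apply: ub_M => //; exact: VV_ub.
Qed.

(** Expand [F] as a mean over [n] and exchange it with the average over [h]. For each [n], [GCS]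
    removes [b] and turns [chi] into its box product; a final translation leaves the box product of
    [gseq] at the origin and moves that of [chi] along [p]. *)
Lemma interchange m f0 fs ths F Hs chi b a c : isDual m f0 fs ths F -> posw Hs ->
  (forall v, ub (chi v)) -> LO (size Hs) b -> 0 <= c ->
  c <= Av1 Hs (fun h => rho (U (s *+ sumn h) (U (s *+ a) F) * (chi h * b h))) ->
  c ^+ (2 ^ size Hs) <= Av Hs (fun h h' => m (fun n =>
    rho (dl s (gseq f0 fs ths n) h h' * U (s *~ p.[n%:Z] - s *+ a) (cj (bp chi h h'))))).
Proof.
move=> D pH uchi hb c0 hc; have hm := dual_mean D.
pose w n v := U (s *+ sumn v) (U (s *+ a - s *~ p.[n%:Z]) (gseq f0 fs ths n)) * cj (chi v).
have ug n : ub (gseq f0 fs ths n).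
  by apply: gseq_ub; [exact: dual_f0 D|exact: dual_fs D|exact: dual_ths D].
have uw n v : ub (w n v).
  by apply: ub_M; [do 2 apply: ub_U|exact: ub_cj].
have E h : size h = size Hs -> rho (U (s *+ sumn h) (U (s *+ a) F) * (chi h * b h)) =
    m (fun n => rho (w n h * cj (b h))).
  move=> sh; rewrite U_D -rho_cj rmorphM -U_cj rho_UM mulrC (dualE D).
  congr m; apply: funext => n.
  rewrite /w -[in RHS]mulrA -[in RHS]rmorphM [in RHS]U_D rho_UM /gseq U_D.
  have -> : s *~ p.[n%:Z] + - (s *+ sumn h + s *+ a) =
     - (s *+ sumn h + (s *+ a - s *~ p.[n%:Z])) by rewrite addrA opprB.
  by congr (rho _); ring.
have bw h : win Hs h -> bseq (fun n => rho (w n h * cj (b h))).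
  move=> wh; apply: bseq_rho => n; apply: ub_M => //; apply: ub_cj.
  by apply: (LO_ub hb); exact: win_size.
pose x n := Av1 Hs (fun h => rho (w n h * cj (b h))).
have hx1 n : `|x n| <= 1.
  have hh h : win Hs h -> `|rho (w n h * cj (b h))| <= 1.
    move=> wh; apply: rho_abs; apply: ub_M => //; apply: ub_cj.
    by apply: (LO_ub hb); exact: win_size.
  rewrite ler_norml /x Av1_ub ?andbT//; last by move=> h /hh; rewrite ler_norml => /andP[].
  by rewrite -(Av1_cst (-1) pH); apply: Av1_le => h /hh; rewrite ler_norml => /andP[].
have bx : bseq x by exists 1.
have hcx : c <= m x.
  apply: (le_trans hc); rewrite (Av1_ext (fun h wh => E h (win_size wh))).
  (* [b] is known to be bounded on the window only; it is extended by [0] in order to exchange mean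
     and average. *)
  pose bb h := if win Hs h then b h else 0.
  rewrite (@Av1_ext _ _ _ (fun h => m (fun n => rho (w n h * cj (bb h))))); last first.
    by move=> h wh; rewrite /bb wh.
  rewrite -(mean_Av1 hm); last first.
    move=> h; apply: bseq_rho => n; apply: ub_M => //; apply: ub_cj; rewrite /bb.
    case: ifP => [wh|_]; last exact: ub_0.
    by apply: (LO_ub hb); exact: win_size.
  rewrite le_eqVlt; apply/orP; left; apply/eqP; congr m; apply: funext => n.
  by apply: Av1_ext => h wh; rewrite /bb wh.
apply: (@le_trans _ _ (m x ^+ (2 ^ size Hs))).
  by apply: lerXn2r; rewrite ?nnegrE// (le_trans c0).
apply: (le_trans (mean_pow hm _ bx)).
rewrite -(mean_Av hm); last first.
  move=> h h'; apply: bseq_rho => n; apply: ub_M; first exact: dl_ub.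
  by apply: ub_U; apply: ub_cj; exact: bp_ub.
apply: (mean_le hm).
- exists 1 => n; rewrite normrX exprn_ile1//.
- apply: bseq_Av => h h'; apply: bseq_rho => n; apply: ub_M; first exact: dl_ub.
  by apply: ub_U; apply: ub_cj; exact: bp_ub.
move=> n; apply: (le_trans (GCS pH (uw n) (LO_cj hb))).
rewrite le_eqVlt; apply/orP; left; apply/eqP; apply: Av_ext => h h' _ _.
rewrite /w bpM bp_cj -/(dl s (U _ _) h h') dl_U.
rewrite -(rho_U (s *~ p.[n%:Z] - s *+ a)) rmorphM U_D.
by rewrite addrA subrK subrr U_0.
Qed.

(** Moving the eigenfunction [cj X] along [p] multiplies it by powers of [cj L], so the last
    transformation is replaced by a phase with exponent [p]. [CPN] bounds the part off the set where
    [cj L ^+ N = 1]; the part on it is called [t] and estimated by Cauchy-Schwarz. *)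
Lemma use_C N d m f0 fs ths F h h' (L X : A) (a : nat) : CPN A ps (p :: rs) d N ->
  isDual m f0 fs ths F -> ub X -> L * cj L = 1 -> inv s L -> aeq (U s X) (L * X) ->
  exists2 t, t ^+ 2 <= rho (ei (cj L ^+ N) * (X * cj X)) &
  m (fun n => rho (dl s (gseq f0 fs ths n) h h' *
     U (s *~ p.[n%:Z] - s *+ a) (cj X))) <= d + t.
Proof.
move=> hC D uX hL iL hX; have hm := dual_mean D.
have hL' : cj L * cj (cj L) = 1 by rewrite cjK mulrC.
have iL' : inv s (cj L) by exact: inv_cj.
have hX' : aeq (U s (cj X)) (cj L * cj X).
  by rewrite U_cj -rmorphM; exact: aeq_cj.
pose f0' := dl s f0 h h'; pose fs' := map (fun f => dl s f h h') fs.
pose ths' := map (fun f => dl s f h h') ths.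
have u0' : ub f0' by apply: dl_ub; exact: dual_f0 D.
have ufs' : uba fs'.
  apply: uba_map (dual_fs D) => f; exact: dl_ub.
have hths' : uni ths' by apply: uni_dl; exact: dual_ths D.
pose Y := upow (cj L) (- a%:Z) * cj X.
have uY : ub Y by apply: ub_M; [apply: ub_unit; exact: upow_unit|exact: ub_cj].
pose G y n := rho (f0' * y * VV 0 ps fs' n * ph (p :: rs) (cj L :: ths') n).
have E : m (fun n => rho (dl s (gseq f0 fs ths n) h h' *
     U (s *~ p.[n%:Z] - s *+ a) (cj X))) = m (G Y).
  congr m; apply: funext => n; rewrite /gseq !dlM dl_VV dl_ph -/f0' -/fs' -/ths'.
  have -> : s *~ p.[n%:Z] - s *+ a = s *~ (p.[n%:Z] - a%:Z) by rewrite mulrzBr -pmulrn.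
  rewrite (eig_pow (p.[n%:Z] - a%:Z) hL' iL' hX') upowD//.
  by rewrite /G /Y /=; congr (rho _); ring.
set e := ei (cj L ^+ N).
have ee : e * e = e by exact: ei_idem.
have bG y : ub y -> bseq (G y).
  move=> uy; apply: bseq_rho => n; apply: ub_M; last exact: ph_ub.
  by apply: ub_M; [exact: ub_M|exact: VV_ub].
have u1 : ub ((1 - e) * Y) by apply: ub_M => //; exact: ei_ubC.
have u2 : ub (e * Y) by apply: ub_M => //; exact: ei_ub.
rewrite E; exists (m (G (e * Y))); last first.
  rewrite (_ : G Y = fun n => G ((1 - e) * Y) n + G (e * Y) n); last first.
    by apply: funext => n; rewrite /G -rhoD; congr (rho _); ring.
  rewrite (meanD hm)//; try exact: bG.
  rewrite lerD2r; apply: hC => //.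
  - exact: ub_M.
  - by rewrite size_map (dual_sfs D).
  - by rewrite /= size_map (dual_sths D).
  rewrite /eprod big_cons -/e.
  have -> : f0' * ((1 - e) * Y) * (e * \prod_(j <- ths') ei (j ^+ N)) =
     (e - e * e) * (f0' * Y * \prod_(j <- ths') ei (j ^+ N)) by ring.
  by rewrite ee subrr mul0r.
apply: (le_trans (mean_sqr hm (bG _ u2))); apply: (mean_lec hm).
  by apply: (bseqM (bG _ u2) (bG _ u2)).
move=> n; rewrite /G.
have -> : f0' * (e * Y) * VV 0 ps fs' n * ph (p :: rs) (cj L :: ths') n =
  (f0' * upow (cj L) (- a%:Z) * VV 0 ps fs' n * ph (p :: rs) (cj L :: ths') n) * (e * cj X).
  by rewrite /Y; ring.
apply: (le_trans (rho_CS1 _ _)).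
  apply: ub_M; last exact: ph_ub.
  apply: ub_M; last exact: VV_ub.
  by apply: ub_M => //; apply: ub_unit; exact: upow_unit.
rewrite rmorphM cjK ei_cj -/e.
have -> : e * cj X * (e * X) = e * e * (X * cj X) by ring.
by rewrite ee.
Qed.

End Lowering.

(** * One step of lowering the order *)

Section Step.
Variables (R : realType) (A : dsys R).
Variables (m0 : (nat -> R) -> R) (hm0 : is_mean m0).
Implicit Types (f g u : A) (m : (nat -> R) -> R).

Local Notation aeq := (@weq R A rho).

Lemma pigeon_seq (T : Type) (zs : seq T) (x : T -> R) c : 0 < c ->
  c <= \sum_(z <- zs) x z -> exists2 z, List.In z zs & c / (size zs).+1%:R <= x z.
Proof.
move=> c0 h; apply: contrapT => hn.
set d := c / _ in hn.
have d0 : 0 < d by rewrite divr_gt0.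
have hx z : List.In z zs -> x z <= d.
  by move=> hz; rewrite leNgt; apply/negP => /ltW hd; apply: hn; exists z.
have : \sum_(z <- zs) x z <= (size zs)%:R * d.
  elim: (zs) hx => [|z l IH] hx; first by rewrite big_nil mul0r.
  rewrite big_cons /= mulrS mulrDl mul1r lerD//; first by apply: hx; left.
  by apply: IH => y hy; apply: hx; right.
move=> /(le_trans h); rewrite /d mulrCA -[leLHS]mulr1 ler_pM2l// ler_pdivlMr// mul1r.
by rewrite ler_nat ltnn.
Qed.

Variables (ps : seq {poly int}) (p : {poly int}) (rs : seq {poly int}).
Let s : {poly int} := 'X^(size ps).

(* The factor [2^-1] keeps the recentred function bounded by [1]. *)
Definition WW r (F : A) : A := kk 2^-1 * (F - PP (s *+ r) F).

Lemma WW_ub r F : ub F -> ub (WW r F).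
Proof.
move=> uF; have [uP _ _] := PPP hm0 (s *+ r) uF.
have h01 : 0 <= (2^-1 : R) <= 1 by apply/andP; split; lra.
have := ub_conv h01 uF (ub_N uP).
have -> : 1 - 2^-1 = 2^-1 :> R by field.
by rewrite -mulrDr.
Qed.

Lemma WW_inv r F y : ub F -> inv (s *+ r) y -> rho (WW r F * y) = 0.
Proof.
move=> uF iy; have [_ _ h] := PPP hm0 (s *+ r) uF.
rewrite /WW -mulrA rho_kk mulrBl rhoB ![_ * y]mulrC h//.
by rewrite subrr mulr0.
Qed.

Lemma inv_bp (w : seq nat -> A) h h' : (forall v, inv s (w v)) -> inv s (bp w h h').
Proof. by move=> hw; rewrite /inv -bp_U; exact: bp_aeq. Qed.

Lemma PP_inv f : inv s (PP s f).
Proof.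
rewrite /PP; case: pselect => [e|_]; last by rewrite /inv rmorph0.
by case: cid => /= c [].
Qed.

(** [e] is the indicator function of the set where the real part of the projection of [G] is at
    least [c / 2]. Restricting to it costs [c / 2], and gains a lower bound valid against every
    nonnegative invariant weight [v * cj v]. *)
Lemma thr_step c (G : A) : 0 < c -> exists e, [/\ e * e = e, cj e = e, ub e, inv s e &
  (ub G -> rho G - c / 2 <= rho (e * G)) /\
  (forall v, ub G -> inv s (v * cj v) ->
     c / 2 * rho (e * (v * cj v)) <= rho (e * (v * cj v) * G))].
Proof.
move=> c0; have c2 : 0 <= c / 2 by rewrite divr_ge0// ltW.
have [e [e1 e2 e3 e4 [e5 e6]]] := thr (PP s G) c2.
have ie : inv s e by apply: e4; exact: PP_inv.
exists e; split=> //; split=> [uG|v uG iv].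
  have [_ _ h] := PPP hm0 s uG.
  have -> : rho G = rho (PP s G) by have := h 1 (inv_1 s); rewrite !mul1r.
  by rewrite h//; move: e5; rewrite mulrBl mul1r rhoB; lra.
have [_ _ h] := PPP hm0 s uG; apply: (le_trans (e6 v)).
rewrite h; last exact: inv_M.
by rewrite mulrAC.
Qed.

Definition eig (chi lam : A) :=
  [/\ ub chi, lam * cj lam = 1, inv s lam & aeq (U s chi) (lam * chi)].

Lemma eig_bp (chi lam : seq nat -> A) h h' : (forall v, eig (chi v) (lam v)) ->
  eig (bp chi h h') (bp lam h h').
Proof.
move=> he; split.
- by apply: bp_ub => v; case: (he v).
- by apply: bp_unit => v; case: (he v).
- by apply: inv_bp => v; case: (he v).
- by rewrite -bp_U -bpM; apply: bp_aeq => v; case: (he v).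
Qed.

Lemma eig_M chi lam e : eig chi lam -> ub e -> inv s e -> eig (chi * e) lam.
Proof.
move=> [h1 h2 h3 h4] ue ie; split=> //; first exact: ub_M.
by rewrite rmorphM mulrA; exact: aeq_M.
Qed.

Lemma eig_abs chi lam : eig chi lam -> inv s (chi * cj chi).
Proof.
move=> [h1 h2 h3 h4]; rewrite /inv rmorphM U_cj.
apply: (aeq_trans (aeq_M h4 (aeq_cj h4))); rewrite rmorphM mulrACA h2 mul1r.
exact: aeq_refl.
Qed.

(** [WW r F] is half the difference of [F] and the mean of the translates [U (s *+ (r * j)) F]. So
    [F] itself or the opposite of one translate keeps half of the correlation; this is the origin of
    [a] and of the sign [sg]. *)
Lemma dual_split c m f0 fs ths F r Hs (y : seq nat -> A) :
  isDual ps p rs m f0 fs ths F -> 0 < c ->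
  c <= Av1 Hs (fun h => rho (U (s *+ sumn h) (WW r F) * y h)) ->
  exists a sg, (sg = 1 \/ sg = - 1 :> A) /\
    c / 2 <= Av1 Hs (fun h => rho (U (s *+ sumn h) (U (s *+ a) F) * (sg * y h))).
Proof.
move=> D c0 hc; have uF := dual_F D.
pose Y a := Av1 Hs (fun h => rho (U (s *+ sumn h) (U (s *+ a) F) * y h)).
have bx h : bseq (fun j => rho (U (s *+ sumn h) (U (s *+ (r * j)) F) * y h)).
  rewrite (_ : (fun j => _) = fun j => rho (y h * U (s *+ sumn h) (U (s *+ (r * j)) F))).
    by apply: bseq_rhoM => j; do 2 apply: ub_U.
  by apply: funext => j; rewrite mulrC.
have bY : bseq (fun j => Y (r * j)%N) by exact: bseq_Av1.
have E : Av1 Hs (fun h => rho (U (s *+ sumn h) (WW r F) * y h)) =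
    2^-1 * (Y 0%N - m0 (fun j => Y (r * j)%N)).
  rewrite (mean_Av1 hm0)// -[- Av1 _ _]mulN1r -Av1Z -Av1D -Av1Z.
  apply: Av1_ext => h _; rewrite /WW rmorphM U_kk rmorphB/= -mulrA rho_kk mulrBl rhoB.
  rewrite mulr0n U_0 mulN1r; congr (_ * (_ - _)).
  rewrite rho_UM mulrC (PP_mean hm0)//; congr m0; apply: funext => j.
  by rewrite mulrC -rho_UM mulrnA.
rewrite E in hc.
have [h0|h0] := leP (c / 2) (Y 0%N).
  exists 0%N, 1; split; first by left.
  by apply: (le_trans h0); apply: Av1_le => h _; rewrite mul1r.
have [j hj] : exists j, c / 2 <= - Y (r * j)%N.
  apply: contrapT => hn.
  have hj j : - (c / 2) <= Y (r * j)%N.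
    rewrite leNgt; apply/negP => hlt; apply: hn; exists j; lra.
  have : - (c / 2) <= m0 (fun j => Y (r * j)%N).
    by rewrite -(mean_cst hm0 (- (c / 2))) (mean_le hm0)//; exact: bseq_cst.
  lra.
exists (r * j)%N, (-1); split; first by right.
apply: (le_trans hj); rewrite /Y -[- Av1 _ _]mulN1r -Av1Z; apply: Av1_le => h _.
by rewrite mulN1r -rhoN mulN1r mulrN.
Qed.

(** The hypothesis is what the inverse theorem extracts from a large seminorm of order [k + 2]; the
    conclusion is a large seminorm of order [k + 1], or a contradiction when [k = 0]. *)
Lemma DLstep k c : CP A ps (p :: rs) -> 0 < c ->
  exists N c', [/\ (0 < N)%N, 0 < c' & forall m f0 fs ths F r Hs chi lam,
    isDual ps p rs m f0 fs ths F -> (N %| r)%N -> posw Hs -> size Hs = k ->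
    (forall h h', eig (chi h h') (lam h h')) ->
    c <= Av Hs (fun h h' => rho (dl s (WW r F) h h' * chi h h')) ->
    (0 < k)%N /\ c' <= QQ s Hs (WW r F)].
Proof.
(* [c1] is what survives after [thr_step] and [dual_split] have each kept one half; [d] reserves
   half of the bound from [interchange] for the error of [CP]. *)
move=> hC c0; pose c1 := c / 4; have c10 : 0 < c1 by rewrite divr_gt0.
pose d := c1 ^+ (2 ^ k) / 2; have d0 : 0 < d by rewrite divr_gt0// exprn_gt0.
have [N N0 hN] := hC d d0.
have [zs [hzs hroots]] := roots A N0.
pose c3 := c / 2 * d ^+ 2.
have c30 : 0 < c3 by rewrite mulr_gt0 ?divr_gt0// exprn_gt0.
pose c4 := c3 / (size zs).+1%:R; have c40 : 0 < c4 by rewrite divr_gt0.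
exists N, ((c4 ^+ (2 ^ k)) ^+ 2); split=> //; first by rewrite !exprn_gt0.
move=> m f0 fs ths F r Hs chi lam D Nr pH sH heig hc.
have uF := dual_F D; have uW := WW_ub r uF; set W := WW r F in hc uW *.
(* Freezing [h'] singles out the vertex [w h]; all other vertices go into the lower-order factor
   [b]. *)
have [h' wh' hc'] : exists2 h', win Hs h' &
    c <= Av1 Hs (fun h => rho (dl s W h h' * chi h h')).
  by move: hc; rewrite AvE => /(Av1_ex pH).
have sh' : size h' = k by rewrite -sH; exact: win_size.
pose w v := U (s *+ sumn v) W; have uw v : ub (w v) by exact: ub_U.
have [b [hb _ hbp]] := @bp_LO R A w h' (fun=> True) I (fun _ _ _ _ => I) (fun _ _ => I) uw (fun=> I).
rewrite sh' in hb.
pose X h := chi h h'; pose L h := lam h h'.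
have hXL h : eig (X h) (L h) by exact: heig.
pose G h := w h * (X h * b h).
have uG h : win Hs h -> ub (G h).
  move=> wh; apply: ub_M => //; apply: ub_M; first by case: (hXL h).
  by apply: (LO_ub hb); rewrite -sH; exact: win_size.
have /choice[e he] := fun h => thr_step (G h) c0.
pose chi1 h := X h * e h.
have e1 h : eig (chi1 h) (L h) by case: (he h) => _ _ ue ie _; exact: eig_M.
have hc1 : c / 2 <= Av1 Hs (fun h => rho (w h * (chi1 h * b h))).
  have : Av1 Hs (fun h => rho (G h) + - (c / 2)) <= Av1 Hs (fun h => rho (w h * (chi1 h * b h))).
    apply: Av1_le => h wh; case: (he h) => _ _ _ _ [h1 _].
    apply: (le_trans (h1 (uG h wh))); rewrite le_eqVlt; apply/orP; left; apply/eqP.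
    by congr (rho _); rewrite /G /chi1; ring.
  apply: le_trans; rewrite Av1D Av1_cst// lerBrDr -splitr.
  apply: (le_trans hc'); apply: Av1_le => h wh.
  by rewrite /dl hbp ?sh' ?(win_size wh)// /G -mulrA [b h * _]mulrC.
have c20 : 0 < c / 2 by rewrite divr_gt0.
have [a [sg [hsg hc2]]] := dual_split D c20 hc1.
have sg2 : sg * cj sg = 1 /\ inv s sg.
  by case: hsg => ->; rewrite /inv ?rmorphN ?rmorph1 ?mulrNN ?mulr1.
have [sgc isg] := sg2; have usg : ub sg by exact: ub_unit.
pose chi2 h := chi1 h * sg.
have e2 h : eig (chi2 h) (L h) by exact: eig_M.
have hc3 : c1 <= Av1 Hs (fun h => rho (U (s *+ sumn h) (U (s *+ a) F) * (chi2 h * b h))).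
  have -> : c1 = c / 2 / 2 by rewrite /c1; field.
  apply: (le_trans hc2); apply: Av1_le => h _; rewrite le_eqVlt; apply/orP; left; apply/eqP.
  by congr (rho _); rewrite /chi2; ring.
have hbH : LO (size Hs) b by rewrite sH.
have uchi2 v : ub (chi2 v) by case: (e2 v).
have := interchange D pH uchi2 hbH (ltW c10) hc3; rewrite sH.
pose Xb h h2 := bp chi2 h h2; pose Lb h h2 := bp L h h2.
have eb h h2 : eig (Xb h h2) (Lb h h2) by exact: eig_bp.
pose T h h2 := rho (ei (cj (Lb h h2) ^+ N) * (Xb h h2 * cj (Xb h h2))).
have /choice[t ht] : forall hh : seq nat * seq nat, exists t, t ^+ 2 <= T hh.1 hh.2 /\
    m (fun n => rho (dl s (gseq ps rs f0 fs ths n) hh.1 hh.2 *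
      U (s *~ p.[n%:Z] - s *+ a) (cj (bp chi2 hh.1 hh.2)))) <= d + t.
  move=> [h h2] /=; have [h1 h3 h4 h5] := eb h h2.
  by have [t t1 t2] := use_C h h2 a hN D h1 h3 h4 h5; exists t.
move=> hA.
(* After the error [d] is subtracted, the rest of the lower bound must come from the set where
   [Lb h h2 ^+ N = 1]. *)
have hT : d ^+ 2 <= Av Hs T.
  have : c1 ^+ (2 ^ k) <= d + Av Hs (fun h h2 => t (h, h2)).
    apply: (le_trans hA); rewrite -[X in X + _](Av_cst d pH) -AvD.
    by apply: Av_le => h h2 _ _; case: (ht (h, h2)).
  have -> : c1 ^+ (2 ^ k) = d + d by rewrite /d -splitr.
  rewrite lerD2l => hd; apply: (@le_trans _ _ (Av Hs (fun h h2 => t (h, h2)) ^+ 2)).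
    by apply: lerXn2r; rewrite ?nnegrE ?(ltW d0)// (le_trans (ltW d0)).
  apply: (le_trans (Av_sqr _ _)); apply: Av_le => h h2 _ _.
  by case: (ht (h, h2)).
have [h2 wh2 hT2] : exists2 h2, win Hs h2 & d ^+ 2 <= Av1 Hs (fun h => T h h2).
  by move: hT; rewrite AvE => /(Av1_ex pH).
pose Pa (f : A) := inv s (f * cj f).
have P1 : Pa 1 by rewrite /Pa rmorph1 mulr1; exact: inv_1.
have PM f g : Pa f -> Pa g -> Pa (f * g).
  by rewrite /Pa rmorphM mulrACA; exact: inv_M.
have PC f : Pa f -> Pa (cj f) by rewrite /Pa mulrC cjK.
have [be [hbe ibe hbpe]] :=
  bp_LO h2 P1 PM PC uchi2 (fun v => eig_abs (e2 v)).
have sh2 : size h2 = k by rewrite -sH; exact: win_size.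
rewrite sh2 in hbe.
pose eL h := ei (cj (Lb h h2) ^+ N).
have ieL h : inv s (eL h).
  apply: inv_ei; rewrite /inv rmorphXn/= U_cj; apply: aeq_X; apply: aeq_cj.
  by case: (eb h h2).
(* With [h2] frozen as well, [Y h] is an eigenfunction whose eigenvalue is an [N]-th root of unity
   wherever [Y h] does not vanish. *)
pose Y h := sg * Xb h h2 * eL h.
pose b' h := b h * cj (be h).
have hb' : LO k b' by apply: LO_M => //; exact: LO_cj.
(* From the size of the eigenfunctions back to a correlation with [w]: the cut-off [e h] was
   introduced for this, and applies because [v * cj v] is invariant. *)
have hc5 : c3 <= Av1 Hs (fun h => rho (w h * Y h * b' h)).
  apply: (@le_trans _ _ (Av1 Hs (fun h => c / 2 * T h h2))).
    by rewrite Av1Z ler_pM2l.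
  apply: Av1_le => h wh; have [ee ce ue ie [_ hthr]] := he h.
  have eLL : eL h * eL h = eL h by exact: ei_idem.
  have ceL : cj (eL h) = eL h by exact: ei_cj.
  have XbE : Xb h h2 = chi2 h * be h by apply: hbpe; rewrite sh2 -sH; exact: win_size.
  pose v := eL h * be h.
  have iv : inv s (v * cj v).
    by rewrite /v rmorphM mulrACA ceL eLL; apply: inv_M => //; exact: ibe.
  have vv : v * cj v = eL h * (be h * cj (be h)) by rewrite /v rmorphM ceL mulrACA eLL.
  apply: (@le_trans _ _ (c / 2 * rho (e h * (v * cj v)))).
    rewrite ler_pM2l//.
    have [uX _ _ _] := hXL h.
    apply: (le_trans _ (le_trans (ub_sq (e h * v) uX) _)).
      rewrite /T -/(eL h) XbE /chi2 /chi1 !rmorphM ce.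
      rewrite le_eqVlt; apply/orP; left; apply/eqP; congr (rho _).
      transitivity (eL h * (X h * cj (X h)) * (e h * e h) * (sg * cj sg) * (be h * cj (be h))).
        by ring.
      rewrite sgc ee /v ?rmorphM ?ceL; transitivity
        (X h * cj (X h) * ((e h * e h) * (eL h * eL h) * (be h * cj (be h)))).
        by rewrite ee eLL; ring.
      by ring.
    rewrite rmorphM ce le_eqVlt; apply/orP; left; apply/eqP; congr (rho _).
    transitivity (e h * e h * (v * cj v)); first by ring.
    by rewrite ee.
  apply: (le_trans (hthr v (uG h wh) iv)).
  rewrite le_eqVlt; apply/orP; left; apply/eqP; congr (rho _).
  rewrite vv /Y XbE /chi2 /chi1 /G /b'.
  have sgg : sg * sg = 1 by case: hsg => ->; rewrite ?mulrNN mulr1.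
  transitivity (w h * (sg * sg * (X h * e h) * be h * eL h) * (b h * cj (be h))).
    by rewrite sgg; ring.
  by ring.
have uY h : ub (Y h).
  apply: ub_M; last exact: ei_ub.
  by apply: ub_M => //; case: (eb h h2).
case: k sH sh' sh2 hb hb' hbe @d d0 hN @c3 c30 @c4 c40 hA hT hT2 hc5 ht
  => [|k] sH sh' sh2 hb hb' hbe d d0 hN c3 c30 c4 c40 hA hT hT2 hc5 ht.
  (* Without windows, [Y [::]] is invariant under [s *+ N], hence under [s *+ r], and [WW r F] is
     orthogonal to it. *)
  exfalso; case: Hs sH hc5 {pH hc wh' hc' uG hc1 hc2 hc3 hbH hA hT wh2 hT2} => // _ /= hc5.
  move: hb' => /= hb'; move: hc5; rewrite hb' mulr1 /w mulr0n U_0.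
  have iY : inv (s *+ r) (Y [::]).
    have iN : inv (s *+ N) (Y [::]).
      have [h1 h3 h4 h5] := eb [::] h2.
      have hY : eig (Y [::]) (Lb [::] h2).
        by rewrite /Y -mulrA mulrC; apply: eig_M => //; apply: eig_M => //; exact: ei_ub.
      have [_ _ _ hYe] := hY.
      have := eig_pow N%:Z h3 h4 hYe; rewrite -pmulrn /inv => /aeq_trans; apply.
      rewrite /= /Y mulrCA; have -> : Lb [::] h2 ^+ N * eL [::] = eL [::].
        have := congr1 cj (ei_mul (cj (Lb [::] h2) ^+ N)).
        by rewrite rmorphM rmorphXn/= cjK ei_cj mulrC.
      exact: aeq_refl.
    by have /dvdnP[q ->] := Nr; rewrite mulnC mulrnA; exact: inv_muln.
  by rewrite (WW_inv uF iY) => /le_lt_trans/(_ c30); rewrite ltxx.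
split=> //.
(* Splitting according to the root of unity makes the eigenvalue a constant. It cancels in a box
   product over at least one window, so the box product of [Yz z] is invariant and is absorbed by
   [Psi]. *)
pose Yz z h := sg * Xb h h2 * ei (cj z * cj (Lb h h2)).
have hsum h : Y h = \sum_(z <- zs) Yz z h.
  rewrite /Y /eL hroots -?mulr_sumr//; have [_ h3 _ _] := eb h h2.
  by rewrite cjK mulrC.
have [z hz hc6] : exists2 z, List.In z zs &
    c4 <= Av1 Hs (fun h => rho (w h * Yz z h * b' h)).
  apply: (pigeon_seq c30 (x := fun z => Av1 Hs (fun h => rho (w h * Yz z h * b' h)))).
  apply: (le_trans hc5); rewrite -Av1_sum; apply: Av1_le => h _.
  by rewrite hsum mulr_sumr mulr_suml rho_sum.
have [zc zU] := hzs z hz.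
have uYz h : ub (Yz z h).
  apply: ub_M; last exact: ei_ub.
  by apply: ub_M => //; case: (eb h h2).
have eYz h : aeq (U s (Yz z h)) (cj z * Yz z h).
  have [h1 h3 h4 h5] := eb h h2; rewrite /Yz; set q := ei _.
  have iq : inv s q by apply: inv_ei; apply: inv_M; [rewrite /inv U_cj zU|exact: inv_cj].
  have qL : q * Lb h h2 = cj z * q.
    have e3 : q * (z * Lb h h2) = q.
      have e4 : q * (cj z * cj (Lb h h2)) = q by exact: ei_mul.
      have := congr1 cj e4; rewrite -[cj z * _]rmorphM rmorphM cjK /q ei_cj => e5.
      by rewrite -[RHS]e5.
    by rewrite -[in RHS]e3; transitivity (z * cj z * (q * Lb h h2)); [rewrite zc mul1r|ring].
  rewrite !rmorphM; apply: (aeq_trans (aeq_M (aeq_M isg h5) iq)).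
  have -> : sg * (Lb h h2 * Xb h h2) * q = sg * Xb h h2 * (q * Lb h h2) by ring.
  by rewrite qL => x; congr (rho _); ring.
have := @GCS R A Hs (fun v => w v * Yz z v) b' pH (fun v => ub_M (uw v) (uYz v)).
rewrite sH => /(_ hb') hG.
have hG2 : c4 ^+ (2 ^ k.+1) <= Av Hs (fun h h' => rho (bp (fun v => w v * Yz z v) h h')).
  by apply: le_trans hG; apply: lerXn2r; rewrite ?nnegrE ?(ltW c40)// (le_trans (ltW c40)).
have p0 : 0 <= c4 ^+ (2 ^ k.+1) by rewrite exprn_ge0// ltW.
apply: (@le_trans _ _ (Av Hs (fun h h' => rho (bp (fun v => w v * Yz z v) h h')) ^+ 2)).
  by apply: lerXn2r; rewrite ?nnegrE// (le_trans p0).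
apply: (le_trans (Av_sqr _ _)); apply: Av_le => h h3 wh wh3.
rewrite bpM; apply: (rho_Psi hm0); first exact: dl_ub.
  exact: bp_ub.
rewrite /inv -bp_U; apply: (aeq_trans (bp_aeq _ _ eYz)).
rewrite bpM; have -> : bp (fun=> cj z) h h3 = 1.
  case: Hs sH h h3 wh wh3 {pH hc wh' hc' uG hc1 hc2 hc3 hbH hA hT wh2 hT2 hc5 hc6 hG hG2}
    => //= H Hs _ [|x h] [|y h3] //= _ _.
  rewrite (@bp_ext _ _ _ (fun=> 1)) ?bp_1// => v.
  by rewrite cjK mulrC.
by rewrite mul1r; exact: aeq_refl.
Qed.

End Step.

(** * Iterating the step; negligible last functions *)

Section Inverse.
Variables (R : realType) (A : dsys R).
Variables (m0 : (nat -> R) -> R) (hm0 : is_mean m0).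
Implicit Types (f g u : A) (m : (nat -> R) -> R).

Section Eig.
Variable s : {poly int}.

Definition PsiT (M t : nat) (g : A) := avg (M * t`!) (fun a => avg (M * t`!) (fun b =>
  Psi s (U (s *+ a) g * cj (U (s *+ b) g)))).

Lemma PsiT_bd M t g : ub g -> 0 <= PsiT M t g <= 1.
Proof.
move=> ug; apply/andP; split.
  by do 2 (apply: avg_ge0 => ? _); exact: Psi_ge0.
do 2 (apply: avg_ub => // ? _); apply: (Psi_le1 hm0).
by apply: ub_M; [|apply: ub_cj]; exact: ub_U.
Qed.

Lemma bseq_PsiT M g : ub g -> bseq (fun t => PsiT M t g).
Proof.
move=> ug; exists 1 => t; have /andP[h1 h2] := PsiT_bd M t ug.
by rewrite ger0_norm.
Qed.

(** The inverse theorem as one inequality without case distinction: [chi = 0] is taken when the mean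
    is below [c / 2]. In this form it can be averaged over all derivatives. *)
Lemma eig_ex c M : 0 < c -> (0 < M)%N -> exists2 kap, 0 < kap & forall g, ub g ->
  exists chi lam : A, [/\ ub chi, lam * cj lam = 1, inv s lam,
    weq rho (U s chi) (lam * chi) &
    kap * (m0 (fun t => PsiT M t g) - c / 2) <= rho (g * chi)].
Proof.
move=> c0 M0; have c4 : 0 < c / 4 by rewrite divr_gt0.
have [kap k0 hk] := u2inv A c4; exists kap => // g ug.
have bP := bseq_PsiT M ug; set mu := m0 _.
have mu1 : mu <= 1.
  by apply: (mean_lec hm0) => // t; case/andP: (PsiT_bd M t ug).
have [hmu|hmu] := leP (c / 2) mu; last first.
  exists 0, 1; split; rewrite ?mulr0 ?rho0.
  - exact: ub_0.
  - by rewrite rmorph1 mulr1.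
  - exact: inv_1.
  - by rewrite rmorph0; exact: aeq_refl.
  - by apply: mulr_ge0_le0; rewrite ?(ltW k0)// subr_le0 ltW.
have ugg a b : ub (U (s *+ a) g * cj (U (s *+ b) g)).
  by apply: ub_M; [|apply: ub_cj]; exact: ub_U.
have hP a b := PPP hm0 s (ugg a b).
have [||||chi [lam [h1 h2 h3 h4 h5]]] := hk g s M
   (fun a b => PP s (U (s *+ a) g * cj (U (s *+ b) g))) ug M0.
- by move=> a b; case: (hP a b).
- by move=> a b; case: (hP a b).
- by move=> a b y iy; case: (hP a b) => _ _; exact.
- move=> T; apply: contrapT => hn.
  have : mu <= c / 4.
    rewrite /mu -(meanSn hm0 T) //; apply: (mean_lec hm0).
      exact: (@bseq_comp _ (fun n => n + T)%N _ bP).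
    move=> t; rewrite leNgt; apply/negP => /ltW ht; apply: hn.
    by exists (t + T)%N; [exact: leq_addl|exact: ht].
  by lra.
exists chi, lam; split=> //; apply: (le_trans _ h5).
by rewrite -[leRHS]mulr1 ler_pM2l//; lra.
Qed.

End Eig.

Variables (ps : seq {poly int}) (p : {poly int}) (rs : seq {poly int}).
Let s : {poly int} := 'X^(size ps).

(** The last window, [M] times a factorial, is reserved for the inverse theorem applied to the
    derivatives over the other windows; [DLstep] then gives a lower bound of one order less. At the
    lowest order its conclusion [0 < k] fails. *)
Lemma DL k c M : CP A ps (p :: rs) -> 0 < c -> (0 < M)%N ->
  exists2 N, (0 < N)%N & forall m f0 fs ths F r,
    isDual ps p rs m f0 fs ths F -> (N %| r)%N ->
    ~ (forall Hs, size Hs = k.+1 -> mulw M Hs -> c <= QQ s Hs (WW ps r F)).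
Proof.
move=> hC; elim: k c => [|k IH] c c0 M0.
  have [kap k0 hk] := eig_ex s c0 M0.
  have [|N [c' [N0 c'0 hN]]] := @DLstep R A m0 hm0 ps p rs 0 (kap * (c / 2)) hC.
    by rewrite mulr_gt0// divr_gt0.
  exists N => // m f0 fs ths F r D Nr hQ.
  have uW := WW_ub hm0 ps r (dual_F D).
  have [chi [lam [h1 h2 h3 h4 h5]]] := hk _ uW.
  have [] // := hN m f0 fs ths F r [::] (fun _ _ => chi) (fun _ _ => lam) D Nr.
  rewrite /= dl_nil; apply: (le_trans _ h5); rewrite ler_pM2l//.
  have : c <= m0 (fun t => PsiT s M t (WW ps r F)).
    rewrite -(mean_cst hm0 c); apply: (mean_le hm0); first exact: bseq_cst.
      exact: bseq_PsiT.
    move=> t; have := hQ [:: (M * t`!)%N] erefl.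
    rewrite /mulw /= muln_gt0 M0 fact_gt0 dvdn_mulr// => /(_ isT) h.
    apply: (le_trans h); rewrite QQ_cons; apply: avg_le => a _; apply: avg_le => b _.
    by rewrite /QQ /= dl_nil.
  by lra.
have [kap k0 hk] := eig_ex s c0 M0.
have [|N [c' [N0 c'0 hN]]] := @DLstep R A m0 hm0 ps p rs k.+1 (kap * (c / 2)) hC.
  by rewrite mulr_gt0// divr_gt0.
have [N2 N20 hN2] := IH c' c'0 M0.
exists (N * N2)%N; first by rewrite muln_gt0 N0.
move=> m f0 fs ths F r D Nr hQ.
have N1r := dvdn_trans (dvdn_mulr N2 (dvdnn N)) Nr.
apply: (hN2 m f0 fs ths F r D (dvdn_trans (dvdn_mull N (dvdnn N2)) Nr)) => Hs sH hH.
have uW := WW_ub hm0 ps r (dual_F D); set W := WW ps r F in uW hQ *.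
have udl h h' : ub (dl s W h h') by exact: dl_ub.
have /choice[cl hcl] : forall hh : seq nat * seq nat, exists cl : A * A,
   [/\ ub cl.1, cl.2 * cj cl.2 = 1, inv s cl.2, weq rho (U s cl.1) (cl.2 * cl.1) &
    kap * (m0 (fun t => PsiT s M t (dl s W hh.1 hh.2)) - c / 2) <= rho (dl s W hh.1 hh.2 * cl.1)].
  by move=> [h h']; have [chi [lam H]] := hk _ (udl h h'); exists (chi, lam).
have pH := mulw_pos hH.
have [] // := hN m f0 fs ths F r Hs (fun h h' => (cl (h, h')).1)
  (fun h h' => (cl (h, h')).2) D N1r pH sH.
  by move=> h h'; have [h1 h2 h3 h4 _] := hcl (h, h').
apply: (@le_trans _ _ (Av Hs (fun h h' =>
    kap * (m0 (fun t => PsiT s M t (dl s W h h')) + - (c / 2))))); last first.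
  by apply: Av_le => h h' _ _; have [_ _ _ _] := hcl (h, h').
rewrite AvZ AvD Av_cst// ler_pM2l//.
suff : c <= Av Hs (fun h h' => m0 (fun t => PsiT s M t (dl s W h h'))) by lra.
rewrite -(mean_Av hm0); last by move=> h h'; exact: bseq_PsiT.
rewrite -[leLHS](mean_cst hm0); apply: (mean_le hm0); first exact: bseq_cst.
  by apply: bseq_Av => h h'; exact: bseq_PsiT.
move=> t; have := hQ (rcons Hs (M * t`!)%N); rewrite size_rcons sH => /(_ erefl).
rewrite /mulw all_rcons -/(mulw M Hs) hH muln_gt0 M0 fact_gt0 dvdn_mulr// => /(_ isT) h.
apply: (le_trans h); rewrite /QQ Av_rcons; apply: Av_le => h1 h2 w1 w2.
apply: avg_le => a _; apply: avg_le => b _.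
by rewrite dl_rcons// (win_size w1) (win_size w2).
Qed.

(* Turns the exponent [q n] of the i-th transformation into a polynomial with coefficients in the
   acting group. *)
Definition emb i (q : {poly int}) : {poly {poly int}} := 'X^i *: map_poly polyC q.

Lemma polyC_intr (z : int) : z%:P = z%:~R :> {poly int}.
Proof. by rewrite -[in LHS](intz z) rmorph_int. Qed.

Lemma emb_horner i q n : (emb i q).[n%:R] = 'X^i *~ q.[n%:Z].
Proof.
rewrite /emb hornerZ -[n%:R](_ : (n%:Z)%:P = _); last by rewrite polyC_intr -pmulrn.
by rewrite horner_map /= polyC_intr mulrzr.
Qed.

Lemma size_emb i q : size (emb i q) = size q.
Proof. by rewrite /emb size_scale ?monic_neq0 ?monicXn// size_map_polyC. Qed.

Lemma lead_emb i q : lead_coef (emb i q) = 'X^i *~ lead_coef q.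
Proof.
rewrite /emb lead_coefZ lead_coef_map_inj//; last exact: polyC_inj.
by rewrite polyC_intr mulrzr.
Qed.

Fixpoint embs i (qs : seq {poly int}) : seq {poly {poly int}} :=
  if qs is q :: qs' then emb i q :: embs i.+1 qs' else [::].

Lemma tm_embs i qs fs n : tm (embs i qs) fs n = VV i qs fs n :> A.
Proof.
by elim: qs i fs => [|q qs IH] i [|f fs] //=; rewrite IH emb_horner.
Qed.

Lemma size_embs i qs : size (embs i qs) = size qs.
Proof. by elim: qs i => //= q qs IH i; rewrite IH. Qed.

Lemma mem_embs i qs q : q \in embs i qs ->
  exists2 q' : {poly int}, q' \in qs & size q = size q'.
Proof.
elim: qs i => [//|x qs IH] i; rewrite inE => /orP[/eqP ->|/IH[y h e]].
  by exists x; rewrite ?mem_head// size_emb.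
by exists y => //; rewrite inE h orbT.
Qed.

Lemma srt_top : srt (rcons ps p ++ rs) ->
  (1 < size p)%N /\ forall q, q \in ps -> (1 < size q < size p)%N.
Proof.
rewrite /srt map_cat map_rcons cat_path => /andP[h _].
have h1 := order_path_min ltn_trans h.
rewrite all_rcons in h1; case/andP: h1 => h1 h2; split=> // q hq.
rewrite (allP h2); last exact: map_f.
move: h; rewrite rcons_path => /andP[+ hl].
elim/last_ind: (ps) hq hl => // l x IH; rewrite map_rcons last_rcons rcons_path.
rewrite mem_rcons inE => /orP[/eqP-> //|hq] hx /andP[hl hlx].
by apply: IH => //; exact: ltn_trans hlx hx.
Qed.

(** If [p] is linear then [ps] is empty, by the order of the degrees, and [LinT] applies. Otherwise
    [p] dominates the other exponents, and [f0] is treated as one more function, with exponent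
    [0]. *)
Lemma PETC d : srt (rcons ps p ++ rs) -> 0 < d -> exists c M K, [/\ 0 < c, (0 < M)%N &
  forall m f0 f fs ths, is_mean m -> ub f0 -> ub f -> uba fs -> uni ths ->
  size fs = size ps -> size ths = size rs ->
  d <= m (fun n => rho (f0 * VV 0 ps fs n * U (s *~ p.[n%:Z]) f * ph rs ths n)) ->
  Concl s c M K f].
Proof.
move=> hs d0; have [p1 hps] := srt_top hs.
have s0 : s != 0 by rewrite monic_neq0 ?monicXn.
have lp0 : lead_coef p != 0 by rewrite lead_coef_eq0 -size_poly_gt0 ltnW.
pose D := \max_(r <- rs) size (r : {poly int}).
have hD : all (fun r : {poly int} => size r <= D.+1)%N rs.
  apply/allP => r hr; rewrite /D.
  rewrite (big_rem r hr)/=; apply: leqW; exact: leq_maxl.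
have [p2|p2] := leqP (size p) 2.
  have ps0 : ps = [::].
    case: (ps) hps => // q qs /(_ q (mem_head _ _)) /andP[q1 q2].
    by have := leq_ltn_trans q1 (leq_trans q2 p2); rewrite ltnn.
  have sp : size p = 2%N by apply/eqP; rewrite eqn_leq p2.
  have p10 : p`_1 != 0 by move: lp0; rewrite lead_coefE sp.
  have [c' [M [c'0 M0 hL]]] := @LinT R A m0 hm0 s p`_1 [::] D
    p10 isT d d0.
  exists c', M, D; split=> // m f0 f fs ths hm u0 uf ufs hu sfs sths hd.
  exists D => // Hs sH hH; rewrite -(QQ_U hm0 s (s *~ p`_0) Hs uf).
  apply: (hL m f0 _ [::] rs ths) => //; first exact: ub_U.
    apply: (le_trans hd); rewrite le_eqVlt; apply/orP; left; apply/eqP; congr m.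
    apply: funext => n; congr (rho _); rewrite ps0 /= U_D -mulrzDr !mulr1 -mulrA.
    congr (_ * (U (s *~ _) f * _)).
    rewrite (@horner_coef_wide _ 2) ?sp// 2!big_ord_recr big_ord0 /= add0r.
    by rewrite expr0 mulr1 expr1 addrC.
  by rewrite addn0.
have nc : nice s (emb (size ps) p) (0 :: embs 0 ps).
  have g0 : good s (emb (size ps) p).
    by exists (lead_coef p) => //; rewrite size_emb lead_emb.
  split=> // q; rewrite inE => /orP[/eqP ->|/mem_embs[q' hq' e]].
    by rewrite subr0 size_poly0.
  have /andP[_ q2] := hps _ hq'.
  have sq : (size (- q) < size (emb (size ps) p))%N by rewrite size_polyN e size_emb.
  split; last by rewrite e size_emb ltnW.
  exists (lead_coef p) => //.
  by rewrite size_polyDl// lead_coefDl// size_emb lead_emb.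
have [|c [M [K [c0 M0 hG]]]] := @Good_PET R A m0 hm0 s s0 _ _ D _ nc d d0.
  by rewrite size_emb.
exists c, M, K; split=> // m f0 f fs ths hm u0 uf ufs hu sfs sths hd.
apply: (hG m f (f0 :: fs) rs ths) => //=; first by rewrite size_embs sfs.
apply: (le_trans hd); rewrite le_eqVlt; apply/orP; left; apply/eqP; congr m.
apply: funext => n; rewrite emb_horner horner0 U_0 tm_embs; congr (rho _).
by rewrite -/s; ring.
Qed.

(** Lowering the order works for dual functions only, so a large average is first transferred from
    [f] to [W = WW ps N F]. As [f] is orthogonal to the invariants, it correlates with [W]; hence
    [W] has large norm, and as [W] is orthogonal to the projection of [F], it correlates with [F].
    The average with [W] in place of [f] is thus large, and [PETC] contradicts [DL]. *)
Lemma PPr_CP : srt (rcons ps p ++ rs) -> CP A ps (p :: rs) -> PPr A ps p rs.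
Proof.
move=> hs hC d d0; have dd0 : 0 < d ^+ 2 / 2 by rewrite divr_gt0// exprn_gt0.
have [c [M [K [c0 M0 hP]]]] := PETC hs dd0.
have [N N0 hN] : exists2 N, (0 < N)%N & forall k, (k <= K)%N ->
    forall m f0 fs ths F r, isDual ps p rs m f0 fs ths F -> (N %| r)%N ->
    ~ (forall Hs, size Hs = k.+1 -> mulw M Hs -> c <= QQ s Hs (WW ps r F)).
  apply: (@fin_dvd (fun k N => forall m f0 fs ths F r, isDual ps p rs m f0 fs ths F ->
    (N %| r)%N ->
    ~ (forall Hs, size Hs = k.+1 -> mulw M Hs -> c <= QQ s Hs (WW ps r F)))).
    by move=> k N1 N2 h12 h m f0 fs ths F r D hr; apply: (h m f0 fs ths F r D); exact: dvdn_trans hr.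
  by move=> k; exact: DL.
exists N => // m f0 f fs ths hm u0 uf ufs hu sfs sths hf.
rewrite leNgt; apply/negP => hd.
pose v n := U (- (s *~ p.[n%:Z])) (gseq ps rs f0 fs ths n).
have uv n : ub (v n) by apply: ub_U; exact: gseq_ub.
have [F' uF' hF'] := wmean hm uv.
pose F := cj F'; have uF : ub F by exact: ub_cj.
have D : isDual ps p rs m f0 fs ths F.
  split=> // a; rewrite /F cjK hF'; congr m; apply: funext => n.
  rewrite /v mulrC rho_UM opprK /gseq; congr (rho _); ring.
have hfF : d < rho (f * cj F) by rewrite (dualE D).
set W := WW ps N F; have [uP iP hPP] := PPP hm0 (s *+ N) uF.
have hfW : d / 2 < rho (f * cj W).
  rewrite /W /WW rmorphM cj_kk mulrCA rho_kk rmorphB mulrBr rhoB.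
  rewrite [f * cj (PP _ _)]mulrC hf; last exact: inv_cj.
  by rewrite subr0; lra.
have uW : ub W by exact: (WW_ub hm0).
have hWW : (d / 2) ^+ 2 <= rho (W * cj W).
  apply: (@le_trans _ _ (rho (f * cj W) ^+ 2)).
    by apply: lerXn2r; rewrite ?nnegrE; lra.
  by apply: (le_trans (rho_CS1 _ uf)); rewrite cjK mulrC.
have hWF : rho (W * cj W) = 2^-1 * rho (W * cj F).
  rewrite {2}/W /WW rmorphM cj_kk mulrCA rho_kk rmorphB mulrBr rhoB.
  by rewrite (WW_inv hm0 uF (inv_cj iP)) subr0.
have [k kK hk] : Concl s c M K W.
  apply: (hP m f0 W fs ths) => //; rewrite -(dualE D).
  have : (d / 2) ^+ 2 = d ^+ 2 / 4 by field.
  lra.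
exact: (hN k kK m f0 fs ths F N D (dvdnn N)).
Qed.

End Inverse.

(** * All families of strictly increasing degrees *)

Section AllC.
Variables (R : realType) (A : dsys R).
Variables (m0 : (nat -> R) -> R) (hm0 : is_mean m0).

Theorem CP_all ps rs : srt (ps ++ rs) -> CP A ps rs.
Proof.
elim: (size ps) {-2}ps (erefl (size ps)) rs => {ps} [|k IH] ps.
  by move=> /size0nil -> rs; exact: CP_nil.
case/lastP: ps => [//|ps p]; rewrite size_rcons => -[sp] rs hs.
have hs' : srt (ps ++ p :: rs) by rewrite -cat_rcons.
apply: (CP_rcons hm0) => //; first by apply: (PPr_CP hm0) => //; exact: IH.
move=> N i N0; apply: IH; first by rewrite size_map.
rewrite -map_cat srt_aff//; move: hs'; rewrite /srt !map_cat /= !cat_path /=.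
move=> /and3P[-> h1 h2] /=.
by case: [seq _ | _ <- rs] h2 => //= x l /andP[h ->]; rewrite (ltn_trans h1 h).
Qed.

Theorem PPr_all ps p : srt (rcons ps p) -> PPr A ps p [::].
Proof.
move=> hs; apply: (PPr_CP hm0) => //; first by rewrite cats0.
by apply: CP_all; rewrite cats1.
Qed.

End AllC.

(** * Replacing each factor by its projection *)

Section LowerBound.
Variables (R : realType) (A : dsys R).
Variables (m0 : (nat -> R) -> R) (hm0 : is_mean m0).
Implicit Types (g u : A) (m : (nat -> R) -> R).

Variable f : A.
Hypothesis uf : ub f.

Local Notation P i r := (PP ('X^i *+ r) f).

Lemma PP_dist i r r' : (r %| r')%N ->
  rho ((P i r' - P i r) * cj (P i r' - P i r)) = Psi ('X^i *+ r') f - Psi ('X^i *+ r) f.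
Proof.
move=> hr; have [u1 i1 h1] := PPP hm0 ('X^i *+ r) uf.
have [u2 i2 h2] := PPP hm0 ('X^i *+ r') uf.
have ic : inv ('X^i *+ r) (cj (P i r)) by exact: inv_cj.
have ic' : inv ('X^i *+ r') (cj (P i r)).
  by have /dvdnP[q ->] := hr; rewrite mulnC mulrnA; exact: inv_muln.
have e1 : rho (P i r' * cj (P i r)) = Psi ('X^i *+ r) f.
  by rewrite mulrC -h2// h1// mulrC.
have e2 : rho (P i r * cj (P i r')) = Psi ('X^i *+ r) f by rewrite rho_swap.
rewrite rmorphB; set a := P i r'; set b := P i r.
have -> : (a - b) * (cj a - cj b) = a * cj a - a * cj b - b * cj a + b * cj b by ring.
rewrite rhoD !rhoB /a /b e1 e2 /Psi; ring.
Qed.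

(** [Psi] increases along divisibility and its sum over [i < k] is at most [k], so increments above
    [e] can occur only finitely often along a divisibility chain. *)
Lemma good_r k e : 0 < e -> exists2 r, (0 < r)%N & forall i r', (i < k)%N -> (r %| r')%N ->
  (0 < r')%N -> Psi ('X^i *+ r') f <= Psi ('X^i *+ r) f + e.
Proof.
move=> e0; pose Phi r := \sum_(i < k) Psi ('X^i *+ r) f.
have mono i r r' : (r %| r')%N -> Psi ('X^i *+ r) f <= Psi ('X^i *+ r') f.
  by move=> h; rewrite -subr_ge0 -PP_dist//; exact: rho_ge0.
have bd r : Phi r <= k%:R.
  rewrite -[k in k%:R]card_ord -sumr_const; apply: ler_sum => i _.
  exact: (Psi_le1 hm0).
have [r r0 hr] : exists2 r, (0 < r)%N & forall r', (r %| r')%N -> (0 < r')%N ->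
    Phi r' <= Phi r + e.
  apply: contrapT => hn.
  have step r : (0 < r)%N -> exists r', (0 < r')%N /\ Phi r + e <= Phi r'.
    move=> r0; apply: contrapT => hn'; apply: hn; exists r => // r' h r'0.
    rewrite leNgt; apply/negP => /ltW hlt; apply: hn'; by exists r'.
  have it j : exists r, (0 < r)%N /\ j%:R * e <= Phi r.
    elim: j => [|j [r [r0 hr]]].
      exists 1%N; split=> //; rewrite mul0r; apply: sumr_ge0 => i _; exact: Psi_ge0.
    have [r' [r'0 hr']] := step r r0; exists r'; split=> //.
    by rewrite -natr1 mulrDl mul1r; apply: le_trans hr'; rewrite lerD2r.
  have [r [_ hr]] := it (Num.truncn (k%:R / e)).+1.
  have := le_trans hr (bd r); rewrite -ler_pdivlMr// leNgt.
  by rewrite truncnS_gt.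
exists r => // i r' ik hrr r'0; have := hr r' hrr r'0.
rewrite /Phi (bigD1 (Ordinal ik))//= [X in _ <= X + _](bigD1 (Ordinal ik))//= => h.
have : \sum_(j < k | j != Ordinal ik) Psi ('X^j *+ r) f <=
    \sum_(j < k | j != Ordinal ik) Psi ('X^j *+ r') f.
  by apply: ler_sum => j _; exact: mono.
by lra.
Qed.

Lemma VV_nseq i ps n : uba (nseq (size ps) f) /\ ub (VV i ps (nseq (size ps) f) n).
Proof.
have h : uba (nseq (size ps) f) by elim: (ps) => //= p l IH.
by split=> //; exact: VV_ub.
Qed.

(** Replacing the last [f] by its projection for [r' = r * N] costs [2 * d], the orthogonal part
    being halved to stay bounded; passing from [r'] to [r] costs [d] by the choice of [r]. As [p.[0]
    = 0], the exponent [p.[n * r]] is a multiple of [r], so the projection does not move and joins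
    [f0]. *)
Lemma peel r d ps m f0 : 0 < d -> (0 < r)%N -> is_mean m -> ub f0 ->
  (forall i r', (i < size ps)%N -> (r %| r')%N -> (0 < r')%N ->
    Psi ('X^i *+ r') f <= Psi ('X^i *+ r) f + d ^+ 2) ->
  srt ps -> (forall p, p \in ps -> p.[0] = 0) ->
  rho (f0 * \prod_(i < size ps) P i r) - (size ps)%:R * (3 * d) <=
  m (fun n => rho (f0 * VV 0 (map (aff r 0) ps) (nseq (size ps) f) n)).
Proof.
move=> d0 r0 hm; elim/last_ind: ps f0 => [|ps p IH] f0 u0 hr hs hz.
  rewrite big_ord0 mul0r subr0 /=.
  by rewrite (mean_cst hm) mulr1.
rewrite !size_rcons in hr *; set k := size ps in hr *.
have hs' : srt ps by move: hs; rewrite /srt map_rcons rcons_path => /andP[].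
have hsa : srt (rcons (map (aff r 0) ps) (aff r 0 p)) by rewrite -map_rcons srt_aff.
have [N N0 hN] := PPr_all A hm0 hsa d0.
pose r' := (r * N)%N; have r'0 : (0 < r')%N by rewrite muln_gt0 r0.
have szk : size (map (aff r 0) ps) = k by rewrite size_map.
have [uP iP hP] := PPP hm0 ('X^k *+ r) uf.
have [uP' iP' hP'] := PPP hm0 ('X^k *+ r') uf.
have IHk : rho (f0 * P k r * \prod_(i < k) P i r) - k%:R * (3 * d) <=
    m (fun n => rho (f0 * P k r * VV 0 (map (aff r 0) ps) (nseq k f) n)).
  apply: IH => //; first exact: ub_M.
    by move=> i q hi; apply: hr; exact: ltnW.
  by move=> q hq; apply: hz; rewrite mem_rcons inE hq orbT.
pose V n := f0 * VV 0 (map (aff r 0) ps) (nseq k f) n.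
have ufs : uba (nseq k f) by case: (VV_nseq 0 ps 0).
have uV n : ub (V n) by apply: ub_M => //; exact: VV_ub.
pose T n g := U ('X^k *~ (aff r 0 p).[n%:Z]) g.
pose X g n := rho (V n * T n g).
have bX g : ub g -> bseq (X g).
  by move=> ug; apply: bseq_rho => n; apply: ub_M => //; exact: ub_U.
have h01 : 0 <= (2^-1 : R) <= 1 by apply/andP; split; lra.
have ubh g g' : ub g -> ub g' -> ub (kk 2^-1 * (g - g')).
  move=> ug ug'; have := ub_conv h01 ug (ub_N ug').
  have -> : 1 - 2^-1 = 2^-1 :> R by field.
  by rewrite -mulrDr.
have e1 : m (X f) = m (X (P k r')) - 2 * m (X (kk 2^-1 * (P k r' - f))).
  rewrite -(meanZ hm); last by apply: bX; exact: ubh.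
  rewrite -(meanB hm); last 2 first.
  - exact: bX.
  - by apply: bseqZ; apply: bX; exact: ubh.
  congr m; apply: funext => n; rewrite /X /T rmorphM U_kk mulrCA rho_kk mulrA.
  rewrite divff ?mul1r ?pnatr_eq0// rmorphB mulrBr rhoB; ring.
have e2 : m (X (kk 2^-1 * (P k r' - f))) <= d.
  have ho y : inv ('X^(size (map (aff r 0) ps)) *+ N) y ->
      rho (y * (kk 2^-1 * (P k r' - f))) = 0.
    rewrite szk => hy; rewrite mulrCA rho_kk mulrBr rhoB -hP' ?subrr ?mulr0//.
    by rewrite /r' mulnC mulrnA; apply: inv_muln.
  have ufs' : size (nseq k f) = size (map (aff r 0) ps) by rewrite size_nseq szk.
  have := hN m f0 _ (nseq k f) [::] hm u0 (ubh _ _ uP' uf) ufs I ufs' erefl ho.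
  apply: le_trans; rewrite le_eqVlt; apply/orP; left; apply/eqP; congr m.
  by apply: funext => n; rewrite szk /X /T /V /= mulr1.
have e3 : m (X (P k r)) - d <= m (X (P k r')).
  rewrite -[d](mean_cst hm) -(meanB hm); [|exact: bX|exact: bseq_cst].
  apply: (mean_le hm); [by apply: bseqD; [exact: bX|exact: bseq_cst]|exact: bX|move=> n].
  rewrite lerBlDr -lerBlDl; rewrite /X -rhoB -mulrBr /T -rmorphB.
  have := rho_CS1 (U ('X^k *~ (aff r 0 p).[n%:Z]) (P k r - P k r')) (uV n).
  have hsym : (P k r - P k r') * cj (P k r - P k r') = (P k r' - P k r) * cj (P k r' - P k r).
    by rewrite !rmorphB; ring.
  rewrite -U_cj -rmorphM rho_U hsym PP_dist ?dvdn_mulr// => h.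
  have h2 : rho (V n * U ('X^k *~ (aff r 0 p).[n%:Z]) (P k r - P k r')) ^+ 2 <= d ^+ 2.
    by apply: le_trans h _; rewrite lerBlDl; apply: hr => //; exact: dvdn_mulr.
  rewrite leNgt; apply/negP => hlt; have : d ^+ 2 < d ^+ 2.
    by apply: lt_le_trans h2; rewrite ltrXn2r// ?ltW// nnegrE// ltW.
  by rewrite ltxx.
have e4 : m (X (P k r)) = m (fun n => rho (f0 * P k r * VV 0 (map (aff r 0) ps) (nseq k f) n)).
  congr m; apply: funext => n; rewrite /X /T.
  have -> : rho (V n * U ('X^k *~ (aff r 0 p).[n%:Z]) (P k r)) = rho (V n * P k r).
    have [w hw] := poly_dvd p r n 0; rewrite hz ?mem_rcons ?inE ?eqxx// add0r in hw.
    by rewrite affE hw mulrzA -pmulrn; apply: inv_mulz.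
  by congr (rho _); rewrite /V; ring.
have e5 : m (X f) = m (fun n => rho (f0 * VV 0 (map (aff r 0) (rcons ps p)) (nseq k.+1 f) n)).
  congr m; apply: funext => n; rewrite /X /V /T.
  have -> : nseq k.+1 f = rcons (nseq k f) f by elim: (k) => //= j <-.
  by rewrite map_rcons VV_rcons ?size_nseq ?szk// add0n mulrA.
rewrite -e5 big_ord_recr /= -/k -natr1.
have -> : f0 * (\prod_(i < k) P i r * P k r) = f0 * P k r * \prod_(i < k) P i r by ring.
rewrite e4 in e3; lra.
Qed.

End LowerBound.

Local Open Scope complex_scope.

(** * Bounded complex measurable functions *)

Section N2.
Variable R : realType.
Implicit Types z w : R[i].

(** The squared modulus as a real number; bounds on functions are stated with it. *)
Definition n2 z : R := complex.Re z ^+ 2 + complex.Im z ^+ 2.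

Lemma n2_ge0 z : 0 <= n2 z. Proof. by rewrite addr_ge0 ?sqr_ge0. Qed.
Lemma n2M z w : n2 (z * w) = n2 z * n2 w.
Proof. by case: z => a b; case: w => c d; rewrite /n2/=; ring. Qed.
Lemma n2X z n : n2 (z ^+ n) = n2 z ^+ n.
Proof.
elim: n => [|n IH]; first by rewrite !expr0 /n2/= expr0n addr0 expr1n.
by rewrite !exprS n2M IH.
Qed.
Lemma n2D z w : n2 (z + w) <= 2 * (n2 z + n2 w).
Proof.
case: z => a b; case: w => c d; rewrite /n2/=.
by have := sqr_ge0 (a - c); have := sqr_ge0 (b - d); nra.
Qed.
Lemma n2N z : n2 (- z) = n2 z.
Proof. by case: z => a b; rewrite /n2/= !sqrrN. Qed.
Lemma n2J z : n2 (conjc z) = n2 z.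
Proof. by case: z => a b; rewrite /n2/= sqrrN. Qed.
Lemma n2C (a : R) : n2 a%:C = a ^+ 2.
Proof. by rewrite /n2/= expr0n addr0. Qed.
Lemma n2_eq0 z : n2 z = 0 -> z = 0.
Proof.
case: z => a b; rewrite /n2/= => /eqP; rewrite paddr_eq0 ?sqr_ge0//.
by rewrite !sqrf_eq0 => /andP[/eqP-> /eqP->].
Qed.
Lemma Re_n2 z : `|complex.Re z| <= 1 + n2 z.
Proof.
case: z => a b; rewrite /n2/= ler_norml; have := sqr_ge0 b.
by have := sqr_ge0 (a - 1); have := sqr_ge0 (a + 1); nra.
Qed.
Lemma mulJ z : z * conjc z = (n2 z)%:C.
Proof. by case: z => a b; apply/eqP; rewrite eq_complex /n2/=; apply/andP; split; apply/eqP; ring. Qed.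
Lemma n2_conv t z w : 0 <= t <= 1 -> n2 z <= 1 -> n2 w <= 1 ->
  n2 (t%:C * z + (1 - t)%:C * w) <= 1.
Proof.
move=> /andP[t0 t1] z1 w1; have h : n2 (t%:C * z + (1 - t)%:C * w) =
   t * n2 z + (1 - t) * n2 w - t * (1 - t) * n2 (z - w).
  by move: z w {z1 w1} => [a b] [c d]; rewrite /n2/=; ring.
rewrite h; have := n2_ge0 (z - w).
have : 0 <= t * (1 - t) by rewrite mulr_ge0// subr_ge0.
move=> h1 h2; have : 0 <= t * (1 - t) * n2 (z - w) by rewrite mulr_ge0.
have : t * n2 z <= t by rewrite ler_piMr.
have : (1 - t) * n2 w <= 1 - t by rewrite ler_piMr// subr_ge0.
by lra.
Qed.
End N2.

Section BFun.
Context d (X : measurableType d) (R : realType).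
Implicit Types f g : X -> R[i].

Definition mbc f := [/\ measurable_fun setT (fun x => complex.Re (f x)),
  measurable_fun setT (fun x => complex.Im (f x)) &
  exists c, forall x, n2 (f x) <= c].

Definition mbc_pred : {pred X -> R[i]} := fun f => `[< mbc f >].

Lemma mbc_cst z : mbc (fun=> z).
Proof. by split; [exact: measurable_cst|exact: measurable_cst|exists (n2 z)]. Qed.

Lemma mbcB f g : mbc f -> mbc g -> mbc (f - g).
Proof.
move=> [mf mf' [c hc]] [mg mg' [e he]]; split.
- rewrite [X in measurable_fun _ X](_ : _ = (fun x => complex.Re (f x) - complex.Re (g x))).
    exact: measurable_funB.
  by apply: funext => x; rewrite !fctE raddfB.
- rewrite [X in measurable_fun _ X](_ : _ = (fun x => complex.Im (f x) - complex.Im (g x))).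
    exact: measurable_funB.
  by apply: funext => x; rewrite !fctE raddfB.
- exists (2 * (c + e)) => x; rewrite !fctE; apply: le_trans (n2D _ _) _.
  by rewrite n2N ler_wpM2l// lerD.
Qed.

Lemma mbcM f g : mbc f -> mbc g -> mbc (f * g).
Proof.
move=> [mf mf' [c hc]] [mg mg' [e he]]; split.
- rewrite [X in measurable_fun _ X](_ : _ = (fun x => complex.Re (f x) * complex.Re (g x)
     - complex.Im (f x) * complex.Im (g x))).
    by apply: measurable_funB; exact: measurable_funM.
  by apply: funext => x; rewrite fctE; case: (f x) (g x) => [? ?] [? ?].
- rewrite [X in measurable_fun _ X](_ : _ = (fun x => complex.Re (f x) * complex.Im (g x)
     + complex.Im (f x) * complex.Re (g x))).
    by apply: measurable_funD; exact: measurable_funM.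
  by apply: funext => x; rewrite fctE; case: (f x) (g x) => [? ?] [? ?].
- by exists (c * e) => x; rewrite fctE n2M ler_pM ?n2_ge0.
Qed.

Lemma mbcJ f : mbc f -> mbc (fun x => conjc (f x)).
Proof.
move=> [mf mf' [c hc]]; split; last by exists c => x; rewrite n2J.
- rewrite [X in measurable_fun _ X](_ : _ = (fun x => complex.Re (f x)))//.
  by apply: funext => x; case: (f x).
- rewrite [X in measurable_fun _ X](_ : _ = (fun x => - complex.Im (f x))).
    exact: measurableT_comp.
  by apply: funext => x; case: (f x).
Qed.

Lemma mbc_subring : subring_closed mbc_pred.
Proof.
split; first by apply/asboolP; exact: mbc_cst.
- by move=> f g /asboolP hf /asboolP hg; apply/asboolP; exact: mbcB.
- by move=> f g /asboolP hf /asboolP hg; apply/asboolP; exact: mbcM.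
Qed.


Record bfun := BFun { bf :> X -> R[i]; bfP : bf \in mbc_pred }.
HB.instance Definition _ := [isSub for bf].
HB.instance Definition _ := [Choice of bfun by <:].
HB.instance Definition _ :=
  GRing.SubChoice_isSubComPzRing.Build _ _ bfun mbc_subring.

Lemma bfE (f g : bfun) : (forall x, f x = g x) -> f = g.
Proof. by move=> h; apply: val_inj; apply: funext. Qed.

Lemma bf_mbc (f : bfun) : mbc f. Proof. exact/asboolP/bfP. Qed.

Definition mkb f (h : mbc f) : bfun := BFun (asboolT h).

Lemma bfD (f g : bfun) x : (f + g) x = f x + g x. Proof. by []. Qed.
Lemma bfN (f : bfun) x : (- f) x = - f x. Proof. by []. Qed.
Lemma bfM (f g : bfun) x : (f * g) x = f x * g x. Proof. by []. Qed.
Lemma bf1 x : (1 : bfun) x = 1. Proof. by []. Qed.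
End BFun.

(** * Integration of bounded real functions *)

Section Int.
Context d (X : measurableType d) (R : realType) (mu : probability X R).
Implicit Types h k : X -> R.

Definition mb h := measurable_fun setT h /\ exists c, forall x, `|h x| <= c.

Lemma mb_cst c : mb (fun=> c).
Proof. by split; [exact: measurable_cst|exists `|c|]. Qed.
Lemma mbD h k : mb h -> mb k -> mb (fun x => h x + k x).
Proof.
move=> [mh [c hc]] [mk [e he]]; split; first exact: measurable_funD.
by exists (c + e) => x; rewrite (le_trans (ler_normD _ _))// lerD.
Qed.
Lemma mbM h k : mb h -> mb k -> mb (fun x => h x * k x).
Proof.
move=> [mh [c hc]] [mk [e he]]; split; first exact: measurable_funM.
by exists (c * e) => x; rewrite normrM ler_pM.
Qed.
Lemma mbN h : mb h -> mb (fun x => - h x).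
Proof.
move=> [mh [c hc]]; split; first exact: measurable_funN.
by exists c => x; rewrite normrN.
Qed.
Lemma mbZ c h : mb h -> mb (fun x => c * h x).
Proof. by move=> ?; apply: mbM => //; exact: mb_cst. Qed.
Lemma mb_sum (I : Type) (r : seq I) (F : I -> X -> R) : (forall i, mb (F i)) ->
  mb (fun x => \sum_(i <- r) F i x).
Proof.
move=> hF; elim: r => [|i r IH].
  rewrite (_ : (fun _ => _) = (fun=> 0)); first exact: mb_cst.
  by apply: funext => x; rewrite big_nil.
rewrite (_ : (fun _ => _) = (fun x => F i x + \sum_(j <- r) F j x)); first exact: mbD.
by apply: funext => x; rewrite big_cons.
Qed.

Definition ind (B : set X) (x : X) : R := `[< B x >]%:R.

Lemma ind1 (B : set X) x : B x -> ind B x = 1.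
Proof. by move=> h; rewrite /ind asboolT. Qed.
Lemma ind0 (B : set X) x : ~ B x -> ind B x = 0.
Proof. by move=> h; rewrite /ind asboolF. Qed.
Lemma ind_indic (B : set X) : ind B = \1_B.
Proof. by apply: funext => x; rewrite indicE. Qed.
Lemma ind01 (B : set X) x : 0 <= ind B x <= 1.
Proof. by rewrite /ind; case: asboolP; rewrite /= ?lexx ler01. Qed.

Lemma mb_ind (B : set X) : measurable B -> mb (ind B).
Proof.
move=> mB; split; first by rewrite ind_indic; exact: measurable_indic.
by exists 1 => x; have /andP[h0 h1] := ind01 B x; rewrite ger0_norm.
Qed.

Lemma mb_int h : mb h -> mu.-integrable setT (EFin \o h).
Proof.
move=> [mh [c hc]]; apply: measurable_bounded_integrable => //.
  exact: (le_lt_trans (probability_le1 mu measurableT) (ltry 1)).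
by exists c; split; [exact: num_real|move=> M cM x _; exact: le_trans (hc x) (ltW cM)].
Qed.

Definition I h : R := \int[mu]_x h x.

Lemma I_cst c : I (fun=> c) = c.
Proof.
by rewrite /I Rintegral_cst//; have := @probability_setT _ _ _ mu; rewrite /= => ->; rewrite mulr1.
Qed.
Lemma ID h k : mb h -> mb k -> I (fun x => h x + k x) = I h + I k.
Proof. by move=> hh hk; apply: RintegralD => //; exact: mb_int. Qed.
Lemma IZ c h : mb h -> I (fun x => c * h x) = c * I h.
Proof. by move=> hh; apply: RintegralZl => //; exact: mb_int. Qed.
Lemma IN h : mb h -> I (fun x => - h x) = - I h.
Proof.
move=> hh; rewrite -mulN1r -IZ//; congr I.
by apply: funext => x; rewrite mulN1r.
Qed.
Lemma IB h k : mb h -> mb k -> I (fun x => h x - k x) = I h - I k.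
Proof. by move=> hh hk; rewrite ID ?IN//; exact: mbN. Qed.
Lemma I_le h k : mb h -> mb k -> (forall x, h x <= k x) -> I h <= I k.
Proof. by move=> hh hk hl; apply: le_Rintegral => //; exact: mb_int. Qed.
Lemma I_ge0 h : (forall x, 0 <= h x) -> 0 <= I h.
Proof. by move=> h0; apply: Rintegral_ge0. Qed.
Lemma I_ind (B : set X) : measurable B -> (I (ind B))%:E = mu B.
Proof.
move=> mB; rewrite /I /Rintegral ind_indic integral_indic// setIT fineK//.
exact: fin_num_measure.
Qed.

Lemma I_ae h k : mb h -> mb k -> (\forall x \ae mu, h x = k x) -> I h = I k.
Proof.
move=> [mh _] [mk _] hk; congr fine; apply: ae_eq_integral => //.
- exact/measurable_EFinP.
- exact/measurable_EFinP.
- by apply: filterS hk => x -> _.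
Qed.

Lemma I_aele h k : mb h -> mb k -> (\forall x \ae mu, h x <= k x) -> I h <= I k.
Proof.
move=> hh hk hl; have hm : mb (fun x => Num.min (h x) (k x)).
  case: hh hk => [mh [c hc]] [mk [e he]]; split; first exact: measurable_minr.
  by exists (Num.max c e) => x; have [_|_] := leP (h x) (k x); rewrite le_max ?hc ?he ?orbT.
rewrite (I_ae hh hm); last by apply: filterS hl => x /min_idPl.
by apply: I_le => // x; rewrite ge_min lexx orbT.
Qed.

Lemma I0_aei h : mu.-integrable setT (EFin \o h) -> (forall x, 0 <= h x) -> I h <= 0 ->
  \forall x \ae mu, h x = 0.
Proof.
move=> hi h0 hI; have e0 : I h = 0 by apply/eqP; rewrite eq_le hI I_ge0.
have e1 : (\int[mu]_x `|(h x)%:E| = 0)%E.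
  have : (\int[mu]_x (h x)%:E)%E = 0%E.
    have hf := integrable_fin_num measurableT hi.
    by rewrite -(fineK hf); congr (_%:E); exact: e0.
  by move=> <-; apply: eq_integral => x _; rewrite gee0_abs// lee_fin.
have m1 : measurable_fun setT (fun x => (h x)%:E) by exact: measurable_int hi.
have := (ae_eq_integral_abs mu measurableT m1).1 e1.
by apply: filterS => x /(_ Logic.I)[].
Qed.

Lemma I0_ae h : mb h -> (forall x, 0 <= h x) -> I h <= 0 -> \forall x \ae mu, h x = 0.
Proof. by move=> hh; apply: I0_aei; exact: mb_int. Qed.

Lemma ae_ge0 h : mb h -> (0 <= I (fun x => ind [set y | h y < 0] x * h x)) ->
  \forall x \ae mu, 0 <= h x.
Proof.
move=> hh hI; have mB : measurable [set y | h y < 0].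
  rewrite [X in measurable X](_ : _ = setT `&` h @^-1` `]-oo, 0[%classic).
    by case: hh => mh _; apply: mh.
  by rewrite setTI; apply/seteqP; split => x; rewrite /= in_itv.
have mi : mb (fun x => ind [set y | h y < 0] x * h x) by apply: mbM => //; exact: mb_ind.
have : \forall x \ae mu, - (ind [set y | h y < 0] x * h x) = 0.
  apply: I0_ae; first exact: mbN.
    move=> x; rewrite oppr_ge0 /ind; case: asboolP => /= h1; rewrite ?mul0r// mul1r.
    exact: ltW.
  by rewrite IN// oppr_le0.
apply: filterS => x /eqP; rewrite oppr_eq0 leNgt /ind.
case: asboolP => /= [h1|h1]; last by move=> _; apply/negP.
by rewrite mul1r => /eqP h2; rewrite h2 ltxx.
Qed.

Lemma I_map (al : X -> X) h : measurable_fun setT al ->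
  (forall B, measurable B -> mu (al @^-1` B) = mu B) -> mb h -> I (h \o al) = I h.
Proof.
move=> mal hal hh; have hc : mb (h \o al).
  by case: hh => mh [c hc]; split; [exact: measurableT_comp|exists c => x /=; exact: hc].
congr fine; have mh : measurable_fun setT (EFin \o h).
  by apply/measurable_EFinP; case: hh.
have hi : mu.-integrable (al @^-1` setT) ((EFin \o h) \o al) by rewrite preimage_setT; exact: mb_int.
have e := integral_pushforward mal mh hi measurableT; rewrite preimage_setT in e.
by rewrite -[LHS]e; apply: eq_measure_integral => B mB _; exact: hal.
Qed.

End Int.

(** * Roots of unity and Fejer sums *)

Section Circle.
Variable R : realType.
Implicit Types (s t : R).

Definition ee t : R[i] := cos t +i* sin t.

Lemma eeD s t : ee (s + t) = ee s * ee t.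
Proof.
by apply/eqP; rewrite eq_complex /ee /= cosD sinD; apply/andP; split; apply/eqP; ring.
Qed.
Lemma ee0 : ee 0 = 1. Proof. by rewrite /ee cos0 sin0. Qed.
Lemma eeJ t : ee t * conjc (ee t) = 1.
Proof. by rewrite mulJ /n2 /= cos2Dsin2. Qed.
Lemma conjcM (z w : R[i]) : conjc (z * w) = conjc z * conjc w.
Proof. exact: (rmorphM (@conjc R)). Qed.
Lemma conjcX (z : R[i]) n : conjc (z ^+ n) = conjc z ^+ n.
Proof. exact: (rmorphXn (@conjc R)). Qed.

Lemma eeX t n : ee t ^+ n = ee (n%:R * t).
Proof.
elim: n => [|n IH]; first by rewrite expr0 mul0r ee0.
by rewrite exprS IH -eeD -natr1 mulrDl mul1r addrC.
Qed.
Lemma ee_neq1 t : 0 < t -> t < 2 * pi -> ee t != 1.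
Proof.
move=> t0 tp; apply/eqP => -[ct _].
have s0 : 0 < sin (t / 2) by apply: sin_gt0_pi; apply/andP; split; lra.
have : cos t = 1 - 2 * sin (t / 2) ^+ 2.
  have -> : cos t = cos (t / 2 + t / 2) by congr cos; field.
  by rewrite cosD -!expr2; have := cos2Dsin2 (t / 2); lra.
rewrite ct; have : 0 < sin (t / 2) ^+ 2 by rewrite exprn_gt0.
by lra.
Qed.

Lemma root_orth n p q : (0 < n)%N -> (p < n)%N -> (q < n)%N ->
  \sum_(j < n) (ee (2 * pi / n%:R) ^+ j) ^+ p * conjc ((ee (2 * pi / n%:R) ^+ j) ^+ q) =
  (if p == q then n%:R else 0).
Proof.
move=> n0; have nR : (0 : R) < n%:R by rewrite ltr0n.
set z := ee _.
have E j : (z ^+ j) ^+ p * conjc ((z ^+ j) ^+ q) = (z ^+ p * conjc (z ^+ q)) ^+ j.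
  by rewrite exprMn -!rmorphXn /= -!exprM ![(j * _)%N]mulnC.
under eq_bigr do rewrite E.
have zn : z ^+ n = 1.
  rewrite /z eeX (_ : n%:R * _ = pi + pi); last by field; exact: lt0r_neq0.
  by rewrite eeD /ee cospi sinpi; apply/eqP; rewrite eq_complex/=; apply/andP; split; apply/eqP; ring.
have z1 : z * conjc z = 1 by exact: eeJ.
have zd a : (0 < a)%N -> (a < n)%N -> z ^+ a != 1.
  move=> a0 an; rewrite /z eeX; apply: ee_neq1.
    by rewrite mulr_gt0 ?ltr0n// divr_gt0// mulr_gt0// pi_gt0.
  rewrite mulrC mulrAC ltr_pdivrMr// ltr_pM2l ?ltr_nat//.
  by rewrite mulr_gt0// pi_gt0.
move=> pn qn; case: eqP => [->|/eqP pq].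
  under eq_bigr do rewrite rmorphXn/= -exprMn z1 !expr1n.
  by rewrite sumr_const card_ord.
set x := _ * _; have xn : x ^+ n = 1.
  by rewrite /x exprMn -!rmorphXn/= -!exprM ![(_ * n)%N]mulnC !exprM zn !expr1n mul1r rmorph1.
have x1 : x != 1.
  rewrite /x; have [lt|gt|/eqP] := ltngtP p q; last by rewrite (negbTE pq).
  - have -> : z ^+ p * conjc (z ^+ q) = conjc (z ^+ (q - p)).
      rewrite -[in LHS](subnK (ltnW lt)) exprD rmorphM/= mulrCA.
      by rewrite !rmorphXn/= -exprMn z1 expr1n mulr1.
    apply/eqP => h; have := zd (q - p)%N; rewrite subn_gt0 lt.
    rewrite (leq_ltn_trans (leq_subr _ _))// => /(_ isT isT)/eqP; apply.
    by rewrite -[LHS]conjcK h conjc1.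
  - have -> : z ^+ p * conjc (z ^+ q) = z ^+ (p - q).
      rewrite -[in LHS](subnK (ltnW gt)) exprD -mulrA.
      by rewrite !rmorphXn/= -exprMn z1 expr1n mulr1.
    apply: zd; rewrite ?subn_gt0//; exact: (leq_ltn_trans (leq_subr _ _)).
have := subrX1 x n; rewrite xn subrr => /esym/eqP.
by rewrite mulf_eq0 subr_eq0 (negbTE x1)/= => /eqP.
Qed.

End Circle.

Section Fejer.
Variable R : realType.
Implicit Types (c : nat -> nat -> R[i]).

(** For a Toeplitz array this is, up to the factor [1 / M], a Fejer mean of the trigonometric series
    with the entries as coefficients. *)
Definition wf c M t : R := avg M (fun a => avg M (fun b =>
  complex.Re (conjc (ee t) ^+ a * ee t ^+ b * c a b))).
Definition PsiC c H : R := avg H (fun a => avg H (fun b => n2 (c a b))).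
(** The grid has [4 H] points so that sums of two indices below [2 H] stay distinct modulo the
    number of points. *)
Definition grid (H j : nat) : R := j%:R * (2 * pi / (H + H + (H + H))%:R).

Variable c : nat -> nat -> R[i].
Hypothesis ct : forall a b, c a.+1 b.+1 = c a b.
Hypothesis ch : forall a b, conjc (c a b) = c b a.
Hypothesis cb : forall a b, n2 (c a b) <= 1.

Lemma toepD k a b : c (a + k)%N (b + k)%N = c a b.
Proof. by elim: k => [|k IH]; rewrite ?addn0// !addnS ct. Qed.

Lemma toepE a b a' b' : (b + a' = a + b')%N -> c a b = c a' b'.
Proof.
move=> h; have [le|lt] := leqP a a'.
  have -> : a' = (a + (a' - a))%N by lia.
  by have -> : b' = (b + (a' - a))%N; [lia|rewrite toepD].
have -> : a = (a' + (a - a'))%N by lia.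
have -> : b = (b' + (a - a'))%N by lia.
exact: toepD.
Qed.

Lemma sum_half H (F : nat -> R) : (forall i, 0 <= F i) ->
  \sum_(i < H) F i <= \sum_(i < H + H) F i.
Proof. by move=> h; rewrite big_split_ord/= lerDl sumr_ge0. Qed.

(** The pairs [(a + k, b + k)] with [k < H] all qualify. *)
Lemma count_diff H a b : (a < H)%N -> (b < H)%N ->
  H%:R <= \sum_(q : 'I_(H + H) * 'I_(H + H)) (b + q.1 == a + q.2)%N%:R :> R.
Proof.
move=> aH bH; rewrite -natr_sum ler_nat -big_mkcond sum1_card.
have h1 (k : 'I_H) : (a + k < H + H)%N by case: k => k /= kH; lia.
have h2 (k : 'I_H) : (b + k < H + H)%N by case: k => k /= kH; lia.
pose h (k : 'I_H) := (Ordinal (h1 k), Ordinal (h2 k)).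
have hi : injective h by move=> k k' [] /addnI /val_inj.
rewrite -[X in (X <= _)%N]card_ord -(card_imset _ hi); apply: subset_leq_card.
by apply/fintype.subsetP => q /imsetP[k _ ->]; rewrite unfold_in /= addnCA; exact: eqxx.
Qed.

(** Put [N = 2 H], [n = 4 H]. On the grid, orthogonality bounds the sum of the unnormalised values
    [V j] by [n N], and that of their squares from below by [n H^3 PsiC]. If all values of [wf],
    nonnegative by assumption, were at most [PsiC / 16], the sum of squares would be at most half of
    that. *)
Lemma fejer_peak H : (0 < H)%N -> 0 < PsiC c H ->
  (forall j, (j < H + H + (H + H))%N -> 0 <= wf c (H + H) (grid H j)) ->
  exists2 j, (j < H + H + (H + H))%N & PsiC c H / 16 <= wf c (H + H) (grid H j).
Proof.
move=> H0 P0 w0; set n := (H + H + (H + H))%N in w0 *; pose N := (H + H)%N.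
have n0 : (0 < n)%N by rewrite /n; lia.
apply: contrapT => hn.
have hlt j : (j < n)%N -> wf c N (grid H j) <= PsiC c H / 16.
  by move=> jn; rewrite leNgt; apply/negP => /ltW h; apply: hn; exists j.
pose z := ee (2 * pi / n%:R : R).
have zE j : z ^+ j = ee (grid H j) by rewrite /z eeX.
pose V j : R[i] := \sum_(p : 'I_N * 'I_N) conjc (z ^+ j) ^+ p.1 * (z ^+ j) ^+ p.2 * c p.1 p.2.
have wV j : wf c N (grid H j) = complex.Re (V j) / N%:R ^+ 2.
  rewrite /wf /avg -mulr_sumr mulrA -invfM -expr2 mulrC; congr (_ / _).
  rewrite /V raddf_sum/= pair_bigA/=; apply: eq_bigr => p _.
  by rewrite zE.
have VI j : complex.Im (V j) = 0.
  have : conjc (V j) = V j.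
    have sw : injective (fun p : 'I_N * 'I_N => (p.2, p.1)) by move=> [a b] [a' b'] [-> ->].
    rewrite /V; move: (z ^+ j) => y; rewrite rmorph_sum/= (reindex_inj sw)/=.
    by apply: eq_bigr => -[a b] _ /=; rewrite !conjcM !conjcX conjcK ch; ring.
  case: (V j) => x y [] /= h; lra.
have VV j : complex.Re (V j) ^+ 2 = n2 (V j).
  by rewrite /n2 VI expr0n addr0.
have N0 : (0 : R) < N%:R by rewrite ltr0n /N; lia.
have H0' : (0 : R) < H%:R by rewrite ltr0n.
have orth p q : (p < n)%N -> (q < n)%N -> \sum_(j < n) (z ^+ j) ^+ p * conjc ((z ^+ j) ^+ q) =
  (if p == q then n%:R else 0) by exact: root_orth.
have S1 : \sum_(j < n) complex.Re (V j) <= n%:R * N%:R.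
  rewrite -raddf_sum exchange_big/=.
  rewrite (_ : \sum_p _ = \sum_(p : 'I_N * 'I_N) c p.1 p.2 *
      (if p.2 == p.1 :> nat then n%:R else 0)); last first.
    apply: eq_bigr => -[[a aN] [b bN]] _ /=; rewrite -orth ?mulr_sumr; last 2 first.
    - by rewrite /n -/N; lia.
    - by rewrite /n -/N; lia.
    by apply: eq_bigr => j _; move: (z ^+ j) => y; rewrite conjcX; ring.
  rewrite raddf_sum/= -(pair_bigA _ (fun a b : 'I_N =>
    complex.Re (c a b * (if b == a :> nat then n%:R else 0))))/=.
  rewrite -[X in _ <= _ * X%:R]card_ord -sumr_const mulr_sumr.
  apply: ler_sum => a _; rewrite (bigD1 a)//= eqxx big1 => [|b /negbTE ba].
    rewrite addr0 mulr1 -[n%:R in leLHS]/((n%:R : R[i])).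
    have -> : complex.Re (c a a * n%:R) = complex.Re (c a a) * n%:R.
      by rewrite -[n%:R in LHS](rmorph_nat (real_complex R)); case: (c a a) => x y /=; ring.
    rewrite ler_piMl//; apply: le_trans (ler_norm _) _.
    rewrite -(@ler_pXn2r _ 2)// ?nnegrE// expr1n real_normK ?num_real//.
    by apply: le_trans (cb a a); rewrite /n2 lerDl sqr_ge0.
  by case: eqP => [/val_inj/eqP|_]; rewrite ?ba ?mulr0.
have S2 : n%:R * (H%:R ^+ 3 * PsiC c H) <= \sum_(j < n) complex.Re (V j) ^+ 2.
  have e1 : \sum_(j < n) complex.Re (V j) ^+ 2 =
      \sum_(p : 'I_N * 'I_N) \sum_(q : 'I_N * 'I_N)
        n2 (c p.1 p.2) * (n%:R * (p.2 + q.1 == p.1 + q.2)%N%:R).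
    apply: complexI; rewrite rmorph_sum/=.
    under eq_bigr => j _.
      rewrite VV -mulJ {1}/V mulr_suml.
      under eq_bigr => p _ do rewrite /V rmorph_sum/= mulr_sumr.
      over.
    rewrite exchange_big/= rmorph_sum/=; apply: eq_bigr => p _.
    rewrite exchange_big/= rmorph_sum/=; apply: eq_bigr => q _.
    transitivity (c p.1 p.2 * conjc (c q.1 q.2) *
        \sum_(j < n) (z ^+ j) ^+ (p.2 + q.1) * conjc ((z ^+ j) ^+ (p.1 + q.2))).
      rewrite mulr_sumr; apply: eq_bigr => j _; move: (z ^+ j) => y.
      have -> : conjc (conjc y ^+ q.1 * y ^+ q.2 * c q.1 q.2) =
          y ^+ q.1 * conjc y ^+ q.2 * conjc (c q.1 q.2).
        by rewrite !conjcM !conjcX conjcK.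
      by rewrite conjcX !exprD; ring.
    have pn (i j : 'I_N) : (i + j < n)%N by case: i j => i iN [j jN]; rewrite /n -/N /=; lia.
    rewrite orth//; case: eqP => [e|_]; last by rewrite !mulr0.
    by rewrite -(toepE e) mulJ mulr1 rmorphM/= rmorph_nat.
  rewrite e1; pose G a b := \sum_(q : 'I_N * 'I_N) n2 (c a b) * (n%:R * (b + q.1 == a + q.2)%N%:R).
  have G0 a b : 0 <= G a b.
    by apply: sumr_ge0 => q _; rewrite !mulr_ge0 ?n2_ge0.
  have h1 : \sum_(a < H) \sum_(b < H) n2 (c a b) * (n%:R * H%:R) <=
     \sum_(a < N) \sum_(b < N) G a b.
    apply: (@le_trans _ _ (\sum_(a < H) \sum_(b < N) G a b)); last first.
      by apply: (sum_half H (F := fun a => \sum_(b < N) G a b)) => a; exact: sumr_ge0.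
    apply: ler_sum => a _; apply: le_trans (sum_half H (G0 a)).
    apply: ler_sum => b _; rewrite /G -mulr_sumr ler_wpM2l ?n2_ge0//.
    by rewrite -mulr_sumr ler_wpM2l//; exact: count_diff.
  rewrite -(pair_bigA _ (fun a b : 'I_N => G a b)); apply: le_trans h1.
  under eq_bigr do rewrite -mulr_suml.
  rewrite -mulr_suml /PsiC /avg -mulr_sumr le_eqVlt; apply/orP; left; apply/eqP.
  by field; exact: lt0r_neq0.
have hj (j : 'I_n) : complex.Re (V j) ^+ 2 <= N%:R ^+ 2 * (PsiC c H / 16) * complex.Re (V j).
  have := hlt j (ltn_ord j); have := w0 j (ltn_ord j); rewrite wV.
  rewrite pmulr_lge0 ?invr_gt0 ?exprn_gt0// ler_pdivrMr ?exprn_gt0// => h1 h2.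
  by rewrite expr2 ler_wpM2r// [leRHS]mulrC.
have S3 : \sum_(j < n) complex.Re (V j) ^+ 2 <= N%:R ^+ 2 * (PsiC c H / 16) * (n%:R * N%:R).
  apply: (le_trans (ler_sum _ (fun j _ => hj j))); rewrite -mulr_sumr ler_wpM2l//.
  by rewrite mulr_ge0 ?sqr_ge0// divr_ge0// ltW.
have := le_trans S2 S3; have -> : N%:R = 2 * H%:R :> R by rewrite /N natrD; ring.
have -> : (2 * H%:R) ^+ 2 * (PsiC c H / 16) * (n%:R * (2 * H%:R)) =
  n%:R * (H%:R ^+ 3 * PsiC c H) / 2 by field.
have : 0 < n%:R * (H%:R ^+ 3 * PsiC c H) by rewrite mulr_gt0 ?ltr0n// mulr_gt0// exprn_gt0.
lra.
Qed.
End Fejer.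

Lemma limn_sup_cluster (R : realType) (u : nat -> R) dl T : has_ubound (range u) ->
  has_lbound (range u) -> 0 < dl -> exists2 n, (T <= n)%N & `|u n - limn_sup u| < dl.
Proof.
move=> hu hl d0; have hs := cvg_sups_inf hu hl.
have -> : limn_sup u = inf (range (sups u)) by exact/cvg_lim.
set th := inf _; have ls : has_lbound (range (sups u)).
  have [M hM] := hl; exists M => _ [m _ <-].
  apply: (@le_trans _ _ (u m)); first by apply: hM; exists m.
  by apply: ub_le_sup; [exact/has_ubound_sdrop|exists m => /=].
have hi : has_inf (range (sups u)) by split => //; exists (sups u 0%N), 0%N.
have [_ [T0 _ <-] hT0] := inf_adherent d0 hi.
have h1 : sups u (maxn T T0) < th + dl.
  by apply: le_lt_trans hT0; apply: nonincreasing_sups => //; exact: leq_maxr.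
have h2 : th - dl < sups u (maxn T T0).
  by apply: (@lt_le_trans _ _ th); [lra|apply: ge_inf => //; exists (maxn T T0)].
have [_ [n /= hn <-] hlt] := sup_gt (ex_intro _ _ (ex_intro2 _ _ (maxn T T0) (leqnn _) erefl)) h2.
exists n; first by apply: leq_trans hn; exact: leq_maxl.
rewrite ltr_distl hlt/=; apply: le_lt_trans h1.
by apply: ub_le_sup; [exact/has_ubound_sdrop|exists n].
Qed.

(** * Selecting a frequency *)

Section Freq.
Variable R : realType.
Implicit Types (c : nat -> nat -> R[i]).

Lemma grid_ge0 H j : 0 <= grid R H j.
Proof. by rewrite mulr_ge0// divr_ge0// mulr_ge0// pi_ge0. Qed.

Lemma grid_le H j : (j < H + H + (H + H))%N -> grid R H j <= 2 * pi.
Proof.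
move=> jn; rewrite /grid mulrC mulrAC ler_pdivrMr; last by rewrite ltr0n (leq_ltn_trans _ jn).
by rewrite ler_wpM2l ?mulr_ge0 ?pi_ge0// ler_nat ltnW.
Qed.

(* The largest grid frequency at which the Fejer sum reaches [tau], and [-1] if there is none. *)
Definition thc (tau : R) c H : R := \big[Num.max/-1]_(j < H + H + (H + H))
  (if tau <= wf c (H + H) (grid R H j) then grid R H j else -1).

Lemma thc_bd tau c H : -1 <= thc tau c H <= 2 * pi.
Proof.
have p0 := pi_ge0 R; rewrite /thc; elim/big_rec: _ => [|j x _ /andP[h1 h2]].
  by rewrite lexx/=; lra.
rewrite le_max h1 orbT/= ge_max h2 andbT; case: ifP => _; first exact: grid_le.
by lra.
Qed.

Lemma bigmax_if n (b : pred nat) (g : nat -> R) (m := \big[Num.max/-1]_(j < n)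
    (if b j then g j else -1)) :
  (-1 < m -> exists2 j, (j < n)%N & m = g j /\ b j) /\
  (forall j, (j < n)%N -> b j -> g j <= m).
Proof.
rewrite /m => {m}; elim: n b g => [|n IH] b g; first by rewrite big_ord0 ltxx.
rewrite big_ord_recl /=; have [IH1 IH2] := IH (b \o succn) (g \o succn).
set y := \big[_/_]_(_ < _) _.
have ye : y = \big[Num.max/-1]_(j < n) (if (b \o succn) j then (g \o succn) j else -1) by [].
rewrite -ye in IH1 IH2; move: y IH1 IH2 {ye} => y IH1 IH2; split; last first.
  move=> [_ b0|j jn bj]; first by rewrite b0 le_max lexx.
  by rewrite le_max (IH2 j)// orbT.
have h1 : -1 < y -> exists2 j, (j < n.+1)%N & y = g j /\ b j.
  by move=> /IH1[j jn hj]; exists j.+1.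
case b0: (b 0%N).
  by have [yg|gy] := leP (g 0%N) y; [|exists 0%N].
by have [yg|gy] := leP (-1) y; [|rewrite ltxx].
Qed.

Lemma thc_grid tau c H : -1 < thc tau c H ->
  exists2 j, (j < H + H + (H + H))%N & thc tau c H = grid R H j /\
    tau <= wf c (H + H) (grid R H j).
Proof. exact: (bigmax_if _ (fun j => tau <= wf c (H + H) (grid R H j)) (grid R H)).1. Qed.

Lemma thc_peak tau c H j : (j < H + H + (H + H))%N ->
  tau <= wf c (H + H) (grid R H j) -> 0 <= thc tau c H.
Proof.
move=> jn ht; apply: (le_trans (grid_ge0 H j)).
exact: ((bigmax_if _ (fun j => tau <= wf c (H + H) (grid R H j)) (grid R H)).2 j jn ht).
Qed.

Lemma wf_cont c M : continuous (wf c M).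
Proof.
have h : wf c M = (fun t => M%:R^-1 * \sum_(a < M) (M%:R^-1 * \sum_(b < M)
  (cos (b%:R * t - a%:R * t) * complex.Re (c a b) -
   sin (b%:R * t - a%:R * t) * complex.Im (c a b)))).
  apply: funext => t; rewrite /wf /avg; congr (_ * _); apply: eq_bigr => a _.
  congr (_ * _); apply: eq_bigr => b _.
  rewrite -conjcX !eeX /ee cosB sinB; case: (c a b) => x y /=; ring.
have cC (k : R) (F : R -> R) : continuous F -> continuous (fun t => k * F t).
  by move=> cF t; apply: cvgMr; exact: cF.
have cS K (F : nat -> R -> R) : (forall i, continuous (F i)) ->
    continuous (fun t => \sum_(i < K) F i t).
  move=> cF; elim: K => [|K IH].
    rewrite (_ : (fun _ => _) = (fun=> 0)); first exact: cst_continuous.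
    by apply: funext => t; rewrite big_ord0.
  rewrite (_ : (fun _ => _) = (fun t => \sum_(i < K) F i t + F K t)).
    by move=> t; apply: cvgD; [exact: IH|exact: cF].
  by apply: funext => t; rewrite big_ord_recr.
pose f a b t := cos (b%:R * t - a%:R * t) * complex.Re (c a b) -
   sin (b%:R * t - a%:R * t) * complex.Im (c a b).
rewrite h; apply: (cC _ (fun t => \sum_(a < M) (M%:R^-1 * \sum_(b < M) f a b t))).
apply: (cS M (fun a t => M%:R^-1 * \sum_(b < M) f a b t)) => a.
apply: (cC _ (fun t => \sum_(b < M) f a b t)); apply: (cS M (f a)) => b.
have cl : continuous (fun t : R => b%:R * t - a%:R * t).
  by move=> t; apply: cvgB; apply: cvgMr.
move=> t; apply: cvgB; apply: cvgMl.
  exact: (continuous_comp (cl t) (@continuous_cos R _)).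
exact: (continuous_comp (cl t) (@continuous_sin R _)).
Qed.

Variable (Hs : nat -> nat) (tau : R).

(** Any cluster value of the grid frequencies would have large Fejer sums; the upper limit is the
    one that depends measurably on the data. *)
Definition theta c : R := limn_sup (fun n => thc tau c (Hs n)).

Lemma thc_ub c : has_ubound (range (fun n => thc tau c (Hs n))).
Proof. by exists (2 * pi) => _ [n _ <-]; case/andP: (thc_bd tau c (Hs n)). Qed.
Lemma thc_lb c : has_lbound (range (fun n => thc tau c (Hs n))).
Proof. by exists (-1) => _ [n _ <-]; case/andP: (thc_bd tau c (Hs n)). Qed.

(** Frequencies [thc] arbitrarily close to [theta] have Fejer sum at least [tau] over a window that
    is a multiple of [M]. By monotonicity the same holds for the sum of length [M], and continuity
    passes to the limit. *)
Lemma theta_freq c M : (0 < M)%N ->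
  (forall H j N, (0 < N)%N -> wf c (N * M)%N (grid R H j) <= wf c M (grid R H j)) ->
  (forall T, exists2 n, (T <= n)%N & 0 <= thc tau c (Hs n)) ->
  (forall n, (0 < Hs n)%N) -> (forall n, (M <= n)%N -> (M %| Hs n)%N) ->
  tau <= wf c M (theta c).
Proof.
move=> M0 hmono hio Hs0 hdiv; rewrite leNgt; apply/negP => hlt.
have th0 : 0 <= theta c.
  rewrite leNgt; apply/negP => hneg.
  have d0 : 0 < - theta c by rewrite oppr_gt0.
  pose u n := thc tau c (Hs n).
  have hc := cvg_sups_inf (thc_ub c) (thc_lb c).
  have : 0 <= limn (sups u); last by rewrite leNgt -/(limn_sup u) hneg.
  apply: limr_ge; first by apply/cvg_ex; eexists; exact: hc.
  apply: nearW => T; have [n hn h0] := hio T; apply: (le_trans h0).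
  by apply: ub_le_sup; [exact/has_ubound_sdrop/thc_ub|exists n].
have /cvgr_lt/(_ _ hlt) := @wf_cont c M (theta c).
move=> /nbhs_ballP[e /= e0 he].
(* Since [theta c >= 0], a distance below [1] excludes the default value [-1] of [thc]. *)
have d0 : 0 < Num.min e 1 by rewrite lt_min e0 ltr01.
have [n hn] := limn_sup_cluster M (thc_ub c) (thc_lb c) d0.
rewrite -/(theta c) lt_min => /andP[h1 h2].
have [|j jn [e1 e2]] := @thc_grid tau c (Hs n).
  by move: h2; rewrite ltr_distl => /andP[h2 _]; lra.
have /= := he (thc tau c (Hs n)).
rewrite /ball/= distrC => /(_ h1); apply/negP; rewrite -leNgt e1.
apply: (le_trans e2); have /dvdnP[q hq] := hdiv n hn.
have q0 : (0 < q)%N by move: (Hs0 n); rewrite hq muln_gt0 => /andP[].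
have -> : (Hs n + Hs n = (q + q) * M)%N by rewrite hq; lia.
by apply: hmono; rewrite addn_gt0 q0.
Qed.
End Freq.

(** * Structure maps of the system of a measure preserving action *)

Section Instance.
Context d (X : measurableType d) (R : realType) (mu : probability X R).
Variable al : {poly int} -> X -> X.
Hypothesis mal : forall g, measurable_fun setT (al g).
Hypothesis pal : forall g B, measurable B -> mu (al g @^-1` B) = mu B.
Hypothesis al0 : forall x, al 0 x = x.
Hypothesis alD : forall g h x, al g (al h x) = al (g + h) x.
Local Notation S := (bfun X R).
Implicit Types (f g u v : S) (h : {poly int}).

Definition bcj f : S := mkb (mbcJ (bf_mbc f)).
Lemma bcj_zmod : zmod_morphism bcj.
Proof. by move=> f g; apply: bfE => x; exact: (raddfB (@conjc R)). Qed.
Lemma bcj_monoid : monoid_morphism bcj.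
Proof.
split; first by apply: bfE => x; exact: conjc1.
by move=> f g; apply: bfE => x; exact: conjcM.
Qed.
HB.instance Definition _ := GRing.isZmodMorphism.Build S S bcj bcj_zmod.
HB.instance Definition _ := GRing.isMonoidMorphism.Build S S bcj bcj_monoid.

Definition bkk (r : R) : S := mkb (mbc_cst X (r%:C)).
Lemma bkk_zmod : zmod_morphism bkk.
Proof. by move=> r s; apply: bfE => x; exact: rmorphB. Qed.
Lemma bkk_monoid : monoid_morphism bkk.
Proof. by split; [apply: bfE => x|move=> r s; apply: bfE => x; exact: rmorphM]. Qed.
HB.instance Definition _ := GRing.isZmodMorphism.Build R S bkk bkk_zmod.
HB.instance Definition _ := GRing.isMonoidMorphism.Build R S bkk bkk_monoid.

Lemma mb_re f : mb (fun x => complex.Re (f x)).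
Proof.
have [mf _ [c hc]] := bf_mbc f; split => //; exists (1 + c) => x.
by apply: le_trans (Re_n2 _) _; rewrite lerD2l.
Qed.

Definition brho f : R := I mu (fun x => complex.Re (f x)).
Lemma brho_zmod : zmod_morphism brho.
Proof.
move=> f g; rewrite /brho -IB; [|exact: mb_re|exact: mb_re].
by congr (I mu _); apply: funext => x; exact: raddfB.
Qed.
HB.instance Definition _ := GRing.isZmodMorphism.Build S R brho brho_zmod.

Lemma mbcU h f : mbc (f \o al h).
Proof.
have [mf mf' [c hc]] := bf_mbc f; split; last by exists c => x; exact: hc.
  exact: (measurableT_comp mf (mal h)).
exact: (measurableT_comp mf' (mal h)).
Qed.
Definition bU h f : S := mkb (mbcU h f).
Lemma bU_zmod h : zmod_morphism (bU h). Proof. by move=> f g; exact: bfE. Qed.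
Lemma bU_monoid h : monoid_morphism (bU h).
Proof. by split=> [|f g]; exact: bfE. Qed.
HB.instance Definition _ h := GRing.isZmodMorphism.Build S S (bU h) (bU_zmod h).
HB.instance Definition _ h := GRing.isMonoidMorphism.Build S S (bU h) (bU_monoid h).

Definition bub f := forall x, n2 (f x) <= 1.

Lemma bcj_x f x : bcj f x = conjc (f x). Proof. by []. Qed.
Lemma bU_x h f x : bU h f x = f (al h x). Proof. by []. Qed.
Lemma bkk_x r x : bkk r x = r%:C. Proof. by []. Qed.

Lemma fcj_x f x : (f * bcj f) x = (n2 (f x))%:C.
Proof. by rewrite bfM bcj_x mulJ. Qed.

Lemma mb_n2 f : mb (fun x => n2 (f x)).
Proof.
rewrite (_ : (fun _ => _) = (fun x => complex.Re ((f * bcj f) x))); first exact: mb_re.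
by apply: funext => x; rewrite fcj_x.
Qed.

Lemma brho_n2 f : brho (f * bcj f) = I mu (fun x => n2 (f x)).
Proof. by congr (I mu _); apply: funext => x; rewrite fcj_x. Qed.

Lemma weqP f g : weq brho f g <-> \forall x \ae mu, f x = g x.
Proof.
split=> [h|h a].
  have : brho ((f - g) * bcj (f - g)) <= 0.
    by rewrite mulrC mulrBr raddfB/= h subrr.
  rewrite brho_n2 => /(I0_ae (mb_n2 _) (fun x => n2_ge0 _)).
  by apply: filterS => x /n2_eq0/eqP; rewrite bfD bfN subr_eq0 => /eqP.
apply: I_ae; [exact: mb_re|exact: mb_re|].
by apply: filterS h => x fg; rewrite !bfM fg.
Qed.

Lemma brho_U h f : brho (bU h f) = brho f.
Proof. exact: (I_map (mal h) (pal h) (mb_re f)). Qed.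

Lemma brho_le f g : (forall x, complex.Re (f x) <= complex.Re (g x)) -> brho f <= brho g.
Proof. by move=> h; apply: I_le => //; exact: mb_re. Qed.

Lemma brho_aele f g : (\forall x \ae mu, complex.Re (f x) <= complex.Re (g x)) ->
  brho f <= brho g.
Proof.
by move=> h; apply: I_aele => //; exact: mb_re.
Qed.

Lemma brho_ub f c : (forall x, complex.Re (f x) <= c) -> brho f <= c.
Proof.
move=> h; rewrite -[c](I_cst mu); apply: I_le => //; [exact: mb_re|exact: mb_cst].
Qed.

Lemma bub_re f x : bub f -> complex.Re (f x) <= 1.
Proof.
move=> /(_ x); rewrite /n2; case: (f x) => a b /= h.
have := sqr_ge0 b; nra.
Qed.

Lemma brho_kk r f : brho (bkk r * f) = r * brho f.
Proof.
rewrite /brho -IZ; last exact: mb_re.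
congr (I mu _); apply: funext => x; rewrite bfM; case: (f x) => a b /=; ring.
Qed.

Lemma brho_cj f : brho (bcj f) = brho f.
Proof. by congr (I mu _); apply: funext => x; rewrite bcj_x; case: (f x). Qed.

Lemma brho_ge0 f : 0 <= brho (f * bcj f).
Proof. by rewrite brho_n2; apply: I_ge0 => x; exact: n2_ge0. Qed.

Lemma bub_sq f g : bub f -> brho (f * bcj f * (g * bcj g)) <= brho (g * bcj g).
Proof.
move=> uf; apply: brho_le => x; rewrite bfM !fcj_x -rmorphM /=.
by rewrite ler_piMl ?n2_ge0.
Qed.

Lemma bub_all f : exists2 c, 0 < c & bub (bkk c * f).
Proof.
have [_ _ [c hc]] := bf_mbc f; exists (1 + `|c|)^-1.
  by rewrite invr_gt0 ltr_pwDl.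
move=> x; rewrite bfM n2M n2C exprVn ler_pdivrMl ?mulr1 ?exprn_gt0 ?ltr_pwDl//.
apply: (le_trans (hc x)); have := ler_norm c; have := normr_ge0 c; nra.
Qed.

Lemma meas_eq1 (u : S) : measurable [set x | u x = 1].
Proof.
have [mf mf' _] := bf_mbc u.
rewrite (_ : [set x | _] = (setT `&` (fun x => complex.Re (u x)) @^-1` [set 1]) `&`
   (setT `&` (fun x => complex.Im (u x)) @^-1` [set 0])).
  by apply: measurableI; [exact: mf|exact: mf'].
rewrite !setTI; apply/seteqP; split => x /=; first by move=> ->.
by case: (u x) => a b [/= -> ->].
Qed.

Lemma mbc_ind (B : set X) : measurable B -> mbc (fun x => (ind R B x)%:C).
Proof.
move=> mB; split => /=; [by case: (mb_ind R mB)|exact: measurable_cst|].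
exists 1 => x; rewrite n2C; have /andP[h0 h1] := ind01 R B x; nra.
Qed.
Definition bind (B : set X) (mB : measurable B) : S := mkb (mbc_ind mB).

Definition bei (u : S) : S := bind (meas_eq1 u).

Lemma bind_x B (mB : measurable B) x : bind mB x = (ind R B x)%:C. Proof. by []. Qed.

Lemma bei1 u x : u x = 1 -> bei u x = 1. Proof. by move=> h; rewrite /bei bind_x ind1. Qed.
Lemma bei0 u x : u x <> 1 -> bei u x = 0. Proof. by move=> h; rewrite /bei bind_x ind0. Qed.

Lemma bei_or u x : (u x = 1 /\ bei u x = 1) \/ (u x <> 1 /\ bei u x = 0).
Proof.
have [e|ne] := pselect (u x = 1); [left|right]; split=> //; first exact: bei1.
exact: bei0.
Qed.

Lemma bei_idem u : bei u * bei u = bei u.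
Proof.
apply: bfE => x; rewrite bfM; case: (bei_or u x) => -[_ ->]; first by rewrite mulr1.
by rewrite mulr0.
Qed.
Lemma bei_cj u : bcj (bei u) = bei u.
Proof. by apply: bfE => x; rewrite bcj_x conjc_real. Qed.
Lemma bei_ub u : bub (bei u).
Proof.
by move=> x; case: (bei_or u x) => -[_ ->]; rewrite ?(n2C 1) ?(n2C 0) ?expr1n// expr0n.
Qed.
Lemma bei_ubC u : bub (1 - bei u).
Proof.
move=> x; rewrite bfD bfN bf1.
by case: (bei_or u x) => -[_ ->]; rewrite ?subrr ?subr0 ?(n2C 1) ?(n2C 0) ?expr1n// expr0n.
Qed.
Lemma bei_U h u : bU h (bei u) = bei (bU h u).
Proof. by apply: bfE => x. Qed.
Lemma bei_weq u v : weq brho u v -> weq brho (bei u) (bei v).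
Proof.
by move=> /weqP h; apply/weqP; apply: filterS h => x e; rewrite /bei !bind_x /ind /= e.
Qed.
Lemma bei_mul u : bei u * u = bei u.
Proof.
apply: bfE => x; rewrite bfM.
by case: (bei_or u x) => -[]; [move=> -> _|move=> _ ->]; rewrite ?mulr1 ?mul0r.
Qed.
Lemma bei_abs (e u : S) : e * e = e -> e * u = e -> e * bei u = e.
Proof.
move=> ee1 eu; apply: bfE => x; rewrite bfM.
case: (bei_or u x) => -[u1 ->]; first by rewrite mulr1.
have := congr1 (fun f : S => f x) eu; rewrite mulr0 bfM => h.
apply/esym/eqP; apply: contra_notT u1 => e0.
by apply: (mulfI e0); rewrite h mulr1.
Qed.
Lemma bei_fix u F : weq brho (u * F) F -> weq brho (bei u * F) F.
Proof.
move=> /weqP h; apply/weqP; apply: filterS h => x; rewrite !bfM => h.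
case: (bei_or u x) => -[u1 ->]; first by rewrite mul1r.
rewrite mul0r; apply/esym/eqP; apply: contra_notT u1 => F0.
by apply: (mulIf F0); rewrite h mul1r.
Qed.

Lemma meas_ge (y : S) c : measurable [set x | c <= complex.Re (y x)].
Proof.
have [mf _ _] := bf_mbc y.
rewrite (_ : [set x | _] = setT `&` (fun x => complex.Re (y x)) @^-1` `[c, +oo[%classic).
  by apply: mf.
by rewrite setTI; apply/seteqP; split => x /=; rewrite in_itv /= andbT.
Qed.

Lemma bind_ub B (mB : measurable B) : bub (bind mB).
Proof. by move=> x; rewrite bind_x n2C; have /andP[h0 h1] := ind01 R B x; nra. Qed.
Lemma bind_idem B (mB : measurable B) : bind mB * bind mB = bind mB.
Proof.
by apply: bfE => x; rewrite bfM bind_x -rmorphM /= /ind; case: asboolP => _; rewrite ?mulr1 ?mulr0.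
Qed.
Lemma bind_cj B (mB : measurable B) : bcj (bind mB) = bind mB.
Proof. by apply: bfE => x; rewrite bcj_x conjc_real. Qed.

Lemma bthr (y : S) (c : R) : 0 <= c -> exists e : S, [/\ e * e = e, bcj e = e, bub e,
    (forall g : {poly int}, weq brho (bU g y) y -> weq brho (bU g e) e) &
    (brho ((1 - e) * y) <= c /\
     forall v, c * brho (e * (v * bcj v)) <= brho (e * y * (v * bcj v)))].
Proof.
move=> c0; exists (bind (meas_ge y c)); split.
- exact: bind_idem.
- exact: bind_cj.
- exact: bind_ub.
- move=> g /weqP h; apply/weqP; apply: filterS h => x.
  by rewrite !bU_x !bind_x /ind /= => ->.
- split=> [|v].
    apply: brho_ub => x; rewrite bfM bfD bfN bf1 bind_x /ind.
    case: asboolP => /= [_|h]; first by rewrite subrr mul0r.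
    by rewrite subr0 mul1r; apply: ltW; rewrite ltNge; apply/negP.
  rewrite -brho_kk; apply: brho_le => x; rewrite !bfM bkk_x bcj_x mulJ bind_x /ind.
  case: asboolP => /=; have := n2_ge0 (v x); case: (y x) => a b /= h' h; last first.
    by rewrite !(mul0r, mulr0, subr0, addr0).
  by rewrite !(mul1r, mul0r, mulr0, subr0, addr0); exact: ler_wpM2r.
Qed.

Lemma broots N : (0 < N)%N -> exists zs : seq S,
    (forall z, List.In z zs -> z * bcj z = 1 /\ forall g : {poly int}, bU g z = z) /\
    forall L : S, L * bcj L = 1 -> bei (L ^+ N) = \sum_(z <- zs) bei (bcj z * L).
Proof.
move=> N0; have [r hr] := closed_field_poly_normal ('X^N - 1 : {poly R[i]}).
have e1 : lead_coef ('X^N - 1 : {poly R[i]}) = 1 by apply/monicP; exact: monicXnsubC.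
rewrite e1 scale1r in hr.
have rN z : (z \in r) = (z ^+ N == 1).
  by rewrite -root_prod_XsubC -hr /root hornerD hornerN hornerXn hornerC subr_eq0.
have r1 z : z \in r -> z * conjc z = 1.
  rewrite rN => /eqP zN; rewrite mulJ.
  have : n2 z ^+ N = 1 by rewrite -n2X zN (n2C 1) expr1n.
  by move=> /eqP; rewrite pexpr_eq1 ?n2_ge0// => /eqP ->.
pose cst z : S := mkb (mbc_cst X z).
have hin z : List.In z [seq cst w | w <- undup r] -> exists2 w, w \in r & z = cst w.
  move=> hz; suff [w] : exists2 w, w \in undup r & z = cst w by rewrite mem_undup; exists w.
  elim: (undup r) hz => //= w s IH [<-|/IH[w' h1 h2]].
    by exists w; rewrite ?mem_head.
  by exists w'; rewrite // inE h1 orbT.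
exists [seq cst z | z <- undup r]; split.
  move=> z /hin[w wr ->]; split=> [|g]; last by apply: bfE => x.
  by apply: bfE => x; rewrite bfM bcj_x; exact: r1.
move=> L hL; apply: bfE => x.
have hLx : L x * conjc (L x) = 1 by have := congr1 (fun f : S => f x) hL.
have bsum (s : seq S) (F : S -> S) : (\sum_(z <- s) F z) x = \sum_(z <- s) F z x.
  by elim: s => [|z s IH]; rewrite ?big_nil// !big_cons bfD IH.
have bX n : (L ^+ n) x = L x ^+ n.
  by elim: n => [|n IH]; rewrite ?expr0// !exprS bfM IH.
rewrite bsum big_map; have hz z : z \in r -> (bcj (cst z) * L) x = 1 <-> z = L x.
  move=> zr; rewrite bfM bcj_x; have h1 := r1 z zr; split=> [h|<-]; last by rewrite mulrC.
  by rewrite -[LHS]mulr1 -h mulrA h1 mul1r.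
have [e|ne] := eqVneq (L x ^+ N) 1.
  rewrite bei1 ?bX// (bigD1_seq (L x)) ?undup_uniq ?mem_undup ?rN ?e//.
  rewrite bei1; last by apply/hz; rewrite ?rN ?e.
  rewrite big_seq_cond big1; first exact/esym/addr0.
  move=> z /andP[]; rewrite mem_undup => zr zL.
  by apply: bei0 => /(hz _ zr) h; rewrite h eqxx in zL.
rewrite bei0 ?bX; last exact/eqP.
rewrite big_seq big1// => z; rewrite mem_undup => zr; apply: bei0 => /(hz _ zr) h.
by move: zr ne; rewrite rN h => ->.
Qed.
End Instance.

(** * Densities of dominated functionals *)

Section RN.
Context d (X : measurableType d) (R : realType) (mu : probability X R).
Local Notation I := (I mu).

Lemma I_ind_fine (B : set X) : measurable B -> I (ind R B) = fine (mu B).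
Proof. by move=> mB; rewrite -(I_ind mu mB). Qed.

Definition additive_set (lam : set X -> R) := forall A B, measurable A -> measurable B ->
  A `&` B = set0 -> lam (A `|` B) = lam A + lam B.

Lemma I_ind_additive : additive_set (fun B => I (ind R B)).
Proof.
move=> A B mA mB AB; rewrite -ID; [|exact: mb_ind|exact: mb_ind].
congr (I _); apply: funext => x.
have [a|a] := pselect (A x); have [b|b] := pselect (B x).
- by have : (A `&` B) x by []; rewrite AB.
- by rewrite (ind1 _ a) (ind0 _ b) addr0 ind1//; left.
- by rewrite (ind0 _ a) (ind1 _ b) add0r ind1//; right.
- by rewrite (ind0 _ a) (ind0 _ b) addr0 ind0// => -[].
Qed.

Section Charge.
Variable lam : set X -> R.
Hypothesis lamD : additive_set lam.
Hypothesis lam_le : forall B, measurable B -> `|lam B| <= I (ind R B).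

Definition nuC (B : set X) : \bar R := (lam B)%:E.

Lemma lam0 (l : set X -> R) : additive_set l -> l set0 = 0.
Proof.
move=> h; have := h set0 set0 measurable0 measurable0 (setI0 _).
by rewrite setU0 => e; have : l set0 = 0 by lra.
Qed.

Lemma nuC0 : nuC set0 = 0%E. Proof. by rewrite /nuC lam0. Qed.
Lemma nuC_fin B : measurable B -> nuC B \is a fin_num. Proof. by []. Qed.

Lemma lam_bigU (l : set X -> R) (F : nat -> set X) n : additive_set l ->
  (forall i, measurable (F i)) -> trivIset setT F ->
  l (\bigcup_i F i) = \sum_(i < n) l (F i) + l (\bigcup_i F (n + i)%N).
Proof.
move=> hl mF tF; rewrite (bigcup_splitn n) hl; last 1 first.
- rewrite setIC -bigcup_mkord; apply/seteqP; split => // x [[i _ h1] [j /= jn h2]].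
  have : j = (n + i)%N by apply: tF => //; exists x.
  lia.
- congr (_ + _); elim: n => [|n IH]; first by rewrite !big_ord0 lam0.
  rewrite !big_ord_recr/= hl ?IH//; first exact: bigsetU_measurable.
  rewrite -bigcup_mkord; apply/seteqP; split => // x [[j /= jn h1] h2].
  have : j = n by apply: tF => //; exists x.
  lia.
- exact: bigsetU_measurable.
- exact: bigcupT_measurable.
Qed.

(** Finite additivity suffices, because the tail of [lam] is dominated by the tail of the measure,
    which tends to [0]. *)
Lemma nuC_sigma : semi_sigma_additive nuC.
Proof.
move=> F mF tF mU.
have : (fun n => \sum_(0 <= i < n) mu (F i))%E @ \oo --> (I (ind R (\bigcup_n F n)))%:E.
  by rewrite I_ind//; exact: measure_semi_sigma_additive.
move=> /fine_cvgP[_ h]; apply/fine_cvgP; split.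
  by apply: nearW => n; rewrite sumEFin.
apply/cvgrPdist_le => e e0; move/cvgrPdist_le : h => /(_ _ e0).
apply: filterS => n /=; rewrite sumEFin/= !big_mkord => h.
have e1 : fine (\sum_(i < n) mu (F i)) = \sum_(i < n) I (ind R (F i)).
  under eq_bigr do rewrite -I_ind//.
  by rewrite sumEFin.
move: h; rewrite e1 (lam_bigU n I_ind_additive mF tF) (lam_bigU n lamD mF tF).
rewrite ![_ + _ - _]addrAC !subrr !add0r; apply: le_trans.
have mt : measurable (\bigcup_i F (n + i)%N) by exact: bigcupT_measurable.
by apply: le_trans (lam_le mt) _; exact: ler_norm.
Qed.

HB.instance Definition _ := isCharge.Build _ _ _ nuC nuC0 nuC_fin nuC_sigma.

Lemma nuC_dom : nuC `<< mu.
Proof.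
apply/null_content_dominatesP => B mB B0.
have := lam_le mB; rewrite I_ind_fine// B0/= normr_le0 /nuC => /eqP ->.
by [].
Qed.

Lemma density_ex : exists q : X -> R, mu.-integrable setT (EFin \o q) /\
  forall B, measurable B -> lam B = I (fun x => ind R B x * q x).
Proof.
pose nu : {charge set X -> \bar R} := nuC.
have hn : nu `<< mu by exact: nuC_dom.
have hi := Radon_Nikodym_integrable hn.
have hf x := Radon_Nikodym_fin_num x hn.
set g := Radon_Nikodym nu mu in hi hf.
exists (fun x => fine (g x)).
have eg : EFin \o (fun x => fine (g x)) = g by apply: funext => x /=; rewrite fineK.
rewrite eg; split=> // B mB.
have := Radon_Nikodym_integral hn mB; rewrite integral_mkcond -/g => h.
rewrite -[lam B]/(fine (nu B)) h; congr fine; apply: eq_integral => x _.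
rewrite patchE /ind; case: ifPn => [/set_mem h1|h1].
  by rewrite asboolT// mul1r fineK.
by rewrite asboolF ?mul0r// => h2; move/negP: h1; apply; exact: mem_set.
Qed.
End Charge.

Lemma density_le1 (lam : set X -> R) (q : X -> R) : mu.-integrable setT (EFin \o q) ->
  (forall B, measurable B -> lam B = I (fun x => ind R B x * q x)) ->
  (forall B, measurable B -> lam B <= I (ind R B)) -> \forall x \ae mu, q x <= 1.
Proof.
move=> hi hq hl; have mq : measurable_fun setT q by apply/measurable_EFinP; exact: measurable_int hi.
have mB : measurable [set x | 1 < q x].
  rewrite (_ : [set x | _] = setT `&` q @^-1` `]1, +oo[%classic); first exact: mq.
  by rewrite setTI; apply/seteqP; split => x; rewrite /= in_itv/= andbT.
set B := [set x | _] in mB.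
have hBi : mu.-integrable setT (EFin \o (fun x => ind R B x * q x)).
  rewrite (_ : _ \o _ = (EFin \o ind R B) \* (EFin \o q))%E; last by [].
  have [mi [c hc]] := mb_ind R mB.
  apply: integrableMr => //.
  by exists c; split; [exact: num_real|move=> M cM x _; exact: le_trans (hc x) (ltW cM)].
have hii := mb_int mu (mb_ind R mB).
have : \forall x \ae mu, ind R B x * q x - ind R B x = 0.
  apply: I0_aei.
  - exact: (integrableB measurableT hBi hii).
  - move=> x; rewrite /ind; case: asboolP => /= h; last by rewrite mul0r subr0.
    by rewrite mul1r subr_ge0 ltW.
  - by rewrite /I RintegralB// -/(I _) -/(I _) -hq// subr_le0 hl.
apply: filterS => x; rewrite /ind; case: asboolP => /= h.
  by rewrite mul1r => /eqP; rewrite subr_eq0 => /eqP ->.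
by move=> _; rewrite leNgt; apply/negP.
Qed.

(** The Radon-Nikodym density lies in [[-1, 1]] almost everywhere, so truncating it there does not
    change its integrals. *)
Lemma density_mb (lam : set X -> R) : additive_set lam ->
  (forall B, measurable B -> `|lam B| <= I (ind R B)) ->
  exists p, [/\ mb p, forall x, `|p x| <= 1 &
    forall B, measurable B -> lam B = I (fun x => ind R B x * p x)].
Proof.
move=> hD hl; have [q [hi hq]] := density_ex hD hl.
have q1 : \forall x \ae mu, q x <= 1.
  by apply: (density_le1 hi hq) => B mB; apply: le_trans (hl B mB); exact: ler_norm.
have q2 : \forall x \ae mu, - q x <= 1.
  apply: (@density_le1 (fun B => - lam B) (fun x => - q x)).
  - exact: (integrableN hi).
  - move=> B mB; rewrite hq// /I -[LHS]mulN1r -RintegralZl//.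
      by congr Rintegral; apply: funext => x; ring.
    have [mi [c hc]] := mb_ind R mB.
    rewrite (_ : _ \o _ = (EFin \o ind R B) \* (EFin \o q))%E; last by [].
    apply: integrableMr => //.
    by exists c; split; [exact: num_real|move=> M cM x _; exact: le_trans (hc x) (ltW cM)].
  - by move=> B mB; apply: le_trans (hl B mB); rewrite -normrN; exact: ler_norm.
have mq : measurable_fun setT q by apply/measurable_EFinP; exact: measurable_int hi.
pose p x := Num.max (-1) (Num.min 1 (q x)).
have p1 x : `|p x| <= 1.
  by rewrite ler_norml /p le_max lexx/= ge_max ge_min lexx/= andbT; lra.
have mp : mb p.
  split; last by exists 1.
  by apply: measurable_maxr; [exact: measurable_cst|apply: measurable_minr => //; exact: measurable_cst].
exists p; split=> // B mB; rewrite hq//; congr fine; apply: ae_eq_integral => //.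
- apply/measurable_EFinP; apply: measurable_funM => //; exact: (mb_ind R mB).1.
- apply/measurable_EFinP; apply: measurable_funM; [exact: (mb_ind R mB).1|exact: mp.1].
- apply: filterS2 q1 q2 => x h1 h2 _; congr (_ * _)%:E.
  by rewrite /p min_r// max_r//; lra.
Qed.

(** The density comes from the values on indicator functions. The difference [D] of the two
    functionals is linear, vanishes on indicators and is bounded on functions with values in
    [[0, 1]], which forces [D = 0]. *)
Lemma density_fun (Phi : (X -> R) -> R) :
  (forall h k, mb h -> mb k -> Phi (fun x => h x + k x) = Phi h + Phi k) ->
  (forall c h, mb h -> Phi (fun x => c * h x) = c * Phi h) ->
  (forall h k, mb h -> mb k -> (forall x, `|h x| <= k x) -> `|Phi h| <= I k) ->
  exists p, [/\ mb p, forall x, `|p x| <= 1 &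
    forall h, mb h -> Phi h = I (fun x => h x * p x)].
Proof.
move=> PD PZ Ple.
have [||p [mp p1 hp]] := @density_mb (fun B => Phi (ind R B)).
- move=> A B mA mB AB; rewrite -PD; [|exact: mb_ind|exact: mb_ind].
  congr (Phi _); apply: funext => x.
  have [a|a] := pselect (A x); have [b|b] := pselect (B x).
  + by have : (A `&` B) x by []; rewrite AB.
  + by rewrite (ind1 _ a) (ind0 _ b) addr0 ind1//; left.
  + by rewrite (ind0 _ a) (ind1 _ b) add0r ind1//; right.
  + by rewrite (ind0 _ a) (ind0 _ b) addr0 ind0// => -[].
- move=> B mB; apply: Ple; [exact: mb_ind|exact: mb_ind|move=> x].
  by have /andP[h0 h1] := ind01 R B x; rewrite ger0_norm.
exists p; split=> //; pose D h := Phi h - I (fun x => h x * p x).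
have DD h k : mb h -> mb k -> D (fun x => h x + k x) = D h + D k.
  move=> hh hk; rewrite /D PD//.
  have -> : I (fun x => (h x + k x) * p x) = I (fun x => h x * p x) + I (fun x => k x * p x).
    rewrite -ID; [|exact: mbM|exact: mbM].
    by congr (I _); apply: funext => x; rewrite mulrDl.
  ring.
have DZ c h : mb h -> D (fun x => c * h x) = c * D h.
  move=> hh; rewrite /D PZ// mulrBr -IZ; last exact: mbM.
  by congr (_ - I _); apply: funext => x; rewrite mulrA.
have Di B : measurable B -> D (ind R B) = 0 by move=> mB; rewrite /D hp// subrr.
have D2 h : mb h -> (forall x, 0 <= h x <= 1) -> `|D h| <= 2.
  move=> hh h01; have hn x : `|h x| <= 1.
    by have /andP[h0 h1] := h01 x; rewrite ger0_norm.
  rewrite (le_trans (ler_normB _ _))//.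
  have e1 : `|Phi h| <= 1.
    by rewrite -[leRHS](I_cst mu 1); apply: Ple => //; exact: mb_cst.
  suff : `|I (fun x => h x * p x)| <= 1 by lra.
  have hb x : `|h x * p x| <= 1.
    by rewrite normrM; have := hn x; have := p1 x; have := normr_ge0 (h x); have := normr_ge0 (p x); nra.
  have mhp : mb (fun x => h x * p x) by exact: mbM.
  rewrite ler_norml; apply/andP; split.
    rewrite -[leLHS](I_cst mu); apply: I_le => //; first exact: mb_cst.
    by move=> x; have := hb x; rewrite ler_norml => /andP[].
  rewrite -[leRHS](I_cst mu); apply: I_le => //; first exact: mb_cst.
  by move=> x; have := hb x; rewrite ler_norml => /andP[].
(* Peeling off binary digits halves the error each time. *)
have Dk n h : mb h -> (forall x, 0 <= h x <= 1) -> `|D h| <= 2 / 2 ^+ n.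
  elim: n h => [|n IH] h hh h01; first by rewrite expr0 divr1; exact: D2.
  pose B := [set x | 2^-1 <= h x].
  have mB : measurable B.
    rewrite /B (_ : [set x | _] = setT `&` h @^-1` `[2^-1, +oo[%classic); first exact: hh.1.
    by rewrite setTI; apply/seteqP; split => x; rewrite /= in_itv/= andbT.
  pose k x := 2 * h x + (-1) * ind R B x.
  have mk : mb k by apply: mbD; [exact: mbZ|apply: mbZ; exact: mb_ind].
  have k01 x : 0 <= k x <= 1.
    have := h01 x; rewrite /k /ind; case: asboolP => /=; rewrite /B /=; last move/negP.
      lra.
    rewrite -ltNge; lra.
  have := IH k mk k01.
  rewrite /k DD; [|exact: mbZ|by apply: mbZ; exact: mb_ind].
  rewrite !DZ ?Di//; last exact: mb_ind.
  rewrite mulr0 addr0 normrM ger0_norm// => hk.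
  have -> : 2 / 2 ^+ n.+1 = (2 / 2 ^+ n) / 2 :> R by rewrite exprS; field; rewrite expf_neq0.
  by lra.
have D01 h : mb h -> (forall x, 0 <= h x <= 1) -> D h = 0.
  move=> hh h01; apply/eqP; rewrite -normr_le0 leNgt; apply/negP => hpos.
  have := Dk (Num.truncn (2 / `|D h|)).+1 h hh h01; rewrite leNgt => /negP; apply.
  rewrite ltr_pdivrMr ?exprn_gt0// mulrC -ltr_pdivrMr//.
  apply: (lt_trans (truncnS_gt _)).
  by rewrite -natrX ltr_nat; exact: ltn_expl.
move=> h hh; apply/eqP; rewrite -subr_eq0 -/(D h); apply/eqP.
have [mh [c hc]] := hh; pose C := 1 + `|c|.
have C0 : 0 < C by rewrite ltr_pwDl.
pose k x := (2 * C)^-1 * (h x + C).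
have mk : mb k by apply: mbZ; apply: mbD => //; exact: mb_cst.
have k01 x : 0 <= k x <= 1.
  have : `|h x| <= C by apply: le_trans (hc x) _; rewrite /C; have := ler_norm c; lra.
  rewrite ler_norml => /andP[h1 h2]; rewrite /k mulr_ge0 ?invr_ge0 ?mulr_ge0 ?(ltW C0)//=; last by lra.
  by rewrite ler_pdivrMl ?mulr_gt0// mulr1; lra.
have := D01 k mk k01; rewrite /k DZ; last by apply: mbD => //; exact: mb_cst.
rewrite DD//; last exact: mb_cst.
have -> : D (fun=> C) = 0.
  have := DZ C (ind R setT) (mb_ind R measurableT); rewrite Di// mulr0 => <-.
  by congr D; apply: funext => x; rewrite ind1// mulr1.
by rewrite addr0 => /eqP; rewrite mulf_eq0 invr_eq0 mulf_eq0 (gt_eqF C0) pnatr_eq0/= => /eqP.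
Qed.
End RN.

(** * Weak limits along a mean *)

Section WMean.
Context d (X : measurableType d) (R : realType) (mu : probability X R).
Local Notation S := (bfun X R).
Local Notation I := (I mu).
Implicit Types (f g u : S).

Lemma mb_im f : mb (fun x => complex.Im (f x)).
Proof.
have [_ mf [c hc]] := bf_mbc f; split => //; exists (1 + c) => x.
apply: le_trans (_ : _ <= 1 + n2 (f x)) _; last by rewrite lerD2l.
rewrite /n2; case: (f x) => a b /=; rewrite ler_norml; have := sqr_ge0 a.
by have := sqr_ge0 (b - 1); have := sqr_ge0 (b + 1); nra.
Qed.

Lemma I_abs h k : mb h -> mb k -> (forall x, `|h x| <= k x) -> `|I h| <= I k.
Proof.
move=> hh hk hl; rewrite ler_norml -IN//; apply/andP; split; apply: I_le => //.
- exact: mbN.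
- by move=> x; have := hl x; rewrite ler_norml => /andP[].
- by move=> x; apply: le_trans (hl x); exact: ler_norm.
Qed.

Lemma mean_density m (v : nat -> X -> R) : is_mean m -> (forall n, mb (v n)) ->
  (forall n x, `|v n x| <= 1) ->
  exists p, [/\ mb p, forall x, `|p x| <= 1 & forall h, mb h ->
    m (fun n => I (fun x => h x * v n x)) = I (fun x => h x * p x)].
Proof.
move=> hm mv v1.
have hb h k : mb h -> mb k -> (forall x, `|h x| <= k x) ->
    forall n, `|I (fun x => h x * v n x)| <= I k.
  move=> hh hk hl n; apply: I_abs => //; first exact: mbM.
  by move=> x; rewrite normrM; apply: le_trans (hl x); rewrite ler_piMr.
have bs h : mb h -> bseq (fun n => I (fun x => h x * v n x)).
  move=> hh; have [c hc] := hh.2; exists (I (fun=> c)) => n.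
  by apply: hb => //; exact: mb_cst.
apply: density_fun.
- move=> h k hh hk; rewrite -(meanD hm); [|exact: bs|exact: bs].
  congr m; apply: funext => n; rewrite -ID; [|exact: mbM|exact: mbM].
  by congr (I _); apply: funext => x; rewrite mulrDl.
- move=> c h hh; rewrite -(meanZ hm); last exact: bs.
  congr m; apply: funext => n; rewrite -IZ; last exact: mbM.
  by congr (I _); apply: funext => x; rewrite mulrA.
- move=> h k hh hk hl; rewrite ler_norml; apply/andP; split.
    rewrite -[leLHS](mean_cst hm); apply: (mean_le hm); [exact: bseq_cst|exact: bs|].
    by move=> n; have := hb h k hh hk hl n; rewrite ler_norml => /andP[].
  rewrite -[leRHS](mean_cst hm); apply: (mean_le hm); [exact: bs|exact: bseq_cst|].
  by move=> n; have := hb h k hh hk hl n; rewrite ler_norml => /andP[].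
Qed.

(** Treating real and imaginary parts separately only gives [n2 F0 <= 2]. The bound [1] almost
    everywhere comes from testing against [e * bcj F0], with [e] the indicator function of
    [n2 F0 >= 1], and from [2 Re (cj F0 * u) <= n2 F0 + 1]; [F0] is then set to [0] on the null set
    where it fails. *)
Lemma bwmean m (u : nat -> S) : is_mean m -> (forall n, bub (u n)) ->
    exists2 F : S, bub F & forall a, brho mu (a * F) = m (fun n => brho mu (a * u n)).
Proof.
move=> hm hu.
have h1 n x : `|complex.Re (u n x)| <= 1 /\ `|complex.Im (u n x)| <= 1.
  have := hu n x; rewrite /n2; case: (u n x) => a b /= h.
  by rewrite !ler_norml; have := sqr_ge0 a; have := sqr_ge0 b; split; nra.
have [p [mp p1 hp]] := mean_density hm (fun n => mb_re (u n)) (fun n x => (h1 n x).1).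
have [q [mq q1 hq]] := mean_density hm (fun n => mb_im (u n)) (fun n x => (h1 n x).2).
have mF : mbc (fun x => p x +i* q x).
  split; [exact: mp.1|exact: mq.1|exists 2 => x].
  have := p1 x; have := q1 x; rewrite /n2/= !ler_norml => /andP[? ?] /andP[? ?]; nra.
pose F0 : S := mkb mF.
have E (a : S) : brho mu (a * F0) = m (fun n => brho mu (a * u n)).
  have bs (f : S) (v : nat -> X -> R) (g : X -> R) : mb g -> (forall n, mb (v n)) ->
      (forall n x, `|v n x| <= 1) -> bseq (fun n => I (fun x => g x * v n x)).
    move=> mg mv v1; have [c hc] := mg.2; exists (I (fun=> c)) => n.
    apply: I_abs; [exact: mbM|exact: mb_cst|move=> x].
    by rewrite normrM; apply: le_trans (hc x); rewrite ler_piMr.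
  have -> : brho mu (a * F0) = I (fun x => complex.Re (a x) * p x) - I (fun x => complex.Im (a x) * q x).
    rewrite -IB; [|by apply: mbM => //; exact: mb_re|by apply: mbM => //; exact: mb_im].
    by congr (I _); apply: funext => x; rewrite bfM /=; case: (a x).
  rewrite -hp; last exact: mb_re.
  rewrite -hq; last exact: mb_im.
  rewrite -(meanB hm); last 2 first.
  - by apply: bs => // [|n|n x]; [exact: mb_re|exact: mb_re|exact: (h1 n x).1].
  - by apply: bs => // [|n|n x]; [exact: mb_im|exact: mb_im|exact: (h1 n x).2].
  congr m; apply: funext => n; rewrite -IB; last 2 first.
  - by apply: mbM; exact: mb_re.
  - by apply: mbM; exact: mb_im.
  by congr (I _); apply: funext => x; rewrite bfM; case: (a x) (u n x) => ? ? [].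
have mB0 := meas_ge (F0 * bcj F0 - 1) 0.
pose e : S := bind R mB0.
have key : brho mu (e * (F0 * bcj F0 - 1)) <= 0.
  have e1 : brho mu (e * (F0 * bcj F0)) = m (fun n => brho mu (e * bcj F0 * u n)).
    by rewrite -E; congr (brho _ _); rewrite -mulrA [F0 * _]mulrC.
  have e2 : m (fun n => brho mu (e * bcj F0 * u n)) <=
      brho mu (bkk X 2^-1 * (e * (F0 * bcj F0 + 1))).
    have le n : brho mu (e * bcj F0 * u n) <= brho mu (bkk X 2^-1 * (e * (F0 * bcj F0 + 1))).
      apply: brho_le => x; rewrite !bfM bfD fcj_x bf1 bkk_x bcj_x bind_x.
      rewrite /ind; case: asboolP => _ /=; last by rewrite !(mul0r, mulr0, subr0, addr0).
      have := hu n x; rewrite /n2 /=; case: (u n x) => a b /=.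
      have := sqr_ge0 (p x - a); have := sqr_ge0 (q x - b); nra.
    apply: (mean_lec hm) => //.
    have [c hc] := (mb_n2 (e * bcj F0)).2; exists (1 + c) => n.
    apply: le_trans (I_abs (k := fun=> 1 + c) (mb_re _) (mb_cst _ _) _) _; last by rewrite I_cst.
    move=> x; apply: le_trans (Re_n2 _) _; rewrite lerD2l bfM n2M.
    apply: le_trans (hc x); rewrite ger0_norm ?n2_ge0//.
    by rewrite ler_piMr ?n2_ge0//; exact: hu.
  have e3 : brho mu (bkk X 2^-1 * (e * (F0 * bcj F0 + 1))) =
     2^-1 * (brho mu (e * (F0 * bcj F0)) + brho mu e).
    by rewrite brho_kk mulrDr mulr1 raddfD.
  by rewrite mulrBr mulr1 raddfB/=; lra.
have : \forall x \ae mu, complex.Re ((e * (F0 * bcj F0 - 1)) x) = 0.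
  apply: I0_ae => //; first exact: mb_re.
  move=> x; rewrite bfM bind_x /ind; case: asboolP => h; rewrite bfD fcj_x bfN bf1 /=.
    have : 0 <= complex.Re ((F0 * bcj F0 - 1) x) by exact: h.
    by rewrite bfD fcj_x bfN bf1 /= mul1r mul0r subr0.
  by rewrite !mul0r subr0.
move=> hae; have mP : measurable [set x | n2 (F0 x) <= 1].
  rewrite (_ : [set x | _] = [set x | 0 <= complex.Re ((1 - F0 * bcj F0) x)]); first exact: meas_ge.
  by apply/seteqP; split => x; rewrite /mkset bfD bf1 bfN fcj_x /= subr_ge0.
exists (bind R mP * F0).
  move=> x; rewrite bfM bind_x n2M n2C /ind; case: asboolP => /= h.
    by rewrite expr1n mul1r.
  by rewrite expr0n mul0r.
move=> a; rewrite -E; move: a; apply/weqP; apply: filterS hae => x.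
rewrite /e bfM bfD fcj_x bfN bf1 bind_x => hx.
rewrite bfM bind_x; have [h|h] := leP (n2 (F0 x)) 1; first by rewrite ind1// mul1r.
move: hx; rewrite ind1; last by rewrite /mkset bfD fcj_x bfN bf1 /= subr_ge0 ltW.
by move=> /= h2; exfalso; lra.
Qed.
End WMean.

(** * A measurable frequency for Toeplitz arrays of invariant functions *)

Section U2Freq.
Context d (X : measurableType d) (R : realType) (mu : probability X R).
Variable al : {poly int} -> X -> X.
Hypothesis mal : forall g, measurable_fun setT (al g).
Hypothesis pal : forall g B, measurable B -> mu (al g @^-1` B) = mu B.
Local Notation S := (bfun X R).
Local Notation brho := (brho mu).
Local Notation I := (I mu).

Lemma bf_sum (T : Type) (r : seq T) (F : T -> S) x :
  (\sum_(i <- r) F i) x = \sum_(i <- r) F i x.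
Proof. by elim: r => [|i r IH]; rewrite ?big_nil// !big_cons bfD IH. Qed.

Lemma bfX (f : S) n x : (f ^+ n) x = f x ^+ n.
Proof. by elim: n => [|n IH]; rewrite ?expr0// !exprS bfM IH. Qed.

Lemma Re_scale (r : R) (z : R[i]) : complex.Re (r%:C * z) = r * complex.Re z.
Proof. by case: z => a b /=; rewrite mul0r subr0. Qed.

Definition avgS H (F : nat -> S) : S := bkk X (H%:R^-1) * \sum_(a < H) F a.

Lemma avgS_x H (F : nat -> S) x : complex.Re (avgS H F x) = avg H (fun a => complex.Re (F a x)).
Proof. by rewrite /avgS bfM bkk_x Re_scale bf_sum raddf_sum. Qed.

Lemma brho_avgS H (F : nat -> S) (v : S) : brho (v * avgS H F) = avg H (fun a => brho (v * F a)).
Proof. by rewrite /avgS mulrCA brho_kk mulr_sumr raddf_sum. Qed.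

Variables (c : nat -> nat -> S).
Definition arr x a b : R[i] := c a b x.

Definition WS (l : S) M : S := avgS M (fun a => avgS M (fun b => bcj l ^+ a * l ^+ b * c a b)).

Lemma WS_x (l : S) M x t : l x = ee t -> complex.Re (WS l M x) = wf (arr x) M t.
Proof.
move=> lx; rewrite /WS avgS_x; apply: avg_ext => a _; rewrite avgS_x; apply: avg_ext => b _.
by rewrite !bfM !bfX bcj_x lx.
Qed.

Lemma brho_WS (l : S) M (v : S) : brho (v * WS l M) = avg M (fun a => avg M (fun b =>
  brho (v * (bcj l ^+ a * l ^+ b * c a b)))).
Proof. by rewrite brho_avgS; apply: avg_ext => a _; rewrite brho_avgS. Qed.

Definition zc t : S := mkb (mbc_cst X (ee t)).

Variables (s : {poly int}) (D : nat).
Hypothesis D0 : (0 < D)%N.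
Hypothesis uc : forall a b, bub (c a b).
Hypothesis ic : forall a b, weq brho (bU mal s (c a b)) (c a b).
Hypothesis ct : forall a b, weq brho (c a.+1 b.+1) (c a b).
Hypothesis ch : forall a b, weq brho (bcj (c a b)) (c b a).
Hypothesis hW : forall z v (W := fun M => avg M (fun a => avg M (fun b =>
       brho (v * bcj v * (bcj z ^+ a * z ^+ b * c a b))))),
     z * bcj z = 1 -> (forall h, bU mal h z = z) -> weq brho (bU mal s v) v ->
     (forall M, 0 <= W M) /\ (forall M N, (0 < M)%N -> (0 < N)%N -> W (N * M)%N <= W M).

Lemma ae_inv : \forall x \ae mu, arr (al s x) = arr x.
Proof.
have h : \forall x \ae mu, forall a b, c a b (al s x) = c a b x.
  by apply: ae_foralln => a; apply: ae_foralln => b; have /weqP := ic a b.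
by apply: filterS h => x h; apply: funext => a; apply: funext => b; exact: h.
Qed.

Lemma ae_toep : \forall x \ae mu, forall a b, arr x a.+1 b.+1 = arr x a b.
Proof. by apply: ae_foralln => a; apply: ae_foralln => b; have /weqP := ct a b. Qed.

Lemma ae_herm : \forall x \ae mu, forall a b, conjc (arr x a b) = arr x b a.
Proof. by apply: ae_foralln => a; apply: ae_foralln => b; have /weqP := ch a b. Qed.

(** The set where the real part of [f] is negative is invariant, so its indicator function is an
    admissible [v]. *)
Lemma ae_sign (f : S) : (\forall x \ae mu, complex.Re (f (al s x)) = complex.Re (f x)) ->
  (forall v, weq brho (bU mal s v) v -> 0 <= brho (v * bcj v * f)) ->
  \forall x \ae mu, 0 <= complex.Re (f x).
Proof.
move=> fi hf; apply: ae_ge0; first exact: mb_re.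
have mB : measurable [set y | complex.Re (f y) < 0].
  rewrite (_ : [set x | _] = ~` [set x | 0 <= complex.Re (f x)]); first exact/measurableC/meas_ge.
  by apply/seteqP; split => x /=; rewrite ltNge => /negP.
have -> : I (fun x => ind R [set y | complex.Re (f y) < 0] x * complex.Re (f x)) =
    brho (bind R mB * bcj (bind R mB) * f).
  by congr (I _); apply: funext => x; rewrite bind_cj bind_idem bfM bind_x Re_scale.
apply: hf; apply/weqP; apply: filterS fi => x e.
by rewrite bU_x !bind_x /ind /= e.
Qed.

Lemma WS_inv t M : \forall x \ae mu,
  complex.Re (WS (zc t) M (al s x)) = complex.Re (WS (zc t) M x).
Proof. by apply: filterS ae_inv => x e; rewrite !(WS_x _ (t := t))// e. Qed.

Lemma zc_unit t : zc t * bcj (zc t) = 1.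
Proof. by apply: bfE => x; rewrite bfM bcj_x; exact: eeJ. Qed.
Lemma zc_const t h : bU mal h (zc t) = zc t. Proof. exact: bfE. Qed.

(** Only the countably many grid frequencies are involved, so a single null set is discarded. *)
Lemma ae_pos : \forall x \ae mu, forall H j M, 0 <= wf (arr x) M (grid R H j).
Proof.
apply: ae_foralln => H; apply: ae_foralln => j; apply: ae_foralln => M.
have h : \forall x \ae mu, 0 <= complex.Re (WS (zc (grid R H j)) M x).
  apply: ae_sign; first exact: WS_inv.
  move=> v iv; rewrite brho_WS.
  by have [h _] := hW (zc_unit (grid R H j)) (@zc_const _) iv; exact: h.
by apply: filterS h => x; rewrite (WS_x _ (t := grid R H j)).
Qed.

Lemma ae_mono : \forall x \ae mu, forall H j M N, (0 < M)%N -> (0 < N)%N ->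
  wf (arr x) (N * M) (grid R H j) <= wf (arr x) M (grid R H j).
Proof.
apply: ae_foralln => H; apply: ae_foralln => j; apply: ae_foralln => M; apply: ae_foralln => N.
have [M0|M0] := posnP M; first by apply: aeW => x; rewrite M0.
have [N0|N0] := posnP N; first by apply: aeW => x _; rewrite N0.
have h : \forall x \ae mu, 0 <= complex.Re
    ((WS (zc (grid R H j)) M - WS (zc (grid R H j)) (N * M)) x).
  apply: ae_sign.
    apply: filterS2 (WS_inv (grid R H j) M) (WS_inv (grid R H j) (N * M)) => x e1 e2.
    by rewrite !bfD !bfN !raddfB/= e1 e2.
  move=> v iv; rewrite mulrBr raddfB/= !brho_WS subr_ge0.
  by have [_ h] := hW (zc_unit (grid R H j)) (@zc_const _) iv; exact: h.
apply: filterS h => x; rewrite bfD bfN raddfB/= !(WS_x _ (t := grid R H j))//.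
by rewrite subr_ge0.
Qed.

Variable eta : R.
Hypothesis eta0 : 0 < eta.
Variable tn : nat -> nat.
Hypothesis tn_ge : forall n, (n <= tn n)%N.
Let Hs n := (D * (tn n)`!)%N.
Hypothesis hw : forall n, eta <= avg (Hs n) (fun a => avg (Hs n) (fun b =>
  brho (c a b * bcj (c a b)))).

Let Hs0 n : (0 < Hs n)%N. Proof. by rewrite muln_gt0 D0 fact_gt0. Qed.

Let Hs_dvd M n : (0 < M)%N -> (M <= n)%N -> (M %| Hs n)%N.
Proof. by move=> M0 Mn; apply/dvdn_mull/dvdn_fact; rewrite M0 (leq_trans Mn). Qed.

(** This is [(eta / 2) / 16]: the peak that [fejer_peak] gives where [PsiC] exceeds [eta / 2]. *)
Let tau := eta / 32.
Let th n x := thc tau (arr x) (Hs n).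
Let tht x := theta Hs tau (arr x).

Lemma meas_th n : measurable_fun setT (th n).
Proof.
have hj j : measurable_fun setT (fun x => if tau <= wf (arr x) (Hs n + Hs n) (grid R (Hs n) j)
    then grid R (Hs n) j else -1).
  pose B := [set x | tau <= complex.Re (WS (zc (grid R (Hs n) j)) (Hs n + Hs n) x)].
  have mB : measurable B by exact: meas_ge.
  rewrite (_ : (fun _ => _) = (fun x => -1 + (grid R (Hs n) j + 1) * ind R B x)).
    apply: measurable_funD; first exact: measurable_cst.
    by apply: measurable_funM; [exact: measurable_cst|exact: (mb_ind R mB).1].
  apply: funext => x; rewrite /ind /B /mkset (WS_x _ (t := grid R (Hs n) j))//.
  case: asboolP => [->|/negP/negbTE ->] /=; last by rewrite mulr0 addr0.
  by rewrite mulr1; ring.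
rewrite /th /thc; elim: (index_enum _) => [|j r IH].
  by under eq_fun do rewrite big_nil; exact: measurable_cst.
under eq_fun do rewrite big_cons.
by apply: measurable_maxr => //; exact: hj.
Qed.

Lemma meas_tht : measurable_fun setT tht.
Proof.
apply: measurable_fun_limn_sup => [x _|x _|n]; last exact: meas_th.
  exact: thc_ub.
exact: thc_lb.
Qed.

Lemma mbc_lam : mbc (fun x => ee (tht x)).
Proof.
split=> /=.
- exact: (measurableT_comp (continuous_measurable_fun (@continuous_cos R)) meas_tht).
- exact: (measurableT_comp (continuous_measurable_fun (@continuous_sin R)) meas_tht).
- by exists 1 => x; rewrite /n2/= cos2Dsin2.
Qed.
Let lam : S := mkb mbc_lam.

Let E n := [set x | 0 <= th n x].
Let mE n : measurable (E n).
Proof.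
rewrite /E (_ : [set x | _] = setT `&` th n @^-1` `[0, +oo[%classic); first exact: meas_th.
by rewrite setTI; apply/seteqP; split => x; rewrite /= in_itv/= andbT.
Qed.

(** [PsiC] is at most [1] with integral at least [eta], so it exceeds [eta / 2] on a set of measure
    at least [eta / 2], and there a grid frequency reaches [tau]. *)
Lemma E_ge n : ((eta / 2)%:E <= mu (E n))%E.
Proof.
rewrite -I_ind// lee_fin.
pose Ps : S := avgS (Hs n) (fun a => avgS (Hs n) (fun b => c a b * bcj (c a b))).
have PsE x : complex.Re (Ps x) = PsiC (arr x) (Hs n).
  rewrite avgS_x; apply: avg_ext => a _; rewrite avgS_x; apply: avg_ext => b _.
  by rewrite fcj_x.
have h1 : eta <= brho Ps.
  apply: le_trans (hw n) _; rewrite -[Ps]mul1r brho_avgS; apply: avg_le => a _.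
  by rewrite brho_avgS; apply: avg_le => b _; rewrite mul1r.
have h2 : brho Ps <= brho (bind R (mE n) + bkk X (eta / 2)).
  apply: brho_aele; apply: filterS3 ae_toep ae_herm ae_pos => x ht hh hp.
  rewrite PsE bfD bind_x bkk_x raddfD/=; have [e|e] := leP (PsiC (arr x) (Hs n)) (eta / 2).
    by have /andP[h0 _] := ind01 R (E n) x; lra.
  have P0 : 0 < PsiC (arr x) (Hs n) by apply: lt_trans e; rewrite divr_gt0.
  have [j jn hj] := fejer_peak ht hh (fun a b => uc a b x) (Hs0 n) P0 (fun j _ => hp _ j _).
  have ht16 : tau <= PsiC (arr x) (Hs n) / 16 
    by rewrite (_ : tau = eta / 2 / 16); [rewrite ler_pM2r// ltW|rewrite /tau; field].
  rewrite ind1; last by apply: (thc_peak jn); exact: le_trans hj.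
  have : PsiC (arr x) (Hs n) <= 1.
    by apply: avg_ub => // a _; apply: avg_ub => // b _; exact: uc.
  by move=> h; apply: (le_trans h); rewrite lerDl divr_ge0// ltW.
move: h2; rewrite raddfD/= -[bkk X (eta / 2)]mulr1 brho_kk => h2.
have h3 : eta / 2 * brho 1 <= eta / 2.
  by rewrite ler_piMr ?divr_ge0 ?(ltW eta0)//; apply: brho_ub => x.
have -> : I (ind R (E n)) = brho (bind R (mE n)) by [].
have h4 := le_trans h1 h2; rewrite -(lerD2r (eta / 2)) -splitr.
by apply: (le_trans h4); rewrite lerD2l.
Qed.

Lemma mGd : measurable (lim_sup_set E).
Proof.
by apply: bigcap_measurable => // k _; apply: bigcup_measurable => j /= _; exact: mE.
Qed.

Lemma Gd_ge : ((eta / 2)%:E <= mu (lim_sup_set E))%E.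
Proof.
have hc : (fun n => mu (\bigcup_(k in [set k | (n <= k)%N]) E k)) @ \oo --> mu (lim_sup_set E).
  apply: (lim_sup_set_cvg mu) => //; apply: (le_lt_trans (probability_le1 mu _) (ltry 1)).
  by apply: bigcup_measurable => k /= _; exact: mE.
rewrite -(cvg_lim _ hc)//; apply: lime_ge; first by apply/cvg_ex; eexists; exact: hc.
apply: nearW => n; apply: le_trans (E_ge n) _; apply: le_measure; rewrite ?inE//.
  by apply: bigcup_measurable => k /= _; exact: mE.
by move=> x hx; exists n => /=.
Qed.

(** [G] is the indicator function of the points where a peak occurs for infinitely many windows, a
    set of measure at least [eta / 2]; [lam] is the exponential of [theta]. Both are invariant
    because they are computed from the invariant array. *)
Lemma freq_ex : exists G lam : S, [/\ bub G /\ G * bcj G = G, weq brho (bU mal s G) G,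
    lam * bcj lam = 1, weq brho (bU mal s lam) lam &
    forall K, (0 < K)%N -> eta / 32 * (eta / 2) <= avg K (fun a =>
        avg K (fun b => brho (G * (bcj lam ^+ a * lam ^+ b * c a b))))].
Proof.
exists (bind R mGd), lam; split.
- by split; [exact: bind_ub|rewrite bind_cj bind_idem].
- apply/weqP; apply: filterS ae_inv => x e; rewrite bU_x !bind_x /ind.
  have thE n : th n (al s x) = th n x by rewrite /th e.
  suff -> : lim_sup_set E (al s x) = lim_sup_set E x by [].
  by apply/propext; split => h n hn; have [k hk hE] := h n hn; exists k => //;
    move: hE; rewrite /E /= thE.
- by apply: bfE => x; rewrite bfM bcj_x; exact: eeJ.
- apply/weqP; apply: filterS ae_inv => x e; rewrite bU_x.
  by congr ee; rewrite /tht e.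
move=> K K0; rewrite -brho_WS.
have h1 : brho (bkk X tau * bind R mGd) <= brho (bind R mGd * WS lam K).
  apply: brho_aele; apply: filterS ae_mono => x hm.
  have -> : complex.Re ((bind R mGd * WS lam K) x) = ind R (lim_sup_set E) x * wf (arr x) K (tht x).
    by rewrite bfM bind_x Re_scale (WS_x K (l := lam) (t := tht x)).
  have -> : complex.Re ((bkk X tau * bind R mGd) x) = ind R (lim_sup_set E) x * tau.
    by rewrite bfM bkk_x Re_scale bind_x mulrC.
  rewrite /ind; case: asboolP => h /=; last by rewrite !mul0r.
  rewrite !mul1r; apply: theta_freq => //; first by move=> H j N N0; exact: hm.
    by move=> T; have [n hn hE] := h T Logic.I; exists n.
  by move=> n Kn; exact: Hs_dvd.
apply: le_trans h1; rewrite brho_kk ler_wpM2l//; first by rewrite /tau divr_ge0// ltW.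
by have := Gd_ge; rewrite -I_ind//; exact: mGd.
Qed.
End U2Freq.

(** * The system of a measure preserving action *)

Section System.
Context d (X : measurableType d) (R : realType) (mu : probability X R).
Variable al : {poly int} -> X -> X.
Hypothesis mal : forall g, measurable_fun setT (al g).
Hypothesis pal : forall g B, measurable B -> mu (al g @^-1` B) = mu B.
Hypothesis al0 : forall x, al 0 x = x.
Hypothesis alD : forall g h x, al g (al h x) = al (g + h) x.
Local Notation S := (bfun X R).
Local Notation U := (bU (R := R) mal).

Lemma bu2freq eta : 0 < eta -> exists2 kap, 0 < kap &
    forall (s : {poly int}) (D : nat) (c : nat -> nat -> S),
    (0 < D)%N -> (forall a b, bub (c a b)) ->
    (forall a b, weq (brho mu) (U s (c a b)) (c a b)) ->
    (forall a b, weq (brho mu) (c a.+1 b.+1) (c a b)) ->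
    (forall a b, weq (brho mu) (bcj (c a b)) (c b a)) ->
    (forall (z v : S) (W := fun M => avg M (fun a => avg M (fun b =>
       brho mu (v * bcj v * (bcj z ^+ a * z ^+ b * c a b))))),
     z * bcj z = 1 -> (forall h, U h z = z) -> weq (brho mu) (U s v) v ->
     (forall M, 0 <= W M) /\ (forall M N, (0 < M)%N -> (0 < N)%N -> W (N * M)%N <= W M)) ->
    (forall T, exists2 t, (T <= t)%N & eta <= avg (D * t`!) (fun a =>
       avg (D * t`!) (fun b => brho mu (c a b * bcj (c a b))))) ->
    exists G lam : S, [/\ bub G /\ G * bcj G = G, weq (brho mu) (U s G) G, lam * bcj lam = 1,
      weq (brho mu) (U s lam) lam & forall K, (0 < K)%N -> kap <= avg K (fun a =>
        avg K (fun b => brho mu (G * (bcj lam ^+ a * lam ^+ b * c a b))))].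
Proof.
move=> eta0; exists (eta / 32 * (eta / 2)); first by rewrite mulr_gt0// divr_gt0.
move=> s D c D0 uc ic ct ch hW hw.
have /choice[tn htn] T : exists t, (T <= t)%N /\ eta <= avg (D * t`!) (fun a =>
    avg (D * t`!) (fun b => brho mu (c a b * bcj (c a b)))).
  by have [t h1 h2] := hw T; exists t.
exact: (freq_ex D0 uc ic ct ch hW eta0 (fun n => (htn n).1) (fun n => (htn n).2)).
Qed.

Lemma bub_conv t (f g : S) : 0 <= t <= 1 -> bub f -> bub g ->
  bub (bkk X t * f + bkk X (1 - t) * g).
Proof. by move=> ht hf hg x; rewrite bfD !bfM !bkk_x; exact: n2_conv. Qed.

Lemma bub_unit (f : S) : f * bcj f = 1 -> bub f.
Proof.
move=> h x; have := congr1 (fun g : S => g x) h; rewrite fcj_x bf1.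
by move=> /(congr1 (@complex.Re R)) /= ->.
Qed.

Lemma bU_D g h (f : S) : U g (U h f) = U (g + h) f.
Proof.
apply: bfE => x; change (f (al h (al g x)) = f (al (g + h) x)).
rewrite alD.
have -> : h + g = g + h by exact: addrC.
by [].
Qed.

(** Transparent, so that [rho] of this system and [brho mu] are exchanged by conversion later. *)
Definition bsys : dsys R.
Proof.
refine (@Dsys R S (@bcj d X R) (@bkk d X R) (@brho d X R mu) (fun h => U h) (@bub d X R)
  _ _ _ (@brho_cj d X R mu) (@brho_ge0 d X R mu) _ _ _ _ _ _ _ _ _ _ bub_conv bub_unit
  _ _ (@bub_all d X R) (@bwmean d X R mu)
  (@bei d X R) (@bei_idem d X R) (@bei_cj d X R) (@bei_ub d X R) (@bei_ubC d X R) _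
  (@bei_weq d X R mu) (@bei_mul d X R) (@bei_abs d X R) (@bei_fix d X R mu)
  (@bthr d X R mu al mal) (@broots d X R al mal) bu2freq).
- by move=> f; apply: bfE => x; rewrite /= conjcK.
- by move=> r; apply: bfE => x; exact: conjc_real.
- exact: brho_kk.
- by move=> f; apply: bfE => x; rewrite bU_x al0.
- exact: bU_D.
- by move=> g f; apply: bfE.
- by move=> g r; apply: bfE.
- by move=> g f; exact: (brho_U mal pal).
- by move=> x; rewrite bf1 (n2C 1) expr1n.
- by move=> f g hf hg x; rewrite bfM n2M mulr_ile1 ?n2_ge0.
- by move=> f hf x; rewrite bfN n2N.
- by move=> f hf x; rewrite bcj_x n2J.
- by move=> g f hf x; rewrite bU_x.
- by move=> f g; exact: bub_sq.
- by move=> f hf; apply: brho_ub => x; exact: bub_re.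
- by move=> h u; exact: bei_U.
Defined.
End System.

(** * Lower bound for the integral of a product of projections *)

Section Bound.
Context d (X : measurableType d) (R : realType) (mu : probability X R).
Variable al : {poly int} -> X -> X.
Hypothesis mal : forall g, measurable_fun setT (al g).
Hypothesis pal : forall g B, measurable B -> mu (al g @^-1` B) = mu B.
Hypothesis al0 : forall x, al 0 x = x.
Hypothesis alD : forall g h x, al g (al h x) = al (g + h) x.
Local Notation S := (bfun X R).
Local Notation Y := (@bsys _ X R mu al mal pal al0 alD).
Local Notation I := (I mu).

(** The exponential of the sum separates the two sides: [1 + x <= expR x] is used for the sum, and
    with [x = y^-1 - 1] for each factor. *)
Lemma prod_ge_exp k (y : nat -> R) : (forall i, 0 < y i) ->
  1 + \sum_(i < k) (1 - (y i)^-1) <= \prod_(i < k) y i.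
Proof.
move=> y0; apply: (le_trans (expR_ge1Dx _)).
elim: k => [|k IH]; first by rewrite !big_ord0 expR0.
rewrite !big_ord_recr/= expRD ler_pM ?expR_ge0//.
rewrite -[1 - _]opprB expRN -[leRHS]invrK lef_pV2 ?posrE ?invr_gt0 ?expR_gt0//.
by have := @expR_ge1Dx R ((y k)^-1 - 1); congr (_ <= _); ring.
Qed.

Lemma prod_ge k (g : nat -> R) a : 0 <= a -> (forall i, 0 < g i) ->
  a ^+ k * (1 + \sum_(i < k) (1 - a * (g i)^-1)) <= \prod_(i < k) g i.
Proof.
rewrite le_eqVlt => /predU1P[<-|a0] g0.
  case: k => [|k]; first by rewrite !big_ord0 expr0 addr0 mulr1.
  by rewrite exprS !mul0r prodr_ge0// => i _; exact: ltW.
have h := @prod_ge_exp k (fun i => g i / a) (fun i => divr_gt0 (g0 i) a0).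
have -> : \prod_(i < k) g i = a ^+ k * \prod_(i < k) (g i / a).
  rewrite big_split/= prodr_const card_ord exprVn mulrCA divff ?mulr1//.
  by rewrite expf_neq0// gt_eqF.
rewrite ler_wpM2l ?exprn_ge0 ?(ltW a0)//; apply: le_trans h.
by under [in leRHS]eq_bigr do rewrite invfM invrK mulrC.
Qed.

Lemma prod_eps k (F : nat -> R) e : 0 < e <= 1 -> (forall i, 0 <= F i <= 1) ->
  \prod_(i < k) (F i + e) <= \prod_(i < k) F i + 2 ^+ k * e /\ 0 <= \prod_(i < k) F i <= 1.
Proof.
move=> /andP[e0 e1] hF.
suff h : \prod_(i < k) (F i + e) <= \prod_(i < k) F i + (2 ^+ k - 1) * e /\
    0 <= \prod_(i < k) F i <= 1.
  by case: h => h1 h2; split=> //; apply: (le_trans h1); lra.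
elim: k => [|k [IH1 /andP[IH2 IH3]]]; first by rewrite !big_ord0 expr0; split; lra.
rewrite !big_ord_recr/=; have /andP[F0 F1] := hF k.
move: IH1 IH2 IH3; set P := \prod_(i < k) F i; set Q := \prod_(i < k) (_ + _) => IH1 IH2 IH3.
have c0 : 0 <= 2 ^+ k - 1 :> R by rewrite subr_ge0 exprn_ege1// ler1n.
split; last by rewrite mulr_ge0//= mulr_ile1.
have : Q * (F k + e) <= (P + (2 ^+ k - 1) * e) * (F k + e) by rewrite ler_wpM2r//; lra.
move=> h; apply: (le_trans h); rewrite exprS.
move: c0; set c := 2 ^+ k - 1 => c0.
have -> : 2 * 2 ^+ k - 1 = 2 * c + 1 :> R by rewrite /c; ring.
have h1 : c * e * F k <= c * e by rewrite ler_piMr// mulr_ge0// ltW.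
have h2 : P * e <= e by rewrite ler_piMl// ltW.
have h3 : c * e * e <= c * e by rewrite ler_piMr// mulr_ge0// ltW.
have -> : (P + c * e) * (F k + e) = P * F k + c * e * F k + P * e + c * e * e by ring.
lra.
Qed.

Variables (A : set X) (mA : measurable A) (ss : nat -> {poly int}) (F : nat -> S).
Let f : S := bind R mA.
Hypothesis hF : forall i, @isP R Y (ss i) f (F i).

Let Fre i x := complex.Re (F i x).

Lemma F_real i : \forall x \ae mu, F i x = (Fre i x)%:C /\ 0 <= Fre i x <= 1.
Proof.
have hi := hF i; have hc := isP_cj hi.
have fc : cj (f : Y) = f by exact: bind_cj.
rewrite fc in hc; have /weqP e1 := isP_uniq (aeq_refl (A := Y) f) hi hc.
have [uF iF hy] := hi.
have e2 : \forall x \ae mu, 0 <= Fre i x.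
  apply: ae_ge0; first exact: mb_re.
  have mB : measurable [set y | complex.Re (F i y) < 0].
    rewrite (_ : [set x | _] = ~` [set x | 0 <= complex.Re (F i x)]); first exact/measurableC/meas_ge.
    by apply/seteqP; split => x /=; rewrite ltNge => /negP.
  have -> : I (fun x => ind R [set y | complex.Re (F i y) < 0] x * complex.Re (F i x)) =
      brho mu (bind R mB * F i).
    by congr (I _); apply: funext => x; rewrite bfM bind_x Re_scale.
  have -> : brho mu (bind R mB * F i) = brho mu (bind R mB * f).
    apply/esym; apply: hy; apply/weqP; move/weqP: iF; apply: filterS => x e.
    by rewrite bU_x !bind_x /ind /=; move: e; rewrite bU_x => ->.
  apply: I_ge0 => x; rewrite bfM !bind_x Re_scale.
  have /andP[h0 _] := ind01 R [set y | complex.Re (F i y) < 0] x.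
  by have /andP[h1 _] := ind01 R A x; exact: mulr_ge0.
apply: filterS2 e1 e2 => x e1 e2; rewrite e2 /Fre bub_re//; split=> //.
by move: e1; rewrite bcj_x; case: (F i x) => a b [] /= h; rewrite (_ : b = 0)//; lra.
Qed.

Variable e : R.
Hypothesis he : 0 < e <= 1.
(** The truncation and the added [e] make [g i] at least [e] everywhere, so that its inverse is a
    bounded function. *)
Let g i x : R := Num.max (Fre i x) 0 + e.

Let g0 i x : e <= g i x. Proof. by rewrite /g lerDr le_max lexx orbT. Qed.
Let ge0 i x : 0 < g i x.
Proof. by have /andP[h _] := he; exact: lt_le_trans (g0 i x). Qed.

Let mb_g i : mb (g i).
Proof.
have [mF [c hc]] := mb_re (F i); split; last first.
  exists (c + e) => x; rewrite gtr0_norm// /g lerD2r ge_max.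
  by rewrite (le_trans (ler_norm _) (hc x))/= (le_trans (normr_ge0 _) (hc x)).
by apply: measurable_funD => //; apply: measurable_maxr.
Qed.

Let mb_gV i : mb (fun x => (g i x)^-1).
Proof.
have /andP[e0 _] := he; split; last first.
  exists e^-1 => x; rewrite gtr0_norm ?invr_gt0// lef_pV2 ?posrE//.
have -> : (fun x => (g i x)^-1) = (fun x => powR (g i x) (-1)).
  by apply: funext => x; rewrite powR_inv1// ltW.
apply: (@measurableT_comp _ _ _ _ _ _ (fun a => powR a (-1))); last exact: (mb_g i).1.
exact: measurable_powR.
Qed.

(** [1 / g i] is invariant, so the indicator of [A] may be replaced by its projection [F i], which
    is at most [g i]. *)
Lemma int_inv i : I (fun x => ind R A x * (g i x)^-1) <= 1.
Proof.
have mq : mbc (fun x => ((g i x)^-1)%:C).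
  split => /=; [exact: (mb_gV i).1|exact: measurable_cst|].
  have [c hc] := (mb_gV i).2; exists (c ^+ 2) => x; rewrite n2C.
  by rewrite -[leLHS]real_normK ?num_real// lerXn2r ?nnegrE ?(le_trans _ (hc x)).
pose q : S := mkb mq; have [uF iF hy] := hF i.
have iq : @inv R Y (ss i) q.
  apply/weqP; move/weqP: iF; apply: filterS => x ex.
  have ex' : F i (al (ss i) x) = F i x by exact: ex.
  change (((g i (al (ss i) x))^-1)%:C = ((g i x)^-1)%:C).
  by rewrite /g /Fre ex'.
have -> : I (fun x => ind R A x * (g i x)^-1) = brho mu (q * f).
  by congr (I _); apply: funext => x; rewrite bfM bind_x mulrC Re_scale.
have := hy q iq; rewrite -[rho _]/(brho mu (q * f)) -[RHS]/(brho mu (q * F i)) => ->.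
apply: brho_ub => x; rewrite bfM Re_scale -/(Fre i x) mulrC ler_pdivrMr// mul1r.
by have /andP[e0 _] := he; rewrite /g; apply: (@le_trans _ _ (Num.max (Fre i x) 0));
  rewrite ?le_max ?lexx// lerDl ltW.
Qed.

(** Integrate [prod_ge] over [A] with [a] the measure of [A]. By [int_inv] the subtracted terms
    integrate to at most [a ^+ k.+1 * k], which cancels against the same amount and leaves
    [a ^+ k.+1]; the summand [2 ^+ k * e] pays for the regularisation by [e]. *)
Lemma PP_prod k : fine (mu A) ^+ k.+1 <= brho mu (f * \prod_(i < k) F i) + 2 ^+ k * e.
Proof.
set a := fine (mu A); have aE : a = I (ind R A) by rewrite /a I_ind_fine.
have a0 : 0 <= a by rewrite /a fine_ge0.
have mg : mb (fun x => \prod_(i < k) g i x).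
  elim: k => [|k IH].
    by rewrite (_ : (fun _ => _) = (fun=> 1)); [exact: mb_cst|apply: funext => x; rewrite big_ord0].
  rewrite (_ : (fun _ => _) = (fun x => \prod_(i < k) g i x * g k x)); first exact: mbM.
  by apply: funext => x; rewrite big_ord_recr.
have mi := mb_ind R mA.
have mig i : mb (fun x => ind R A x * (g i x)^-1) by exact: mbM.
have msum j : mb (fun x => \sum_(i < j) (ind R A x * (g i x)^-1)).
  exact: (@mb_sum _ X R _ _ (fun (i : 'I_j) x => ind R A x * (g i x)^-1) (fun i => mig i)).
have h1 : a ^+ k.+1 <= I (fun x => ind R A x * \prod_(i < k) g i x).
  apply: (@le_trans _ _ (I (fun x => a ^+ k * (ind R A x * (1 + k%:R)) + (- (a ^+ k * a)) *
      \sum_(i < k) (ind R A x * (g i x)^-1)))).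
    have ms : mb (fun x => \sum_(i < k) (ind R A x * (g i x)^-1)).
      by exact: msum.
    have m1 : mb (fun x => ind R A x * (1 + k%:R)) by apply: mbM => //; exact: mb_cst.
    rewrite ID; [|exact: mbZ|exact: mbZ].
    rewrite !IZ//.
    have -> : I (fun x => ind R A x * (1 + k%:R)) = a * (1 + k%:R).
      rewrite aE mulrC -IZ//; congr (I _); apply: funext => x; exact: mulrC.
    have hs : I (fun x => \sum_(i < k) (ind R A x * (g i x)^-1)) <= k%:R.
      have -> : I (fun x => \sum_(i < k) (ind R A x * (g i x)^-1)) =
          \sum_(i < k) I (fun x => ind R A x * (g i x)^-1).
        clear ms m1 mg; elim: k => [|j IH].
          rewrite big_ord0 -[RHS](I_cst mu); congr (I _); apply: funext => x.
          by rewrite big_ord0.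
        rewrite big_ord_recr/= -IH -(ID mu (msum j) (mig j)).
        by congr (I _); apply: funext => x; rewrite big_ord_recr.
      rewrite -[k in k%:R]card_ord -sumr_const; apply: ler_sum => i _; exact: int_inv.
    have ak : 0 <= a ^+ k * a by rewrite mulr_ge0// exprn_ge0.
    have : a ^+ k * a * I (fun x => \sum_(i < k) (ind R A x * (g i x)^-1)) <= a ^+ k * a * k%:R.
      by rewrite ler_wpM2l.
    rewrite exprSr; lra.
  apply: I_le.
  - by apply: mbD; apply: mbZ; [apply: mbM => //; exact: mb_cst|exact: msum].
  - exact: mbM.
  move=> x; have := prod_ge k a0 (fun i => ge0 i x); rewrite /ind; case: asboolP => /= _ h.
    under eq_bigr do rewrite mul1r.
    rewrite !mul1r; apply: le_trans h; rewrite sumrB -mulr_sumr sumr_const card_ord.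
    lra.
  rewrite !mul0r mulr0 add0r big1 ?mulr0// => i _; exact: mul0r.
apply: (le_trans h1).
have mfp : mb (fun x => complex.Re ((f * \prod_(i < k) F i) x)) by exact: mb_re.
have /andP[e0 e1] := he.
rewrite -[2 ^+ k * e](I_cst mu) -ID//; last exact: mb_cst.
apply: I_aele; [exact: mbM|by apply: mbD => //; exact: mb_cst|].
have hall : \forall x \ae mu, forall i, F i x = (Fre i x)%:C /\ 0 <= Fre i x <= 1.
  by apply: ae_foralln => i; exact: F_real.
apply: filterS hall => x hx.
have pE : (\prod_(i < k) F i) x = (\prod_(i < k) Fre i x)%:C.
  clear -hx; elim: k => [|k IH]; first by rewrite !big_ord0 bf1.
  by rewrite !big_ord_recr bfM IH (hx k).1 rmorphM.
rewrite bfM bind_x Re_scale pE.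
have [p1 /andP[p2 p3]] := prod_eps k he (fun i => (hx i).2).
have -> : \prod_(i < k) g i x = \prod_(i < k) (Fre i x + e).
  by apply: eq_bigr => i _; rewrite /g max_l//; have /andP[] := (hx i).2.
have h2 : 0 <= 2 ^+ k * e by rewrite mulr_ge0 ?exprn_ge0// ltW.
rewrite /ind; case: asboolP => _ /=; first by rewrite !mul1r.
by rewrite !mul0r add0r.
Qed.
End Bound.

(** * The polynomial group acting through commuting maps *)

Section ZPower.
Variables (X : Type) (T T' : X -> X).
Hypotheses (TK : cancel T T') (KT : cancel T' T).

Definition ipow (z : int) : X -> X :=
  match z with Posz n => iter n T | Negz n => iter n.+1 T' end.

Lemma ipowS z x : ipow (z + 1) x = T (ipow z x).
Proof.
case: z => [n|[|n]]; first by rewrite addrC.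
  by rewrite /= KT.
rewrite (_ : Negz n.+1 + 1 = Negz n); last by lia.
by rewrite /= KT.
Qed.

Lemma ipowP z x : ipow (z - 1) x = T' (ipow z x).
Proof. by rewrite -{2}[z](subrK 1) ipowS TK. Qed.

Lemma ipowD a b x : ipow (a + b) x = ipow a (ipow b x).
Proof.
elim: a => [|n IH|n IH]; first by rewrite add0r.
  by rewrite -addn1 PoszD -addrA [1 + b]addrC addrA !ipowS IH.
rewrite -addn1 PoszD opprD -addrA [-1 + b]addrC addrA.
by rewrite !ipowP IH.
Qed.

Lemma ipow_comm (h : X -> X) a x : (forall x, h (T x) = T (h x)) -> h (ipow a x) = ipow a (h x).
Proof.
move=> hT; have hT' y : h (T' y) = T' (h y) by rewrite -{2}[y]KT hT TK.
have hi (g : X -> X) n y : (forall y, h (g y) = g (h y)) -> h (iter n g y) = iter n g (h y).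
  by move=> hg; elim: n => //= n IH; rewrite hg IH.
by case: a => n; exact: hi.
Qed.
End ZPower.

Section Action.
Variables (X : Type) (Ts Ts' : nat -> X -> X).
Hypotheses (TK : forall k, cancel (Ts k) (Ts' k)) (KT : forall k, cancel (Ts' k) (Ts k)).
Hypothesis TC : forall j k x, Ts j (Ts k x) = Ts k (Ts j x).

(** The coefficient of ['X^k] is the exponent of the [k]-th map; coefficients of index at least [l]
    act trivially. *)
Definition act (l : nat) (g : {poly int}) (x : X) : X :=
  foldr (fun k => ipow (Ts k) (Ts' k) g`_k) x (iota 0 l).

Let fold (r : seq nat) (g : {poly int}) (x : X) : X :=
  foldr (fun k => ipow (Ts k) (Ts' k) g`_k) x r.

Let ipowC j k a b x : ipow (Ts j) (Ts' j) a (ipow (Ts k) (Ts' k) b x) =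
  ipow (Ts k) (Ts' k) b (ipow (Ts j) (Ts' j) a x).
Proof.
apply: (ipow_comm (TK k) (KT k)) => y; apply/esym.
by apply: (ipow_comm (TK j) (KT j)) => z; exact: TC.
Qed.

Lemma act_0 l x : act l 0 x = x.
Proof. by rewrite /act; elim: (iota 0 l) => //= k r ->; rewrite coef0. Qed.

Lemma act_D l g h x : act l g (act l h x) = act l (g + h) x.
Proof.
rewrite /act -!/(fold _ _ _); elim: (iota 0 l) => //= k r IH.
rewrite coefD (ipowD (TK k) (KT k)) -IH; congr (ipow _ _ _ _).
have c y b : fold r g (ipow (Ts k) (Ts' k) b y) = ipow (Ts k) (Ts' k) b (fold r g y).
  by elim: (r) => //= j s ->; exact: ipowC.
exact: c.
Qed.

Lemma act_X l k (z : int) x : (k < l)%N -> act l ('X^k *~ z) x = ipow (Ts k) (Ts' k) z x.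
Proof.
move=> kl; rewrite /act.
have cE j : ('X^k *~ z : {poly int})`_j = if j == k then z else 0.
  have -> : ('X^k *~ z : {poly int}) = z *: 'X^k by rewrite -mul_polyC -[z in RHS]intz rmorph_int mulrzl.
  by rewrite coefZ coefXn; case: eqP; rewrite ?mulr1 ?mulr0.
have hn r : k \notin r -> foldr (fun j => ipow (Ts j) (Ts' j) ('X^k *~ z)`_j) x r = x.
  elim: r => //= j r IH; rewrite inE negb_or => /andP[kj /IH ->].
  by rewrite cE eq_sym (negbTE kj).
have : k \in iota 0 l by rewrite mem_iota.
elim: (iota 0 l) (iota_uniq 0 l) => //= j r IH /andP[jr ur].
rewrite inE cE; have [e|kj] := eqVneq k j => h; first by rewrite -e hn// e.
by rewrite /= IH.
Qed.

Lemma act_ind (P : (X -> X) -> Prop) l g : P id ->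
  (forall u v, P u -> P v -> P (u \o v)) -> (forall k, P (Ts k)) -> (forall k, P (Ts' k)) ->
  P (act l g).
Proof.
move=> P0 PC PT PT'; have Pi h n : P h -> P (iter n h).
  by move=> Ph; elim: n => [|n IH] //; exact: (PC _ _ Ph IH).
have Pz k z : P (ipow (Ts k) (Ts' k) z) by case: z => n; exact: Pi.
by rewrite /act; elim: (iota 0 l) => [|k r IH] //; exact: (PC _ _ (Pz k _) IH).
Qed.
End Action.

(** * Correlations as measures of intersections *)

Section Intersection.
Context d (X : measurableType d) (R : realType) (mu : probability X R).
Variable al : {poly int} -> X -> X.
Hypothesis mal : forall g, measurable_fun setT (al g).
Hypothesis pal : forall g B, measurable B -> mu (al g @^-1` B) = mu B.
Hypothesis al0 : forall x, al 0 x = x.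
Hypothesis alD : forall g h x, al g (al h x) = al (g + h) x.
Local Notation S := (bfun X R).
Local Notation Y := (@bsys _ X R mu al mal pal al0 alD).
Variables (A : set X) (mA : measurable A).
Local Notation f := (bind R mA : Y).

Lemma VV_ind (ks : seq nat) i N x :
  (VV i [seq 'X^k : {poly int} | k <- ks] (nseq (size ks) f) N : S) x =
  (ind R [set x | forall j, (j < size ks)%N ->
    A (al ('X^(i + j) *~ (N ^ nth 0 ks j)%N) x)] x)%:C.
Proof.
elim: ks i => [|k ks IH] i; first by rewrite ind1.
pose u : S := U ('X^i *~ ('X^k : {poly int}).[N%:Z]) f.
pose v : S := VV i.+1 [seq 'X^k : {poly int} | k <- ks] (nseq (size ks) f) N.
have -> : (VV i [seq 'X^k : {poly int} | k <- k :: ks] (nseq (size (k :: ks)) f) N : S) = u * v.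
  exact: erefl.
rewrite bfM /v IH; set B := [set y | _]; set C := [set y | _].
have -> : u x = (ind R A (al ('X^i *~ (N ^ k)%N) x))%:C.
  have eN : ('X^k : {poly int}).[N%:Z] = (N ^ k)%N%:Z.
    by rewrite hornerXn -[N%:Z]natz -natrX natz.
  by rewrite /u eN.
rewrite -rmorphM; congr (_%:C).
have hC : C x <-> A (al ('X^i *~ (N ^ k)%N) x) /\ B x.
  split=> [h|[h1 h2] [|j] jn].
  - split; first by have := h 0%N isT; rewrite addn0.
    by move=> j jn; have := h j.+1 jn; rewrite addnS addSn.
  - by rewrite addn0.
  - by have := h2 j jn; rewrite addnS addSn.
have [a|a] := pselect (A (al ('X^i *~ (N ^ k)%N) x)); last first.
  by rewrite (ind0 _ a) mul0r ind0// => /hC[].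
rewrite (ind1 _ a) mul1r; have [b|b] := pselect (B x).
  by rewrite (ind1 _ b) ind1//; exact/hC.
by rewrite (ind0 _ b) ind0// => /hC[].
Qed.
End Intersection.

(** * Bounded gaps *)

Lemma srt_Xn (ks : seq nat) : sorted ltn ks -> all (fun k => 0 < k)%N ks ->
  srt [seq 'X^k : {poly int} | k <- ks].
Proof.
move=> hs h0; have hp : path ltn 0 ks by case: ks hs h0 => //= k ks -> /andP[->].
rewrite /srt -map_comp (eq_map (g := succn)); last by move=> k /=; rewrite size_polyXn.
by rewrite (@path_map _ _ succn ltn 0).
Qed.

Theorem theorem1p3 (R : realType) (disp : measure_display)
    (X : measurableType disp) (mu : probability X R)
    (l : nat) (hl : (0 < l)%N) (T : 'I_l -> X -> X)
    (hT : forall i : 'I_l, invertible_measure_preserving mu (T i))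
    (hcomm : forall i j : 'I_l, T i \o T j = T j \o T i)
    (A : set X) (hA : measurable A)
    (d : 'I_l -> nat) (hd : forall i : 'I_l, (0 < d i)%N)
    (hdinj : injective d)
    (eps : R) (heps : 0 < eps) :
  bounded_gaps
    [set n : nat | (0 < n)%N /\
      (mu A ^+ l.+1 - eps%:E <=
       mu (A `&` \bigcap_(i in [set: 'I_l])
                   (iter (n ^ d i)%N (T i) @^-1` A)))%E].
Proof.
have /choice[T' hT'] i : exists T' : X -> X,
    [/\ cancel (T i) T', cancel T' (T i) & measurable_fun [set: X] T'].
  by have [_ [T' h]] := hT i; exists T'.
(* Sorting the indices makes the exponents strictly increasing. The action is indexed by position in
   this order; positions beyond [l] default to [i0]. *)
pose i0 := Ordinal hl; pose s := sort (fun i j => d i <= d j)%N (enum 'I_l).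
have szs : size s = l by rewrite size_sort size_enum_ord.
pose sk k := nth i0 s k; pose Ts k := T (sk k); pose Ts' k := T' (sk k).
have TK k : cancel (Ts k) (Ts' k) by have [] := hT' (sk k).
have KT k : cancel (Ts' k) (Ts k) by have [] := hT' (sk k).
have TC j k x : Ts j (Ts k x) = Ts k (Ts j x).
  exact: (congr1 (fun g => g x) (hcomm (sk j) (sk k))).
pose mp (u : X -> X) := measurable_fun [set: X] u /\
  forall B, measurable B -> mu (u @^-1` B) = mu B.
have mp_al g : mp (act Ts Ts' l g).
  apply: act_ind => [|u v [mu1 pu] [mv pv]|k|k].
  - by split; [exact: measurable_id|].
  - split=> [|B mB]; first exact: measurableT_comp.
    by rewrite comp_preimage pv ?pu// -[X in measurable X]setTI; exact: mu1.
  - by have [[h1 h2] _] := hT (sk k).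
  - have [_ _ mS] := hT' (sk k); split=> // B mB.
    have mSB : measurable (Ts' k @^-1` B) by rewrite -[X in measurable X]setTI; exact: mS.
    have [[_ h2] _] := hT (sk k); rewrite -(h2 _ mSB); congr (mu _).
    by apply/seteqP; split => x /=; rewrite -/(Ts k) -/(Ts' k) TK.
pose al := act Ts Ts' l.
have mal g : measurable_fun setT (al g) by have [] := mp_al g.
have pal g B : measurable B -> mu (al g @^-1` B) = mu B by have [_] := mp_al g; exact.
have al0 x : al 0 x = x by exact: act_0.
have alD g h x : al g (al h x) = al (g + h) x by exact: act_D.
pose Y := @bsys _ X R mu al mal pal al0 alD.
pose f : Y := bind R hA; have uf : ub f by exact: bind_ub.
pose ks := [seq d i | i <- s]; pose ps := [seq 'X^k : {poly int} | k <- ks].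
have szk : size ks = l by rewrite size_map.
have szp : size ps = l by rewrite size_map.
have hs : srt ps.
  apply: srt_Xn; last by apply/allP => k /mapP[i _ ->].
  rewrite ltn_sorted_uniq_leq map_inj_uniq// sort_uniq enum_uniq/= sorted_map.
  by apply: sort_sorted => i j; exact: leq_total.
have hz p : p \in ps -> p.[0] = 0.
  by move=> /mapP[k /mapP[i _ ->] ->]; rewrite hornerXn expr0n gtn_eqF.
pose AN N := A `&` \bigcap_(i in [set: 'I_l]) (iter (N ^ d i)%N (T i) @^-1` A).
have mAN N : measurable (AN N).
  apply: measurableI => //; apply: fin_bigcap_measurable => // i _.
  have mi n : measurable_fun setT (iter n (T i)).
    elim: n => [|n IH]; first exact: measurable_id.
    by apply: (measurableT_comp _ IH); have [[] ] := hT i.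
  by rewrite -[X in measurable X]setTI; exact: mi.
have rhoE N : rho (f * VV 0 ps (nseq l f) N) = fine (mu (AN N)).
  pose v : bfun X R := VV 0 ps (nseq l f) N.
  have vE x := VV_ind mal pal al0 alD hA ks 0 N x.
  rewrite szk -/ps -/f -/v in vE.
  change (brho mu (bind R hA * v) = fine (mu (AN N))).
  rewrite -I_ind_fine//; congr (I mu _); apply: funext => x.
  rewrite bfM vE bind_x Re_scale.
  set B := [set x | _].
  have hB : B x <-> (\bigcap_(i in [set: 'I_l]) (iter (N ^ d i)%N (T i) @^-1` A)) x.
    have e j : (j < l)%N -> al ('X^j *~ (N ^ nth 0 ks j)%N) x = iter (N ^ d (sk j))%N (T (sk j)) x.
      by move=> jl; rewrite /al act_X// (nth_map i0) ?szs.
    split=> [h i _|h j].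
      have il : (index i s < l)%N by rewrite -{2}szs index_mem mem_sort mem_enum.
      have := h (index i s) il; rewrite add0n e//.
      by rewrite /sk nth_index// mem_sort mem_enum.
    by rewrite add0n => jl; rewrite e//; exact: h.
  have [a|a] := pselect (A x); last by rewrite (ind0 _ a) mul0r ind0// => -[].
  rewrite (ind1 _ a) mul1r; have [b|b] := pselect (B x).
    by rewrite (ind1 _ b) ind1//; split=> //; exact/hB.
  by rewrite (ind0 _ b) ind0// => -[_ /hB].
(* Any mean will do for [m0], which serves to construct the projections; the mean along the bad
   windows is [m], below. *)
have [m0 [hm0 _]] := @window_mean R (fun=> 0%N) succn (fun n => ltnSn n).
(* [dl] is chosen so that the [l] replacements, each costing [3 * dl], lose [eps / 4] in all. *)
pose a := fine (mu A); pose dl := eps / (12 * l%:R).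
have l0 : (0 : R) < l%:R by rewrite ltr0n.
have dl0 : 0 < dl by rewrite divr_gt0// mulr_gt0.
have [r r0 hr] := good_r hm0 uf l (exprn_gt0 2 dl0).
pose u n := rho (f * VV 0 (map (aff r 0) ps) (nseq l f) n).
have uE n : u n = fine (mu (AN (n * r)%N)) by rewrite /u VV_aff addn0 rhoE.
apply: contrapT => hgap.
have hw j : exists w, forall k, (k < j.+1)%N -> u (w + k)%N <= a ^+ l.+1 - eps.
  (* Any [r * j.+2] consecutive integers contain [j.+1] consecutive multiples of [r]; a gap of that
     length gives a window of [j.+1] bad values of [n'], where [n = n' * r]. *)
  apply: contrapT => hn; apply: hgap; exists (r * j.+2)%N; split; first by rewrite muln_gt0 r0.
  move=> m mp0; apply: contrapT => hno; apply: hn; exists (m %/ r).+1 => k kj.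
  have hmr := divn_eq m r; have hmod := ltn_pmod m r0.
  rewrite leNgt; apply/negP => hlt; apply: hno; exists (((m %/ r).+1 + k) * r)%N; split; last by nia.
  split; first by rewrite muln_gt0 r0.
  rewrite uE in hlt; rewrite -/(AN _) -[mu A]fineK ?fin_num_measure//.
  rewrite -[mu (AN _)]fineK ?fin_num_measure//.
  by rewrite -EFin_expe -EFinB lee_fin; exact: ltW.
have /choice[w hw'] := hw.
have [m [hm hmw]] := @window_mean R w succn (fun n => ltnSn n).
have ufs n : ub (VV 0 (map (aff r 0) ps) (nseq l f) n).
  by apply: VV_ub; elim: (l) => //=.
have bu : bseq u by apply: bseq_rho => n; exact: ub_M.
have h1 : m u <= a ^+ l.+1 - eps.
  rewrite -[m u]opprK -(meanN hm)// lerNl; apply: hmw.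
    by have [B hB] := bu; exists B => n; rewrite normrN.
  move=> n; rewrite -[leLHS](avg_cst _ (ltn0Sn n)); apply: avg_le => k kn.
  by rewrite lerN2; exact: hw'.
have h2 : rho (f * \prod_(i < l) PP ('X^i *+ r) f) - l%:R * (3 * dl) <= m u.
  have := peel hm0 uf dl0 r0 hm uf _ hs hz; rewrite szp; apply.
  by move=> i r' il; exact: hr.
(* The regularisation loses at most [2 ^+ l * e <= eps / 4]; with the [eps / 4] of the replacements
   the total stays below [eps]. *)
pose e : R := Num.min 1 (eps / 4 / 2 ^+ l).
have he : 0 < e <= 1 by rewrite lt_min ltr01 !divr_gt0 ?exprn_gt0//= ge_min lexx.
have h3 := PP_prod (fun i => PPP hm0 ('X^i *+ r) uf) he l.
have h4 : 2 ^+ l * e <= eps / 4.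
  by rewrite mulrC -ler_pdivlMr ?exprn_gt0// /e ge_min lexx orbT.
have h5 : l%:R * (3 * dl) = eps / 4 by rewrite /dl; field; exact: lt0r_neq0.
have h6 : a ^+ l.+1 <= rho (f * \prod_(i < l) PP ('X^i *+ r) f) + 2 ^+ l * e by exact: h3.
by move: h1 h2 h4 h6; rewrite h5; lra.
Qed.
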